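(* Assume that $\mu_4<\infty$ and that the counting process $\{N(t);\,t\geq 0\}$ $\mathcal{D}$-averages in time to the random variable $\Lambda$. Let $\sigma^2:=\mathbb{V}X<\infty$ and $$\sigma_*^2:=\frac{\mu_4}{\mu_1^4}-\left(\frac{\mu_2}{\mu_1^2}\right)^2+4\left(\frac{\mu_2}{\mu_1^2}\right)^3-\frac{4\mu_2\mu_3}{\mu_1^5}.$$ Then $$\sqrt t\left(\widehat{\mathrm{CoVar}(X)}-\mathrm{CoVar}(X)\right)\stackrel{\mathcal{D}}{\longrightarrow}\frac{\mathrm{N}\left(0,\frac{\sigma_*^2\mu_1^2}{4\sigma^2}\right)}{\sqrt\Lambda}\quad\text{as } t\rightarrow\infty,$$ where the random variable $\mathrm{N}\left(0,\frac{\sigma_*^2\mu_1^2}{4\sigma^2}\right)$ is independent of $\Lambda$ and has the normal distribution with mean $0$ and variance $\frac{\sigma_*^2\mu_1^2}{4\sigma^2}$. If in addition $\mathbb{E}\{\Lambda^{-1}\}<\infty$ and $t\left(\widehat{\mathrm{CoVar}(X)}-\mathrm{CoVar}(X)\right)^2$ is uniformly integrable, then, as $t\to\infty$, $$\mathbb{E}\left\{\widehat{\mathrm{CoVar}(X)}\right\}\rightarrow\mathrm{CoVar}(X),\qquad \mathbb{V}\left\{\widehat{\mathrm{CoVar}(X)}\right\}\sim\frac{\sigma_*^2\mu_1^2\,\mathbb{E}\{\Lambda^{-1}\}}{4\sigma^2}\,\frac1t,$$ $$\mathrm{CoVar}\left(\widehat{\mathrm{CoVar}(X)}\right)\sim\frac{\sigma_*\mu_1^2\sqrt{\mathbb{E}\{\Lambda^{-1}\}}}{2\sigma^2}\,\frac{1}{\sqrt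 t},$$ and $\widehat{\mathrm{CoVar}(X)}$ is a consistent (i.e. convergent in probability to $\mathrm{CoVar}(X)$) and asymptotically unbiased estimator for $\mathrm{CoVar}(X)$.
   Context: $X$ is a positive random variable with variance $\mathbb{V}X$ and $\mu_\beta:=\mathbb{E}X^\beta\le\infty$. The coefficient of variation of a random variable $Y$ is $\mathrm{CoVar}(Y):=\sqrt{\mathbb{V}Y}/\mathbb{E}Y$. $X_1,X_2,\ldots$ are i.i.d. copies of $X$; $\{N(t);\,t\geq 0\}$ is a counting process (nonnegative integer-valued, nondecreasing in $t$) independent of the $X_i$'s. The sample coefficient of variation based on $X_1,\ldots,X_{N(t)}$ is $\widehat{\mathrm{CoVar}(X)}:=S/\overline X$, where $\overline X:=\frac{1}{N(t)}\sum_{i=1}^{N(t)}X_i$ and $S\ge0$ with $S^2:=\frac{1}{N(t)}\sum_{i=1}^{N(t)}(X_i-\overline X)^2$; on $\{N(t)=0\}$ it is set to $0$. The counting process $\mathcal{D}$-averages in time to $\Lambda$ if $N(t)/t\stackrel{\mathcal{D}}{\longrightarrow}\Lambda$ (convergence in distribution) as $t\to\infty$, where $\mathbb{P}[\Lambda>0]=1$. Uniform integrability is that of the family indexed by $t$. *)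

(* Defs.v *)
From HB Require Import structures.
From mathcomp Require Import all_boot all_order all_algebra finmap.
From mathcomp Require Import all_classical all_reals all_analysis.

Set Implicit Arguments.
Unset Strict Implicit.
Unset Printing Implicit Defensive.

Import Order.TTheory GRing.Theory Num.Theory.
Import numFieldNormedType.Exports.

Local Open Scope classical_set_scope.
Local Open Scope ring_scope.

(* Moments and the coefficient of variation.  The expectation and the variance
   of the library are extended real numbers; the quantities entering the
   formulas below are their real values, finiteness being stated separately on
   the extended real numbers where it is not automatic. *)

Section moments.
Context d (T : measurableType d) (R : realType) (P : probability T R).

Definition moment (X : T -> R) (k : nat) : R :=
  fine 'E_P[fun w => (X w ^+ k)%R].

Definition CoVar (Y : T -> R) : R :=
  Num.sqrt (fine 'V_P[Y]) / fine 'E_P[Y].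

Definition sigma_star2 (X : T -> R) : R :=
  moment X 4 / moment X 1 ^+ 4
  - (moment X 2 / moment X 1 ^+ 2) ^+ 2
  + 4 * (moment X 2 / moment X 1 ^+ 2) ^+ 3
  - 4 * moment X 2 * moment X 3 / moment X 1 ^+ 5.

Definition sigma_star (X : T -> R) : R := Num.sqrt (sigma_star2 X).

End moments.

Section sample.
Context (R : realType).
Implicit Types (x : nat -> R) (n : nat).

(* The sample of size n is x 0, ..., x n.-1. *)
Definition sample_mean x n : R := n%:R^-1 * \sum_(i < n) x i.

Definition sample_sd x n : R :=
  Num.sqrt (n%:R^-1 * \sum_(i < n) (x i - sample_mean x n) ^+ 2).

Definition sample_CoVar_of x n : R :=
  if n == 0%N then 0 else sample_sd x n / sample_mean x n.

Definition sample_CoVar (T : Type) (Xs : nat -> T -> R) (N : R -> T -> nat)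
    (t : R) (w : T) : R :=
  sample_CoVar_of (fun i => Xs i w) (N t w).

End sample.

Section independence.
Context d (T : measurableType d) (R : realType) (P : probability T R).

Definition indep_sets (F G : set (set T)) : Prop :=
  forall A B, F A -> G B -> P (A `&` B) = (P A * P B)%E.

Definition sigma_of d' (T' : measurableType d') (I : Type) (D : set I)
    (Y : I -> T -> T') : set (set T) :=
  <<s \bigcup_(i in D) preimage_set_system [set: T] (Y i) measurable >>.

Definition indep_RV d1 (T1 : measurableType d1) d2 (T2 : measurableType d2)
    (Y : T -> T1) (Z : T -> T2) : Prop :=
  indep_sets (preimage_set_system [set: T] Y measurable)
             (preimage_set_system [set: T] Z measurable).

Definition mutually_independent (I : choiceType) (Y : I -> T -> R) : Prop :=
  forall (J : {fset I}) (B : I -> set R),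
    (forall i, i \in J -> measurable (B i)) ->
    P (\bigcap_(i in [set` J]) (Y i @^-1` B i)) =
    (\prod_(i <- J) P (Y i @^-1` B i))%E.

End independence.

Definition same_law d1 (T1 : measurableType d1) d2 (T2 : measurableType d2)
    (R : realType) (P1 : probability T1 R) (P2 : probability T2 R)
    (Y1 : {RV P1 >-> R}) (Y2 : {RV P2 >-> R}) : Prop :=
  forall A : set R, measurable A ->
    distribution P1 Y1 A = distribution P2 Y2 A.

Definition iid_copies d (T : measurableType d) (R : realType)
    (P : probability T R) (X : {RV P >-> R}) (Xs : nat -> {RV P >-> R}) : Prop :=
  mutually_independent P (fun i => Xs i : T -> R) /\
  forall i, same_law (Xs i) X.

(* A process indexed by t >= 0 is represented by a function of t : R whose
   values at negative times are never used. *)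

Definition counting_process d (T : measurableType d) (R : realType)
    (P : probability T R) (N : R -> {RV P >-> nat}) : Prop :=
  forall w (s t : R), 0 <= s -> s <= t -> (N s w <= N t w)%N.

Definition process_indep d (T : measurableType d) (R : realType)
    (P : probability T R) (N : R -> {RV P >-> nat})
    (Xs : nat -> {RV P >-> R}) : Prop :=
  indep_sets P (sigma_of [set t : R | 0 <= t] (fun t => N t : T -> nat))
               (sigma_of [set: nat] (fun i => Xs i : T -> R)).

(* The normal law with mean m and variance v >= 0.  The library's normal_prob
   takes the standard deviation and is not a point mass when it vanishes;
   v = 0 does occur here (sigma_star2 X can be 0 for a non-constant X taking
   two values). *)
Definition normal_law (R : realType) (m v : R) : set R -> \bar R :=
  if v == 0 then dirac m else normal_prob m (Num.sqrt v).

Section modes_of_convergence.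
Context d (T : measurableType d) (R : realType) (P : probability T R).

(* Pointwise convergence of the distribution functions at the continuity points
   of the limit; the limit may live on another probability space. *)
Definition cvg_in_distribution d' (T' : measurableType d')
    (P' : probability T' R) (Y : R -> T -> R) (Z : T' -> R) : Prop :=
  forall x : R,
    {for x, continuous (fun y : R => P' [set w | Z w <= y])} ->
    P [set w | Y t w <= x] @[t --> +oo%R] --> P' [set w | Z w <= x].

Definition cvg_in_probability (Y : R -> T -> R) (a : R) : Prop :=
  forall eps : R, 0 < eps ->
    P [set w | eps < `|Y t w - a|] @[t --> +oo%R] --> 0%E.

Definition uniformly_integrable (I : Type) (D : set I) (Y : I -> T -> R) :
    Prop :=
  ereal_sup [set (\int[P]_(w in [set w | (c < `|Y i w|)%R]) `|Y i w|%:E)%E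
            | i in D] @[c --> +oo%R] --> 0%E.

Definition consistent (Y : R -> T -> R) (theta : R) : Prop :=
  cvg_in_probability Y theta.

Definition asymptotically_unbiased (Y : R -> T -> R) (theta : R) : Prop :=
  ('E_P[Y t] - theta%:E)%E @[t --> +oo%R] --> 0%E.

End modes_of_convergence.

Definition D_averages d (T : measurableType d) d' (T' : measurableType d')
    (R : realType) (P : probability T R) (P' : probability T' R)
    (N : R -> {RV P >-> nat}) (L : {RV P' >-> R}) : Prop :=
  cvg_in_distribution P P' (fun t w => (N t w)%:R / t) L /\
  P' [set w | 0 < L w] = 1%E.

(* The Landau notations require a canonical filter structure, which the library
   declares for \oo (on nat) but not for +oo. *)
Canonical pinfty_filterType (R : realType) :=
  FilterType (@pinfty_nbhs R) (@filter_filter _ _ _).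

(* f(t) ~ c g(t) as t -> +oo.  For c = 0 this is read, as usual, as
   f(t) = o(g(t)): being equivalent to the null function would instead mean
   vanishing identically near +oo. *)
Definition sim_const (R : realType) (f : R -> R) (c : R) (g : R -> R) : Prop :=
  (c != 0 -> f ~_ (@pinfty_nbhs R) (fun t => c * g t)) /\
  (c = 0 -> f =o_ (@pinfty_nbhs R) g).

(* Main.v *)
Require Import Defs.
From HB Require Import structures.
From mathcomp Require Import all_boot all_order all_algebra finmap.
From mathcomp Require Import all_classical all_reals all_analysis.
From mathcomp Require Import measurable_realfun.
From mathcomp Require Import ring lra.
Import Order.TTheory GRing.Theory Num.Theory.
Import numFieldNormedType.Exports.
Local Open Scope classical_set_scope.
Local Open Scope ring_scope.

Set Implicit Arguments.
Unset Strict Implicit.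
Unset Printing Implicit Defensive.

(** The statistic is a smooth function of the first two empirical moments: its square is
    m2 / m1^2 - 1.  Writing Cn for its value at a deterministic sample size n and C for the
    coefficient of variation, sqrt n (Cn - C) equals n^(-1/2) times the sum of infl (X_i), where
    infl is the influence function, up to an error O(n^(-1/2)) on the event where the normalized
    sums are bounded (linearization, which rests on delta_bound).  The function infl is centered,
    and its variance is the constant v = sigma_star2 mu_1^2 / (4 sigma^2) (infl_var; in particular
    v >= 0).  The central limit theorem therefore gives the limit N(0, v) at deterministic sample
    sizes (sample_CoVar_levy).

    The central limit theorem (clt_levy) is proved by Lindeberg's replacement method with a steep
    logistic test function.  It is stated as a two-sided inequality between distribution functions,
    with tolerances on the threshold and on the probability that do not depend on the threshold.
    This uniformity matters for the random sample size, and it covers v = 0, which occurs for some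
    two-point laws, where the limit is a point mass.

    Since N(t) is independent of the sample, the distribution function of sqrt t (hatC - C) at x is
    the expectation of p_t (N(t)), where p_t(n) is the probability that sqrt t (Cn - C) <= x
    (prob_random_index).  For n of order t, p_t(n) is close to the normal distribution function
    at x sqrt (n / t), and smaller n are unlikely because Lambda > 0 (index_average_close).
    If v > 0, this is a monotone, bounded and continuous function of the rate n / t, so that its
    expectation converges with N(t) / t to the expectation at Lambda, which is the distribution
    function at x of N(0, v) / sqrt Lambda (cdfr_ratio, random_index_limit).  If v = 0, the limit is
    0 and x sqrt (n / t) stays away from 0 for x != 0.  This proves the first part.

    For the second part, uniform integrability of the squared scaled error V_t turns weak convergence
    into convergence of the first two moments (wcvg_expectation_ui, wcvg_expectation_sqr_ui), first
    for truncated monotone functions and then by controlling the tails.  The moments of the limit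
    are 0 and v E(1 / Lambda); they are computed for a pair realized on a product space
    (exists_limit_pair).  With hatC = C + V_t / sqrt t, the mean is C + E V_t / sqrt t, the
    variance is (E V_t^2 - (E V_t)^2) / t, and the remaining claims follow. *)

(** * Gaussian integrals *)

Section lebesgue_affine.
Context (R : realType).
Notation leb := (@lebesgue_measure R).

Lemma measurable_affine (m s : R) : measurable_fun setT (fun x : R => m + s * x).
Proof.
by apply: measurable_funD => //; apply: measurable_funM.
Qed.

Lemma lebesgue_affine_preimage (m s : R) (A : set R) : s != 0 -> measurable A ->
  leb A = (`|s|%:E * leb ((fun x => m + s * x)%R @^-1` A))%E.
Proof.
move=> s0 mA.
pose F : measurableTypeR R -> measurableTypeR R := fun x => m + s * x.
have mF : measurable_fun setT F := measurable_affine m s.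
have s0' : 0 <= `|s| by [].
pose k := NngNum s0'.
pose mu : {measure set (measurableTypeR R) -> \bar R} :=
  mscale k (pushforward leb F).
rewrite (@lebesgue_measure_unique R (mu mF))//.
move=> X [[a b] _ <-] /=.
rewrite /mu /mscale/= /pushforward/=.
have [s_gt0|s_le0] := ltP 0 s.
  have -> : F @^-1` `]a, b] = `](a - m) / s, (b - m) / s]%classic.
    apply/seteqP; split=> x /=; rewrite !in_itv /= /F ltr_pdivrMr// ler_pdivlMr//;
      by move=> /andP[? ?]; apply/andP; split; lra.
  rewrite !lebesgue_measure_itv /= !lte_fin.
  have [ab|ba] := ltP a b; last first.
    by rewrite ltNge ler_pM2r ?invr_gt0// lerD2r ba/= mule0.
  rewrite ltr_pM2r ?invr_gt0// ltrD2r ab -EFinB -EFinM gtr0_norm//.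
  congr EFin; field; exact: s0.
have s_lt0 : s < 0 by rewrite lt_neqAle s0.
have -> : F @^-1` `]a, b] = `[(b - m) / s, (a - m) / s[%classic.
  apply/seteqP; split=> x /=; rewrite !in_itv /= /F ltr_ndivlMr// ler_ndivrMr//;
      by move=> /andP[? ?]; apply/andP; split; lra.
rewrite !lebesgue_measure_itv /= !lte_fin.
have [ab|ba] := ltP a b; last first.
  by rewrite ltNge ler_nM2r ?invr_lt0// lerD2r ba/= mule0.
rewrite ltr_nM2r ?invr_lt0// ltrD2r ab -EFinB -EFinM ltr0_norm//.
congr EFin; field; exact: s0.
Qed.

Lemma ge0_integral_affine (m s : R) (f : R -> \bar R) : s != 0 ->
  measurable_fun setT f -> (forall x, 0 <= f x)%E ->
  (\int[leb]_x f x = `|s|%:E * \int[leb]_x f (m + s * x)%R)%E.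
Proof.
move=> s0 mf f0.
pose F : measurableTypeR R -> measurableTypeR R := fun x => m + s * x.
have mF : measurable_fun setT F := measurable_affine m s.
have s0' : 0 <= `|s| by [].
pose k := NngNum s0'.
pose mu : {measure set (measurableTypeR R) -> \bar R} :=
  mscale k (pushforward leb F).
transitivity (\int[mu mF]_x f x)%E.
  by apply: eq_measure_integral => A mA _; exact: lebesgue_affine_preimage.
rewrite ge0_integral_mscale//=; congr (_ * _)%E.
by rewrite (@ge0_integral_pushforward _ _ _ _ _ F mF).
Qed.

End lebesgue_affine.

Section gaussian.
Context (R : realType).
Notation leb := (@lebesgue_measure R).

(** The normal law has the normal density as its Radon-Nikodym derivative. *)
Lemma ge0_integral_normal_prob (m s : R) (f : R -> \bar R) :
  measurable_fun setT f -> (forall x, 0 <= f x)%E ->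
  (\int[normal_prob m s]_x f x = \int[leb]_x (f x * (normal_pdf m s x)%:E))%E.
Proof.
move=> mf f0.
have dom : normal_prob m s `<< leb := normal_prob_dominates m s.
rewrite -(@Radon_Nikodym_SigmaFinite.change_of_variables _ _ _
  (normal_prob m s) leb dom f setT)//.
apply: ge0_ae_eq_integral => //.
- apply: emeasurable_funM => //.
  exact: measurable_int (Radon_Nikodym_SigmaFinite.f_integrable dom).
- apply: emeasurable_funM; first exact: mf.
  apply/measurable_EFinP; exact: measurable_normal_pdf.
- by move=> x _; rewrite mule_ge0// (Radon_Nikodym_SigmaFinite.f_ge0 dom).
- by move=> x _; rewrite mule_ge0// lee_fin normal_pdf_ge0.
- apply: ae_eqe_mul2l; apply: integral_ae_eq => //=.
  + exact: (Radon_Nikodym_SigmaFinite.f_integrable dom).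
  + apply/measurable_EFinP; exact: measurable_normal_pdf.
  + by move=> E _ mE; rewrite -(Radon_Nikodym_SigmaFinite.f_integral dom).
Qed.

Lemma normal_pdf_affine (m s x : R) : s != 0 ->
  `|s| * normal_pdf m s (m + s * x) = normal_pdf 0 1 x.
Proof.
move=> s0; rewrite !normal_pdfE ?oner_eq0// mulrA; congr (_ * _).
  rewrite /normal_peak -mulrnAr sqrtrM ?sqr_ge0// sqrtr_sqr invfM mulrA.
  by rewrite divff ?normr_eq0// expr1n -mulrnAr !mul1r.
rewrite /normal_fun; congr expR; field.
by rewrite s0.
Qed.

Lemma ge0_integral_normal_affine (m s : R) (f : R -> \bar R) : s != 0 ->
  measurable_fun setT f -> (forall x, 0 <= f x)%E ->
  (\int[normal_prob 0 1]_x f (m + s * x)%R = \int[normal_prob m s]_x f x)%E.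
Proof.
move=> s0 mf f0.
rewrite [RHS]ge0_integral_normal_prob// (@ge0_integral_affine _ m s)//.
- rewrite ge0_integral_normal_prob//; last first.
    exact: (measurableT_comp mf (measurable_affine m s)).
  rewrite -ge0_integralZl//.
  + apply: eq_integral => x _; rewrite muleCA -EFinM.
    by rewrite normal_pdf_affine.
  + apply: emeasurable_funM.
      exact: (measurableT_comp mf (measurable_affine m s)).
    apply/measurable_EFinP.
    exact: (measurableT_comp (measurable_normal_pdf m s) (measurable_affine m s)).
  + by move=> x _; rewrite mule_ge0// lee_fin normal_pdf_ge0.
- apply: emeasurable_funM; first exact: mf.
  apply/measurable_EFinP; exact: measurable_normal_pdf.
- by move=> x; rewrite mule_ge0// lee_fin normal_pdf_ge0.
Qed.

Lemma normal_prob_affine (m s : R) (A : set R) : s != 0 -> measurable A ->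
  normal_prob 0 1 [set x | A (m + s * x)] = normal_prob m s A.
Proof.
move=> s0 mA.
have mB : measurable [set x | A (m + s * x)].
  by rewrite -[X in measurable X]setTI; exact: (measurable_affine m s).
have -> : normal_prob m s A = (\int[normal_prob m s]_x (\1_A x)%:E)%E.
  by rewrite integral_indic// setIT.
rewrite -(@ge0_integral_normal_affine m s (EFin \o \1_A))//; last 2 first.
- by apply/measurable_EFinP; exact: measurable_indic.
- by move=> x /=; rewrite lee_fin.
rewrite -[RHS]/(\int[normal_prob 0 1]_x (\1_[set x | A (m + s * x)%R] x)%:E)%E.
by rewrite integral_indic// setIT.
Qed.

Lemma ge0_integral_normal0_opp (f : R -> \bar R) :
  measurable_fun setT f -> (forall x, 0 <= f x)%E ->
  (\int[normal_prob 0 1]_x f (- x)%R = \int[normal_prob 0 1]_x f x)%E.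
Proof.
move=> mf f0.
have n1 : (-1 : R) != 0 by rewrite oppr_eq0 oner_eq0.
transitivity (\int[normal_prob 0 1]_x f (0 + -1 * x)%R)%E.
  by apply: eq_integral => x _; rewrite add0r mulN1r.
rewrite (@ge0_integral_normal_affine 0 (-1) f n1 mf f0).
rewrite (@ge0_integral_normal_prob 0 (-1) f mf f0).
rewrite (@ge0_integral_normal_prob 0 1 f mf f0).
apply: eq_integral => x _; congr (_ * EFin _)%E.
by rewrite !normal_pdfE ?oner_eq0// /normal_peak /normal_fun sqrrN.
Qed.

(** Multiplying the standard density by e^(a x^2), with a = (s^2 - 1) / (2 s^2), gives s times
    the density of N(0, s^2).  Hence the exponential moments of x^2, from which the second
    moment is extracted without integrating by parts. *)
Lemma normal_pdf_expR_sqr (s x : R) : 0 < s ->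
  expR ((s ^+ 2 - 1) / (2 * s ^+ 2) * x ^+ 2) * normal_pdf 0 1 x =
  s * normal_pdf 0 s x.
Proof.
move=> s0; rewrite !normal_pdfE ?oner_eq0 ?gt_eqF//.
have pk : s * normal_peak s = normal_peak 1.
  rewrite /normal_peak -[s ^+ 2 * pi *+ 2]mulrnAr sqrtrM ?sqr_ge0// sqrtr_sqr.
  by rewrite gtr0_norm// invfM mulrA divff ?gt_eqF// expr1n !mul1r.
rewrite [LHS]mulrCA [RHS]mulrA pk.
congr (_ * _); rewrite /normal_fun -expRD; congr expR; field.
by rewrite gt_eqF.
Qed.

Lemma integral_normal_expR_sqr (s : R) : 0 < s ->
  (\int[normal_prob 0 1]_x
     (expR ((s ^+ 2 - 1) / (2 * s ^+ 2) * x ^+ 2))%:E = s%:E)%E.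
Proof.
move=> s0; rewrite ge0_integral_normal_prob; first last.
- by move=> x; rewrite lee_fin expR_ge0.
- apply/measurable_EFinP; apply: (measurableT_comp (@measurable_expR R)).
  by apply: measurable_funM => //; exact: measurable_funX.
under eq_integral do rewrite -EFinM normal_pdf_expR_sqr// EFinM.
rewrite ge0_integralZl//=.
- by rewrite integral_normal_pdf mule1.
- apply/measurable_EFinP; exact: measurable_normal_pdf.
- by move=> x _; rewrite lee_fin normal_pdf_ge0.
- by rewrite lee_fin ltW.
Qed.

Lemma integrable_normal_expR_sqr (s : R) : 0 < s ->
  (normal_prob 0 1).-integrable setT
     (fun x : R => (expR ((s ^+ 2 - 1) / (2 * s ^+ 2) * x ^+ 2))%:E).
Proof.
move=> s0; apply/integrableP; split.
  apply/measurable_EFinP; apply: (measurableT_comp (@measurable_expR R)).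
  by apply: measurable_funM => //; exact: measurable_funX.
under eq_integral do rewrite gee0_abs ?lee_fin ?expR_ge0//.
by rewrite integral_normal_expR_sqr// ltry.
Qed.

Lemma integrable_normal_sqr :
  (normal_prob 0 1).-integrable setT (fun x : R => (x ^+ 2)%:E).
Proof.
have i2 := integrable_normal_expR_sqr (ltr0n R 2).
(* At s = 2 the exponent is (3/8) x^2, and x^2 <= (8/3) e^(3 x^2 / 8). *)
have : (normal_prob 0 1).-integrable setT
   (fun x : R => ((8 / 3)%:E * (expR ((2 ^+ 2 - 1) / (2 * 2 ^+ 2) * x ^+ 2))%:E)%E).
  exact: integrableZl.
apply: le_integrable => //.
  by apply/measurable_EFinP; exact: measurable_funX.
move=> x _ /=; rewrite lee_fin ger0_norm ?sqr_ge0// ger0_norm; last first.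
  by rewrite mulr_ge0 ?expR_ge0//; lra.
have := expR_ge1Dx ((2 ^+ 2 - 1) / (2 * 2 ^+ 2) * x ^+ 2).
move: (expR _) => e.
have := sqr_ge0 x; move: (x ^+ 2) => y; lra.
Qed.

(** The inequality 1 + u <= e^u at u = a x^2, with a of either sign, squeezes the second
    moment between functions of s that both tend to 1 as s -> 1. *)
Lemma normal_sqr_moment_le (s : R) : 0 < s ->
  (s ^+ 2 - 1) / (2 * s ^+ 2) * (\int[normal_prob 0 1]_x (x ^+ 2)) <= s - 1.
Proof.
move=> s0; set a := _ / _.
have is2 := integrable_normal_sqr.
have i1 : (normal_prob 0 1).-integrable setT (fun x : R => (1 : R)%:E).
  exact: finite_measure_integrable_cst.
rewrite lerBrDl -[X in X + _](_ : \int[normal_prob 0 1]_(x in setT) (1 : R) = 1); last first.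
  by rewrite Rintegral_cst// [X in fine X](probability_setT (normal_prob 0 1)) mulr1.
have ia : (normal_prob 0 1).-integrable setT (fun x : R => (a * x ^+ 2)%:E).
  exact: (integrableZl measurableT a is2).
rewrite -RintegralZl// -RintegralD//.
rewrite (_ : s = \int[normal_prob 0 1]_x (expR (a * x ^+ 2))); last first.
  by rewrite /Rintegral integral_normal_expR_sqr.
apply: le_Rintegral => //.
- exact: (integrableD measurableT i1 ia).
- exact: integrable_normal_expR_sqr.
- by move=> x _; exact: expR_ge1Dx.
Qed.

Lemma Rintegral_normal_sqr : \int[normal_prob 0 1]_x (x ^+ 2) = 1 :> R.
Proof.
have := normal_sqr_moment_le.
have : 0 <= \int[normal_prob 0 1]_x (x ^+ 2) :> R.
  by apply: Rintegral_ge0 => x _; exact: sqr_ge0.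
move: (\int[_]_x _) => I I0 H.
have H' s : 0 < s -> (s ^+ 2 - 1) * I <= (s - 1) * (2 * s ^+ 2).
  move=> s0; rewrite -ler_pdivrMr; last by rewrite mulr_gt0 ?exprn_gt0.
  by rewrite mulrAC; exact: H.
apply/eqP; rewrite eq_le; apply/andP; split; rewrite leNgt; apply/negP => I1.
- pose e := Num.min 1 ((I - 1) / 5).
  have e0 : 0 < e by rewrite lt_min ltr01 divr_gt0// subr_gt0.
  have e1 : e <= 1 by rewrite ge_min lexx.
  have e2 : e * 5 <= I - 1 by rewrite -ler_pdivlMr// ge_min lexx orbT.
  have := H' (1 + e) (addr_gt0 ltr01 e0).
  rewrite (_ : (1 + e) ^+ 2 - 1 = e * (2 + e)); last by ring.
  rewrite (_ : 1 + e - 1 = e); last by ring.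
  rewrite -[leLHS]mulrA ler_pM2l//; nra.
- pose e := (1 - I) / 5.
  have e0 : 0 < e by rewrite divr_gt0// subr_gt0.
  have e1 : e < 1 by rewrite /e; lra.
  have e2 : I = 1 - 5 * e by rewrite /e; lra.
  have := H' (1 - e); rewrite subr_gt0 => /(_ e1).
  rewrite (_ : (1 - e) ^+ 2 - 1 = - (e * (2 - e))); last by ring.
  rewrite (_ : 1 - e - 1 = - e); last by ring.
  rewrite !mulNr lerN2 -[leRHS]mulrA ler_pM2l//; nra.
Qed.

Lemma integrable_normal_id :
  (normal_prob 0 1).-integrable setT (fun x : R => x%:E).
Proof.
have i1 : (normal_prob 0 1).-integrable setT (fun x : R => (1 : R)%:E).
  exact: finite_measure_integrable_cst.
have := integrableD measurableT i1 integrable_normal_sqr.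
apply: le_integrable => //.
  by apply/measurable_EFinP; exact: measurable_id.
move=> x _ /=; rewrite lee_fin [leRHS]ger0_norm; last first.
  by rewrite addr_ge0// sqr_ge0.
have := sqr_ge0 (`|x| - 1); have := normr_ge0 x.
rewrite -(real_normK (num_real x)); move: `|x| => y; nra.
Qed.

End gaussian.

Section gaussian_semigroup.
Context (R : realType).
Notation leb := (@lebesgue_measure R).

Lemma Rintegral_normal_id : \int[normal_prob 0 1]_x x = 0 :> R.
Proof.
rewrite /Rintegral integralE.
set p := integral _ _ _; set q := integral _ _ _.
suff -> : p = q.
  have : q \is a fin_num by exact: integrable_neg_fin_num (integrable_normal_id R).
  by move=> /subee ->.
rewrite /p -ge0_integral_normal0_opp//.
- apply: eq_integral => x _.
  by rewrite funeposE funenegE /= EFinN.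
- apply: measurable_funepos; apply/measurable_EFinP; exact: measurable_id.
Qed.

(** Completing the square in m: the product of the densities is a density in u times a density
    in m, whose integral over m is 1. *)
Lemma normal_pdf_convolution (a b u m : R) : 0 < a -> 0 < b ->
  normal_pdf m b u * normal_pdf 0 a m =
  normal_pdf 0 (Num.sqrt (a ^+ 2 + b ^+ 2)) u *
  normal_pdf (a ^+ 2 * u / (a ^+ 2 + b ^+ 2))
             (a * b / Num.sqrt (a ^+ 2 + b ^+ 2)) m.
Proof.
move=> a0 b0; set c := Num.sqrt _.
have c2 : c ^+ 2 = a ^+ 2 + b ^+ 2 by rewrite sqr_sqrtr// addr_ge0// sqr_ge0.
have c0 : 0 < c by rewrite sqrtr_gt0 addr_gt0// exprn_gt0.
rewrite !normal_pdfE ?gt_eqF ?divr_gt0 ?mulr_gt0//.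
have pk (s : R) : 0 < s -> normal_peak s = s^-1 * (Num.sqrt (pi *+ 2))^-1.
  move=> s0; rewrite /normal_peak -[s ^+ 2 * pi *+ 2]mulrnAr sqrtrM ?sqr_ge0//.
  by rewrite sqrtr_sqr gtr0_norm// invfM.
rewrite mulrACA [RHS]mulrACA !pk ?divr_gt0 ?mulr_gt0//; congr (_ * _).
  have : (Num.sqrt (pi *+ 2))^-1 != 0 :> R.
    by rewrite invr_eq0 gt_eqF// sqrtr_gt0 mulrn_wgt0// pi_gt0.
  move: (_^-1) => k k0.
  by field; rewrite !gt_eqF.
rewrite /normal_fun -!expRD; congr expR.
rewrite -c2; have -> : b ^+ 2 = c ^+ 2 - a ^+ 2 by rewrite c2 addrC addKr.
have cE : c ^+ 2 - a ^+ 2 != 0.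
  by rewrite c2 addrC addKr gt_eqF// exprn_gt0.
rewrite !expr_div_n exprMn; have -> : b ^+ 2 = c ^+ 2 - a ^+ 2 by rewrite c2 addrC addKr.
field.
by rewrite cE !gt_eqF.
Qed.

Lemma measurable_normal_pdf2 (b : R) : b != 0 ->
  measurable_fun setT (fun p : R * R => normal_pdf p.1 b p.2).
Proof.
move=> b0.
rewrite (_ : (fun p : R * R => normal_pdf p.1 b p.2) =
  (fun p => normal_peak b * expR (- (p.2 - p.1) ^+ 2 / (b ^+ 2 *+ 2)))); last first.
  by apply/funext => p; rewrite normal_pdfE.
apply: measurable_funM => //; apply: (measurableT_comp (@measurable_expR R)).
apply: measurable_funM => //; apply: measurableT_comp => //.
apply: measurable_funX; apply: measurable_funB => //.
Qed.

(** Convolving N(0, a^2) with N(0, b^2) gives N(0, a^2 + b^2): exchange the two integrations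
    and use the factorization of the product of the densities. *)
Lemma ge0_integral_normal_semigroup (a b : R) (f : R -> \bar R) :
  0 <= a -> 0 <= b -> measurable_fun setT f -> (forall x, 0 <= f x)%E ->
  (\int[normal_prob 0 1]_y \int[normal_prob 0 1]_z f (a * y + b * z)%R =
   \int[normal_prob 0 1]_z f (Num.sqrt (a ^+ 2 + b ^+ 2) * z)%R)%E.
Proof.
move=> + + mf f0; rewrite le0r => /predU1P[->|a0].
  move=> b0; rewrite expr0n/= add0r sqrtr_sqr ger0_norm//.
  under eq_integral do under eq_integral do rewrite mul0r add0r.
  by rewrite integral_cst// [X in (_ * X)%E](probability_setT (normal_prob 0 1)) mule1.
rewrite le0r => /predU1P[->|b0].
  rewrite expr0n/= addr0 sqrtr_sqr gtr0_norm//.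
  apply: eq_integral => y _.
  under eq_integral do rewrite mul0r addr0.
  by rewrite integral_cst// [X in (_ * X)%E](probability_setT (normal_prob 0 1)) mule1.
set c := Num.sqrt _.
have c0 : 0 < c by rewrite sqrtr_gt0 addr_gt0// exprn_gt0.
have an0 : a != 0 by rewrite gt_eqF.
have bn0 : b != 0 by rewrite gt_eqF.
have cn0 : c != 0 by rewrite gt_eqF.
have mfpdf : measurable_fun setT
    (fun p : R * R => f p.2 * (normal_pdf p.1 b p.2)%:E)%E.
  apply: emeasurable_funM; first exact: (measurableT_comp mf).
  by apply/measurable_EFinP; exact: measurable_normal_pdf2.
pose h (m : R) := (\int[leb]_u (f u * (normal_pdf m b u)%:E))%E.
have mh : measurable_fun setT h.
  apply: (@measurable_fun_fubini_tonelli_F _ _ _ _ _ leb _ mfpdf) => p.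
  by rewrite mule_ge0// lee_fin normal_pdf_ge0.
have h0 m : (0 <= h m)%E.
  by apply: integral_ge0 => u _; rewrite mule_ge0// lee_fin normal_pdf_ge0.
transitivity (\int[normal_prob 0 1]_y h (0 + a * y)%R)%E.
  apply: eq_integral => y _.
  rewrite (@ge0_integral_normal_affine _ (a * y) b f bn0 mf f0) add0r.
  by rewrite (@ge0_integral_normal_prob _ (a * y) b f mf f0).
rewrite (@ge0_integral_normal_affine _ 0 a h an0 mh h0).
rewrite (@ge0_integral_normal_prob _ 0 a h mh h0).
transitivity (\int[normal_prob 0 1]_z f (0 + c * z)%R)%E; last first.
  by apply: eq_integral => z _; rewrite add0r.
rewrite (@ge0_integral_normal_affine _ 0 c f cn0 mf f0).
rewrite (@ge0_integral_normal_prob _ 0 c f mf f0).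
pose k (p : R * R) := (f p.2 * (normal_pdf p.1 b p.2 * normal_pdf 0 a p.1)%:E)%E.
have k0 p : (0 <= k p)%E by rewrite mule_ge0// lee_fin mulr_ge0// normal_pdf_ge0.
have mk : measurable_fun setT k.
  apply: emeasurable_funM; first exact: (measurableT_comp mf).
  apply/measurable_EFinP; apply: measurable_funM; first exact: measurable_normal_pdf2.
  exact: (measurableT_comp (measurable_normal_pdf 0 a)).
transitivity (\int[leb]_m \int[leb]_u k (m, u))%E.
  apply: eq_integral => m _; rewrite /h -ge0_integralZr//.
  - by apply: eq_integral => u _; rewrite /k/= EFinM muleA.
  - apply: emeasurable_funM => //; apply/measurable_EFinP.
    exact: measurable_normal_pdf.
  - by move=> u _; rewrite mule_ge0// lee_fin normal_pdf_ge0.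
  - by rewrite lee_fin normal_pdf_ge0.
rewrite (@fubini_tonelli _ _ _ _ _ leb leb k mk k0).
apply: eq_integral => u _.
under eq_integral do rewrite /k/= normal_pdf_convolution// -/c EFinM muleA.
rewrite ge0_integralZl//.
- by rewrite integral_normal_pdf mule1.
- apply/measurable_EFinP; exact: measurable_normal_pdf.
- by move=> m _; rewrite lee_fin normal_pdf_ge0.
- by rewrite mule_ge0// lee_fin normal_pdf_ge0.
Qed.

End gaussian_semigroup.

(** * Independence and integration *)

Section bounded_integrals.
Context d (T : measurableType d) (R : realType) (P : probability T R).

Lemma bounded_integrable (f : T -> R) (M : R) :
  measurable_fun setT f -> (forall w, `|f w| <= M) ->
  P.-integrable setT (EFin \o f).
Proof.
move=> mf fM; apply: measurable_bounded_integrable => //.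
- by rewrite -ge0_fin_numE// fin_num_measure.
- exists M; split; first exact: num_real.
  by move=> y My w _ /=; exact: (le_trans (fM w) (ltW My)).
Qed.

Lemma EFin_Rintegral (f : T -> R) : P.-integrable setT (EFin \o f) ->
  (\int[P]_w (f w)%:E)%E = (\int[P]_w f w)%:E.
Proof. by move=> i; rewrite /Rintegral fineK//; exact: integrable_fin_num. Qed.

Lemma Rintegral_cst_prob (r : R) : \int[P]_(w in setT) r = r.
Proof. by rewrite Rintegral_cst// [X in fine X]probability_setT mulr1. Qed.

Lemma Rintegral_bounded (f : T -> R) (M : R) :
  measurable_fun setT f -> (forall w, `|f w| <= M) -> `|\int[P]_w f w| <= M.
Proof.
move=> mf fM; have intf := bounded_integrable mf fM.
apply: (le_trans (le_normr_Rintegral _ intf)) => //.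
rewrite -[leRHS]Rintegral_cst_prob; apply: le_Rintegral => //.
- apply: (@bounded_integrable _ M); first exact: measurableT_comp.
  by move=> w; rewrite normr_id.
- exact: finite_measure_integrable_cst.
Qed.

End bounded_integrals.

Section independence_fubini.
Context d (T : measurableType d) (R : realType) (P : probability T R).
Context d1 (T1 : measurableType d1) d2 (T2 : measurableType d2).

(** The joint law of an independent pair is the product of the marginals, so that Tonelli's
    theorem applies. *)
Lemma ge0_integral_indep (Y : T -> T1) (Z : T -> T2) (f : T1 * T2 -> \bar R) :
  measurable_fun setT Y -> measurable_fun setT Z -> indep_RV P Y Z ->
  measurable_fun setT f -> (forall p, 0 <= f p)%E ->
  (\int[P]_w f (Y w, Z w) = \int[P]_w \int[P]_w' f (Y w, Z w'))%E.
Proof.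
move=> mY mZ YZ mf f0.
pose Y' : {mfun T >-> T1} := HB.pack Y (isMeasurableFun.Build _ _ _ _ Y mY).
pose Z' : {mfun T >-> T2} := HB.pack Z (isMeasurableFun.Build _ _ _ _ Z mZ).
have mYZ : measurable_fun setT (fun w => (Y w, Z w)) by exact/measurable_fun_pair.
pose YZ' : {mfun T >-> (T1 * T2)%type} :=
  HB.pack (fun w => (Y w, Z w)) (isMeasurableFun.Build _ _ _ _ _ mYZ).
pose m1 : probability T1 R := distribution P Y'.
pose m2 : probability T2 R := distribution P Z'.
pose m' : probability (T1 * T2)%type R := distribution P YZ'.
have E X : measurable X -> (m1 \x m2)%E X = m' X.
  apply: product_measure_unique => A B mA mB.
  transitivity (P ((setT `&` Y @^-1` A) `&` (setT `&` Z @^-1` B))).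
    by rewrite !setTI.
  rewrite YZ ?setTI//; first by exists A; rewrite ?setTI.
  by exists B; rewrite ?setTI.
transitivity (\int[m']_p f p)%E.
  by rewrite /m' (ge0_integral_distribution YZ').
transitivity (\int[(m1 \x m2)%E]_p f p)%E.
  by apply: eq_measure_integral => A mA _; apply/esym; exact: E.
rewrite fubini_tonelli1// /fubini_F (ge0_integral_distribution Y')//; last first.
- by move=> y; exact: integral_ge0.
- exact: (@measurable_fun_fubini_tonelli_F _ _ _ _ _ m2 f mf f0).
apply: eq_integral => w _ /=.
by rewrite (ge0_integral_distribution Z')//; exact: measurableT_comp.
Qed.

End independence_fubini.

Lemma ge0_integral_same_law d1 (T1 : measurableType d1) d2 (T2 : measurableType d2)
    (R : realType) (P1 : probability T1 R) (P2 : probability T2 R)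
    (Y1 : {RV P1 >-> R}) (Y2 : {RV P2 >-> R}) (f : R -> \bar R) :
  same_law Y1 Y2 -> measurable_fun setT f -> (forall x, 0 <= f x)%E ->
  (\int[P1]_w f (Y1 w) = \int[P2]_w f (Y2 w))%E.
Proof.
move=> sl mf f0.
rewrite -(ge0_integral_distribution Y1)// -(ge0_integral_distribution Y2)//.
by apply: eq_measure_integral => A mA _; exact: sl.
Qed.

Section partial_sums.
Context d (T : measurableType d) (R : realType) (P : probability T R).
Context (Xs : nat -> {RV P >-> R}) (h : R -> R).
Hypothesis mh : measurable_fun setT h.

Definition partial_sum (n : nat) (w : T) : R := \sum_(i < n) h (Xs i w).

Let cylinders (n : nat) : set (set T) :=
  [set A | exists2 B : nat -> set R, (forall i, measurable (B i)) &
    A = \bigcap_(i in [set i | (i < n)%N]) (Xs i @^-1` B i)].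

Lemma measurable_partial_sum n : measurable_fun setT (partial_sum n).
Proof.
apply: measurable_sum => i.
exact: (measurableT_comp mh).
Qed.

(** The events D such that D and Xs n^-1(B) are independent form a lambda-system; it contains
    the cylinders over the first n variables, which are stable under intersection, hence the
    sigma-algebra that they generate, for which the partial sum is measurable. *)
Lemma indep_partial_sum n : mutually_independent P (fun i => Xs i : T -> R) ->
  indep_RV P (partial_sum n) (Xs n).
Proof.
move=> indep A' B' [A mA <-] [B mB <-]; rewrite !setTI.
pose C := Xs n @^-1` B.
have mC : measurable C by rewrite -[C]setTI; exact: measurable_funP.
have mcyl D : cylinders n D -> measurable D.
  move=> [E mE ->]; apply: bigcap_measurableType => i _.
  by rewrite -[X in measurable X]setTI; exact: measurable_funP.
pose good := [set D | measurable D /\ P (D `&` C) = (P D * P C)%E].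
suff : <<s cylinders n >> `<=` good.
  move=> sub; suff /sub [] : <<s cylinders n >> (partial_sum n @^-1` A) by [].
  have mX (i : 'I_n) : measurable_fun setT (Xs i : g_sigma_algebraType (cylinders n) -> R).
    move=> _ D mD; rewrite setTI; apply: sub_sigma_algebra.
    exists (fun j => if j == i :> nat then D else setT) => [j|].
      by case: ifP.
    apply/seteqP; split => [w Dw j _ /=|w /(_ i (ltn_ord i)) /=].
      by case: eqP => // ->.
    by rewrite eqxx.
  have : measurable_fun setT (partial_sum n : g_sigma_algebraType (cylinders n) -> R).
    by apply: measurable_sum => i; exact: (measurableT_comp mh).
  by move=> /(_ measurableT _ mA); rewrite setTI.
apply: lambda_system_subset => //.
- move=> D E [D' mD ->] [E' mE ->]; exists (fun i => D' i `&` E' i).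
    by move=> i; exact: measurableI.
  apply/seteqP; split=> w /=.
    by move=> [Dw Ew] i ni; split; [exact: Dw|exact: Ew].
  by move=> H; split=> i ni; have [] := H i ni.
- split => //.
  + by split=> //; rewrite setTI probability_setT mul1e.
  + move=> D E ED [mD PD] [mE PE]; split; first exact: measurableD.
    have f0 (F : set T) : measurable F -> P F \is a fin_num by exact: fin_num_measure.
    rewrite (_ : (D `\` E) `&` C = (D `&` C) `\` (E `&` C)); last first.
      apply/seteqP; split=> w /=; first by move=> [[Dw nE] Cw]; split=> // -[].
      by move=> [[Dw Cw] nE]; split=> //; split=> // Ew; exact: nE.
    have -> : P (D `\` E) = (P D - P E)%E.
      by rewrite measureD// ?(setIidr ED)// ltey_eq f0.
    have -> : P ((D `&` C) `\` (E `&` C)) = (P D * P C - P E * P C)%E.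
      have mDC : measurable (D `&` C) by exact: measurableI.
      have mEC : measurable (E `&` C) by exact: measurableI.
      rewrite -PD -PE measureD//; last by rewrite ltey_eq f0.
      by rewrite (setIidr (@setSI _ C _ _ ED)).
    by rewrite muleBl ?f0// fin_num_adde_defr// f0.
  + move=> F ndF goodF; have mF i : measurable (F i) by have [] := goodF i.
    split; first exact: bigcupT_measurable.
    rewrite setI_bigcupl.
    have c1 : (P \o (fun k => F k `&` C)) n @[n --> \oo] --> P (\bigcup_k (F k `&` C)).
      apply: nondecreasing_cvg_mu.
      - by move=> i; exact: measurableI.
      - by apply: bigcupT_measurable => i; exact: measurableI.
      - by move=> i j ij; apply/subsetPset; apply: setSI; apply/subsetPset; exact: ndF.
    have c2 : (P \o F) n @[n --> \oo] --> P (\bigcup_k F k).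
      by apply: nondecreasing_cvg_mu => //; exact: bigcupT_measurable.
    apply/esym; apply: (cvg_unique _ _ c1) => //.
    rewrite (_ : P \o _ = fun k => (P (F k) * P C)%E); last first.
      by apply/funext => k /=; have [_ ->] := goodF k.
    by apply: cvgeZr => //; rewrite fin_num_measure.
- move=> D cD; split; first exact: mcyl.
  case: cD => {}B' mB' ->.
  pose J : {fset nat} := [fset i in iota 0 n]%fset.
  pose B2 i := if i == n then B else B' i.
  have Jlt i : (i \in J) = (i < n)%N by rewrite !inE /= mem_iota.
  have nJ : n \notin J by rewrite Jlt ltnn.
  have H1 := indep J B' (fun i _ => mB' i).
  have mB2 i : i \in (n |` J)%fset -> measurable (B2 i).
    by move=> _; rewrite /B2; case: ifP.
  have H2 := indep (n |` J)%fset B2 mB2.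
  have -> : (\bigcap_(i in [set i | (i < n)%N]) (Xs i @^-1` B' i) `&` C) =
     \bigcap_(i in [set` (n |` J)%fset]) (Xs i @^-1` B2 i).
    apply/seteqP; split=> w /=.
      move=> [H Cw] i /=; rewrite in_fset1U /B2 => /orP[/eqP ->|]; first by rewrite eqxx.
      by rewrite Jlt => ni; rewrite ltn_eqF//; exact: H.
    move=> H; split=> [i /= ni|].
      have := H i; rewrite /= in_fset1U Jlt ni orbT => /(_ isT).
      by rewrite /B2 ltn_eqF.
    by have := H n; rewrite /= in_fset1U eqxx => /(_ isT); rewrite /B2 eqxx.
  rewrite [LHS]H2 big_fsetU1//= /B2 eqxx -/C muleC; congr (_ * _)%E.
  rewrite (_ : \bigcap_(i in _) _ = \bigcap_(i in [set` J]) (Xs i @^-1` B' i)).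
    rewrite H1; apply: eq_big_seq => i; rewrite Jlt => ni.
    by rewrite ltn_eqF.
  by apply/seteqP; split=> w H i /= iJ; apply: H; move: iJ; rewrite /= Jlt.
Qed.

End partial_sums.

(** * Second-order expansion of the logistic function *)

Section taylor_logistic.
Context (R : realType).

Lemma ler_norm_of_bounds (x y : R) : - y <= x -> x <= y -> `|x| <= y.
Proof. by move=> yx xy; rewrite ler_norml yx xy. Qed.

Lemma le_min_of_le (x a b : R) : x <= a -> x <= b -> x <= Num.min a b.
Proof. by move=> xa xb; rewrite le_min xa xb. Qed.

(** f1 and f2 stand for the first two derivatives of f.  Of the two bounds on the remainder, the
    cubic one makes it negligible for small increments, while the quadratic one keeps it
    integrable when only second moments exist. *)
Definition taylor2 (f f1 f2 : R -> R) (B K : R) : Prop := forall x h : R,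
  `|f (x + h) - f x - f1 x * h - f2 x * (h ^+ 2 / 2)| <=
  Num.min (B * h ^+ 2) (K * `|h| ^+ 3).

(** Integrating a bound on the derivative raises the exponent by one; the factor 1 / (n + 1)
    is given up. *)
Lemma mvt_bound (f df : R -> R) (c : R) (n : nat) :
  (forall h : R, is_derive h 1 f (df h)) -> f 0 = 0 ->
  (forall h, `|df h| <= c * `|h| ^+ n) -> forall h, `|f h| <= c * `|h| ^+ n.+1.
Proof.
move=> Df f0 dfb h.
have c0 : 0 <= c.
  by have := le_trans (normr_ge0 _) (dfb 1); rewrite normr1 expr1n mulr1.
have cf a b : {within `[a, b], continuous f}.
  apply: derivable_within_continuous => x _.
  by have := Df x; move=> H; exact: ex_derive.
have key (a b : R) : a <= b -> a = 0 \/ b = 0 -> `|f b - f a| <= c * (b - a) ^+ n.+1.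
  move=> ab ab0; have [y + ->] := MVT_segment ab (fun x _ => Df x) (cf a b).
  rewrite in_itv/= => /andP[ay yb].
  rewrite normrM exprSr mulrA (ger0_norm (_ : 0 <= b - a)) ?subr_ge0//.
  rewrite ler_wpM2r ?subr_ge0//; apply: (le_trans (dfb y)); rewrite ler_wpM2l//.
  rewrite lerXn2r// ?nnegrE ?subr_ge0//.
  by case: ab0 => E; apply: ler_norm_of_bounds; lra.
have [h0|h0] := leP 0 h.
  by have := key 0 h h0 (or_introl erefl); rewrite f0 !subr0 (ger0_norm h0).
have := key h 0 (ltW h0) (or_intror erefl).
by rewrite f0 !sub0r normrN (ltr0_norm h0).
Qed.

Lemma is_derive_translate (f : R -> R) (df x h : R) :
  is_derive (x + h) 1 f df -> is_derive h 1 (fun h => f (x + h)) df.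
Proof.
move=> Df; rewrite -[df]mulr1; apply: (@is_derive1_comp _ f (fun h => x + h)) => //.
by apply: is_derive_eq; rewrite add0r mulr1.
Qed.

Lemma taylor2_of_derive (f f1 f2 f3 : R -> R) (B K : R) :
  (forall x : R, is_derive x 1 f (f1 x)) -> (forall x : R, is_derive x 1 f1 (f2 x)) ->
  (forall x : R, is_derive x 1 f2 (f3 x)) ->
  (forall x, `|f2 x| <= B) -> (forall x, `|f3 x| <= K) ->
  taylor2 f f1 f2 (2 * B) K.
Proof.
move=> D1 D2 D3 B2 K3 x h.
pose r2 h := f2 (x + h) - f2 x.
pose r1 h := f1 (x + h) - f1 x - f2 x * h.
pose r0 h := f (x + h) - f x - f1 x * h - f2 x * (h ^+ 2 / 2).
have dr2 (y : R) : is_derive y 1 r2 (f3 (x + y)).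
  have := is_derive_translate (D3 (x + y)) => H.
  by rewrite /r2; apply: is_derive_eq; rewrite subr0.
have dr1 (y : R) : is_derive y 1 r1 (r2 y).
  have := is_derive_translate (D2 (x + y)) => H.
  rewrite /r1 /r2; apply: is_derive_eq; rewrite /GRing.scale/=; ring.
have dr0 (y : R) : is_derive y 1 r0 (r1 y).
  have := is_derive_translate (D1 (x + y)) => H.
  rewrite /r0 /r1; apply: is_derive_eq; rewrite /GRing.scale/=; by field.
have r20 : r2 0 = 0 by rewrite /r2 addr0 subrr.
have r10 : r1 0 = 0 by rewrite /r1 addr0 subrr mulr0 subrr.
have r00 : r0 0 = 0 by rewrite /r0 addr0 subrr expr0n/= mul0r !mulr0 !subrr.
apply: le_min_of_le; rewrite -/(r0 h).
  rewrite -[h ^+ 2](real_normK (num_real h)).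
  apply: (mvt_bound dr0 r00) => {}h; rewrite -[_ ^+ 1]/(`|h|).
  have /(mvt_bound dr1 r10) : forall h, `|r2 h| <= 2 * B * `|h| ^+ 0.
    move=> y; rewrite expr0 mulr1 /r2 (le_trans (ler_normB _ _))//.
    by have := B2 (x + y); have := B2 x; lra.
  by move=> /(_ h); rewrite expr1.
apply: (mvt_bound dr0 r00); apply: (mvt_bound dr1 r10).
by apply: (mvt_bound dr2 r20) => y; rewrite expr0 mulr1.
Qed.

Lemma taylor2_scale (f f1 f2 : R -> R) (B K k : R) : 0 <= k -> taylor2 f f1 f2 B K ->
  taylor2 (fun x => f (k * x)) (fun x => k * f1 (k * x))
    (fun x => k ^+ 2 * f2 (k * x)) (B * k ^+ 2) (K * k ^+ 3).
Proof.
move=> k0 tf x h; have := tf (k * x) (k * h).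
rewrite mulrDr exprMn normrM (ger0_norm k0) [(k * `|h|) ^+ 3]exprMn !mulrA.
congr (`|_ - _ - _| <= _); ring.
Qed.

(** A smooth monotone substitute for the indicator function of a half-line.  Its derivatives are
    polynomials in the function itself, hence bounded; logistic1 and logistic2 are the first
    two. *)
Definition logistic (x : R) : R := (1 + expR x)^-1.
Definition logistic1 (x : R) : R := - (logistic x * (1 - logistic x)).
Definition logistic2 (x : R) : R :=
  logistic x * (1 - logistic x) * (1 - 2 * logistic x).

Lemma logistic_gt0 (x : R) : 0 < logistic x.
Proof. by rewrite invr_gt0 addr_gt0// expR_gt0. Qed.

Lemma logistic_lt1 (x : R) : logistic x < 1.
Proof.
by rewrite invf_lt1 ?ltrDl ?expR_gt0// addr_gt0// expR_gt0.
Qed.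

Lemma is_derive_logistic (x : R) : is_derive x 1 logistic (logistic1 x).
Proof.
have n0 : (1 + expR x) != 0 by rewrite gt_eqF// addr_gt0// expR_gt0.
rewrite /logistic.
have H : is_derive x 1 (fun y => 1 + expR y) (expR x).
  by apply: is_derive_eq; rewrite add0r mul1r.
apply: (is_derive_eq (@is_deriveV R (fun y => 1 + expR y) x _ 1 n0 H)).
by rewrite /logistic1 /logistic /GRing.scale/=; field.
Qed.

Lemma is_derive_logistic1 (x : R) : is_derive x 1 logistic1 (logistic2 x).
Proof.
have H := is_derive_logistic x.
rewrite /logistic1; apply: is_derive_eq.
rewrite /logistic2 /logistic1 /GRing.scale/=; ring.
Qed.

Lemma is_derive_logistic2 (x : R) : is_derive x 1 logistic2
  (- (logistic x * (1 - logistic x)) * (1 - 6 * logistic x + 6 * logistic x ^+ 2)).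
Proof.
have H := is_derive_logistic x.
rewrite /logistic2; apply: is_derive_eq.
rewrite /logistic1 /GRing.scale/=; ring.
Qed.

Lemma taylor2_logistic : taylor2 logistic logistic1 logistic2 2 1.
Proof.
rewrite -[X in taylor2 _ _ _ X]mulr1.
apply: (taylor2_of_derive is_derive_logistic is_derive_logistic1 is_derive_logistic2) => x.
  have := logistic_gt0 x; have := logistic_lt1 x; rewrite /logistic2.
  by move: (logistic x) => g g1 g0; apply: ler_norm_of_bounds; nra.
have := logistic_gt0 x; have := logistic_lt1 x.
move: (logistic x) => g g1 g0; rewrite mulNr normrN normrM -[leRHS]mulr1.
by apply: ler_pM => //; apply: ler_norm_of_bounds; nra.
Qed.

Lemma continuous_logistic : continuous logistic.
Proof.
move=> x; apply/differentiable_continuous/derivable1_diffP.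
by have := is_derive_logistic x => H; exact: ex_derive.
Qed.

Lemma measurable_logistic : measurable_fun setT logistic.
Proof. exact: continuous_measurable_fun continuous_logistic. Qed.

End taylor_logistic.

(** * Lindeberg's replacement of the summands *)

Section averaging.
Context d (T : measurableType d) (R : realType) (P : probability T R).

(** The expectation of a test function as a function of its translation.  All estimates on these
    functions are uniform in x, which makes the comparison of distribution functions uniform
    in the threshold. *)
Definition avg (Y : T -> R) (f : R -> R) (x : R) : R := \int[P]_w f (x + Y w).

(** The bound on the remainder, averaged over the increment a xi. *)
Definition taylor_rem (B K : R) (xi : T -> R) (a : R) : R :=
  \int[P]_w Num.min (B * (a * xi w) ^+ 2) (K * `|a * xi w| ^+ 3).

Lemma bounded_shift_integrable (Y : T -> R) (f : R -> R) (M x : R) :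
  measurable_fun setT Y -> measurable_fun setT f -> (forall x, `|f x| <= M) ->
  P.-integrable setT (EFin \o (fun w => f (x + Y w))).
Proof.
move=> mY mf fM; apply: (@bounded_integrable _ _ _ _ _ M) => // .
by apply: (measurableT_comp mf); exact: measurable_funD.
Qed.

Lemma measurable_avg (Y : T -> R) (f : R -> R) :
  measurable_fun setT Y -> measurable_fun setT f -> (forall x, 0 <= f x) ->
  measurable_fun setT (avg Y f).
Proof.
move=> mY mf f0; rewrite /avg /Rintegral.
apply: (measurableT_comp (@fine_measurable R setT measurableT)).
apply: (@measurable_fun_fubini_tonelli_F _ _ _ _ _ P
  (fun p : R * T => (f (p.1 + Y p.2))%:E)).
  apply/measurable_EFinP; apply: (measurableT_comp mf).
  by apply: measurable_funD => //; exact: measurableT_comp.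
by move=> p; rewrite lee_fin.
Qed.

Lemma avg_bounded (Y : T -> R) (f : R -> R) (M x : R) :
  measurable_fun setT Y -> measurable_fun setT f -> (forall x, `|f x| <= M) ->
  `|avg Y f x| <= M.
Proof.
move=> mY mf fM; apply: Rintegral_bounded => //.
by apply: (measurableT_comp mf); exact: measurable_funD.
Qed.

Lemma taylor2_avg (Y : T -> R) (f f1 f2 : R -> R) (M B K : R) :
  measurable_fun setT Y ->
  measurable_fun setT f -> measurable_fun setT f1 -> measurable_fun setT f2 ->
  (forall x, `|f x| <= M) -> (forall x, `|f1 x| <= M) -> (forall x, `|f2 x| <= M) ->
  taylor2 f f1 f2 B K -> taylor2 (avg Y f) (avg Y f1) (avg Y f2) B K.
Proof.
move=> mY mf mf1 mf2 fM f1M f2M tf x h; rewrite /avg.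
have i0 y := @bounded_shift_integrable Y f M y mY mf fM.
have i1 := @bounded_shift_integrable Y f1 M x mY mf1 f1M.
have i2 := @bounded_shift_integrable Y f2 M x mY mf2 f2M.
have i01 := integrableB measurableT (i0 (x + h)) (i0 x).
have i1h := integrableZr measurableT h i1.
have i2h := integrableZr measurableT (h ^+ 2 / 2) i2.
have i012 := integrableB measurableT i01 i1h.
rewrite -RintegralB// -RintegralZr// -RintegralB// -RintegralZr// -RintegralB//.
apply: Rintegral_bounded => [|w].
  by apply/measurable_EFinP; exact: measurable_int (integrableB measurableT i012 i2h).
by have := tf (x + Y w) h; rewrite [x + h + _]addrAC.
Qed.

Lemma taylor_rem_integrable (f f1 f2 : R -> R) (B K : R) (xi : T -> R) (a : R) :
  taylor2 f f1 f2 B K -> measurable_fun setT xi ->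
  P.-integrable setT (EFin \o (fun w => xi w ^+ 2)) ->
  P.-integrable setT
    (EFin \o (fun w => Num.min (B * (a * xi w) ^+ 2) (K * `|a * xi w| ^+ 3))).
Proof.
move=> tf mxi ixi2.
have := integrableZl measurableT (B * a ^+ 2) ixi2.
apply: le_integrable => //.
  apply/measurable_EFinP; apply: measurable_minr.
    by apply: measurable_funM => //; apply: measurable_funX; exact: measurable_funM.
  apply: measurable_funM => //; apply: measurable_funX; apply: measurableT_comp => //.
  exact: measurable_funM.
move=> w _ /=; rewrite lee_fin.
have m0 : 0 <= Num.min (B * (a * xi w) ^+ 2) (K * `|a * xi w| ^+ 3).
  exact: le_trans (normr_ge0 _) (tf 0 (a * xi w)).
rewrite (ger0_norm m0); apply: le_trans (ler_norm _).
by rewrite -mulrA -exprMn ge_min lexx.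
Qed.

(** Averaging over a centered increment kills the first-order term, and the second-order term
    depends on the variance of the increment only. *)
Lemma taylor_one_step (f f1 f2 : R -> R) (M B K : R) (xi : T -> R) (a s2 x : R) :
  taylor2 f f1 f2 B K -> measurable_fun setT f -> (forall x, `|f x| <= M) ->
  measurable_fun setT xi -> P.-integrable setT (EFin \o xi) ->
  P.-integrable setT (EFin \o (fun w => xi w ^+ 2)) ->
  \int[P]_w xi w = 0 -> \int[P]_w (xi w ^+ 2) = s2 ->
  `|\int[P]_w f (x + a * xi w) - f x - f2 x * (a ^+ 2 / 2) * s2|
  <= taylor_rem B K xi a.
Proof.
move=> tf mf fM mxi ixi ixi2 E0 E2.
have maxi : measurable_fun setT (fun w => a * xi w) by exact: measurable_funM.
have i0 := @bounded_shift_integrable _ f M x maxi mf fM.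
have ic : P.-integrable setT (EFin \o (fun w : T => f x)).
  exact: finite_measure_integrable_cst.
have i1 := integrableZl measurableT (f1 x * a) ixi.
have i2 := integrableZl measurableT (f2 x * (a ^+ 2 / 2)) ixi2.
have ia := integrableB measurableT i0 ic.
have ib := integrableB measurableT ia i1.
have id := integrableB measurableT ib i2.
rewrite -{1}(Rintegral_cst_prob P (f x)) -RintegralB//.
rewrite -[X in X - _ * s2]subr0 -[X in _ - X - _](mulr0 (f1 x * a)) -E0 -E2.
rewrite -RintegralZl// -RintegralB// -RintegralZl// -RintegralB//.
apply: (le_trans (le_normr_Rintegral _ id)) => //.
apply: le_Rintegral => //.
- exact: integrable_norm id.
- exact: taylor_rem_integrable tf mxi ixi2.
move=> w _; have := tf x (a * xi w).
by rewrite mulrA [f2 x * _](_ : _ = f2 x * (a ^+ 2 / 2) * xi w ^+ 2)//; field.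
Qed.

End averaging.

Section lindeberg.
Context d (T : measurableType d) (R : realType) (P : probability T R).
Context (X : {RV P >-> R}) (Xs : nat -> {RV P >-> R}) (h : R -> R).
Hypothesis iid : iid_copies X Xs.
Hypothesis mh : measurable_fun setT h.
Let xi w := h (X w).
Notation S := (partial_sum Xs h).

Let mxi : measurable_fun setT xi.
Proof. exact: (measurableT_comp mh). Qed.

(** The last summand is independent of the previous ones, so that it can be integrated out
    separately. *)
Lemma avg_partial_sumS (f : R -> R) (a : R) (k : nat) (x : R) :
  measurable_fun setT f -> (forall x, 0 <= f x <= 1) ->
  avg P (fun w => a * S k.+1 w) f x =
  \int[P]_w avg P (fun w => a * S k w) f (x + a * xi w).
Proof.
move=> mf f01.
have f0 y : 0 <= f y by have /andP[] := f01 y.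
have fM y : `|f y| <= 1 by rewrite (ger0_norm (f0 y)); have /andP[] := f01 y.
have mS := measurable_partial_sum Xs mh.
have maS j : measurable_fun setT (fun w => a * S j w) by exact: measurable_funM.
rewrite /avg /Rintegral; congr fine.
pose F (p : R * R) := (f (x + a * (p.1 + h p.2)))%:E.
have mF : measurable_fun setT F.
  apply/measurable_EFinP; apply: (measurableT_comp mf).
  apply: measurable_funD => //; apply: measurable_funM => //.
  by apply: measurable_funD => //; exact: (measurableT_comp mh).
have F0 p : (0 <= F p)%E by rewrite lee_fin.
have ind := @indep_partial_sum _ _ _ _ _ _ mh k (proj1 iid).
transitivity (\int[P]_w F (S k w, Xs k w))%E.
  by apply: eq_integral => w _; rewrite /F /partial_sum big_ord_recr.
rewrite (ge0_integral_indep (mS k) _ ind mF F0)//.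
transitivity (\int[P]_w \int[P]_w' F (S k w, X w'))%E.
  apply: eq_integral => w _.
  apply: (ge0_integral_same_law (f := fun y => F (S k w, y)) ((proj2 iid) k)) => //.
  exact: (measurableT_comp mF).
rewrite (@fubini_tonelli _ _ _ _ _ P P (fun p => F (S k p.1, X p.2)))//; last first.
  apply: (measurableT_comp mF); apply: measurable_fun_pair => /=.
    exact: (measurableT_comp (mS k)).
  exact: measurableT_comp.
apply: eq_integral => w' _.
rewrite fineK; last first.
  apply: integrable_fin_num => //.
  exact: (@bounded_shift_integrable _ _ _ _ _ _ 1 _ (maS k) mf fM).
by apply: eq_integral => w _; rewrite /F /=; congr (f _)%:E; rewrite /xi; ring.
Qed.

Lemma avg_normalS (f : R -> R) (s : R) (k : nat) (x : R) : 0 <= s ->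
  measurable_fun setT f -> (forall x, 0 <= f x <= 1) ->
  avg (normal_prob 0 1) (fun g => s * Num.sqrt k.+1%:R * g) f x =
  \int[normal_prob 0 1]_g
     avg (normal_prob 0 1) (fun g => s * Num.sqrt k%:R * g) f (x + s * g).
Proof.
move=> s0 mf f01.
have f0 y : 0 <= f y by have /andP[] := f01 y.
have fM y : `|f y| <= 1 by rewrite (ger0_norm (f0 y)); have /andP[] := f01 y.
rewrite /avg /Rintegral; congr fine.
have sE : s * Num.sqrt k.+1%:R = Num.sqrt (s ^+ 2 + (s * Num.sqrt k%:R) ^+ 2).
  rewrite exprMn sqr_sqrtr//.
  have -> : s ^+ 2 + s ^+ 2 * k%:R = s ^+ 2 * k.+1%:R by rewrite -natr1; ring.
  by rewrite sqrtrM ?sqr_ge0// sqrtr_sqr ger0_norm.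
rewrite sE.
have mfx : measurable_fun setT (fun y : R => (f (x + y))%:E).
  apply/measurable_EFinP; apply: (measurableT_comp mf).
  by apply: measurable_funD => //; exact: measurable_id.
rewrite -(@ge0_integral_normal_semigroup R s (s * Num.sqrt k%:R)
   (fun y => (f (x + y))%:E) s0 (mulr_ge0 s0 (sqrtr_ge0 _)) mfx)//; last first.
  by move=> y; rewrite lee_fin.
apply: eq_integral => y _; rewrite fineK; last first.
  apply: integrable_fin_num => //.
  apply: (@bounded_shift_integrable _ _ _ _ _ _ 1) => //.
by apply: eq_integral => z _; rewrite addrA.
Qed.

(** Replacing the increments of the sum one at a time by Gaussian increments costs at most the
    sum of the two Taylor remainders at each step, uniformly in x: both increments have the same
    first two moments, and averages of f inherit its expansion. *)
Lemma lindeberg_bound (f f1 f2 : R -> R) (M B K s a : R) (k : nat) (x : R) :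
  0 <= s -> 0 <= a ->
  measurable_fun setT f -> measurable_fun setT f1 -> measurable_fun setT f2 ->
  (forall x, 0 <= f x <= 1) -> (forall x, `|f1 x| <= M) -> (forall x, `|f2 x| <= M) ->
  1 <= M ->
  taylor2 f f1 f2 B K ->
  P.-integrable setT (EFin \o xi) ->
  P.-integrable setT (EFin \o (fun w => xi w ^+ 2)) ->
  \int[P]_w xi w = 0 -> \int[P]_w (xi w ^+ 2) = s ^+ 2 ->
  `|avg P (fun w => a * S k w) f x -
    avg (normal_prob 0 1) (fun g => a * s * Num.sqrt k%:R * g) f x|
  <= k%:R * (taylor_rem P B K xi a +
             taylor_rem (normal_prob 0 1) B K (fun g => s * g) a).
Proof.
move=> s0 a0 mf mf1 mf2 f01 f1M f2M M1 tf ixi ixi2 E0 E2.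
have f0 y : 0 <= f y by have /andP[] := f01 y.
have fM y : `|f y| <= 1 by rewrite (ger0_norm (f0 y)); have /andP[] := f01 y.
have fM' y : `|f y| <= M by exact: le_trans (fM y) M1.
set r := (X in k%:R * X).
elim: k x => [|k IHk] x.
  rewrite mul0r /avg /partial_sum sqrtr0 mulr0.
  under eq_Rintegral do rewrite big_ord0 mulr0 addr0.
  rewrite Rintegral_cst_prob.
  under eq_Rintegral do rewrite mul0r addr0.
  by rewrite Rintegral_cst_prob subrr normr0.
rewrite avg_partial_sumS// avg_normalS ?mulr_ge0//.
set V := avg P _ f; set W := avg (normal_prob 0 1) _ f.
have mS := measurable_partial_sum Xs mh.
have maS j : measurable_fun setT (fun w => a * S j w) by exact: measurable_funM.
have mg (c : R) : measurable_fun setT (fun g : R => c * g).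
  by apply: measurable_funM => //; exact: measurable_id.
have mV : measurable_fun setT V by exact: measurable_avg.
have mW : measurable_fun setT W.
  exact: (@measurable_avg _ _ _ (normal_prob 0 1) _ f (mg _) mf f0).
have V1 y : `|V y| <= 1 by exact: avg_bounded.
have W1 y : `|W y| <= 1.
  exact: (@avg_bounded _ _ _ (normal_prob 0 1) _ f 1 y (mg _) mf fM).
have maxi : measurable_fun setT (fun w => a * xi w) by exact: measurable_funM.
have iV := @bounded_shift_integrable _ _ _ P _ V 1 x maxi mV V1.
have iW := @bounded_shift_integrable _ _ _ P _ W 1 x maxi mW W1.
have -> : \int[P]_w V (x + a * xi w) - \int[normal_prob 0 1]_g W (x + a * s * g) =
  (\int[P]_w (V (x + a * xi w) - W (x + a * xi w))) +
  (\int[P]_w W (x + a * xi w) - \int[normal_prob 0 1]_g W (x + a * s * g)).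
  by rewrite RintegralB//; ring.
apply: le_trans (ler_normD _ _) _; rewrite -natr1 mulrDl mul1r; apply: lerD.
  apply: Rintegral_bounded => [|w]; last exact: IHk.
  apply/measurable_EFinP; exact: measurable_int (integrableB measurableT iV iW).
have tW := @taylor2_avg _ _ _ (normal_prob 0 1) _ f f1 f2 M B K
  (mg (a * s * Num.sqrt k%:R)) mf mf1 mf2 fM' f1M f2M tf.
have st1 := taylor_one_step a x tW mW W1 mxi ixi ixi2 E0 E2.
have i2 := integrable_normal_sqr R.
have i1 := integrable_normal_id R.
have isg : (normal_prob 0 1).-integrable setT (EFin \o (fun g : R => s * g)).
  exact: (integrableZl measurableT s i1).
have isg2 : (normal_prob 0 1).-integrable setT (EFin \o (fun g : R => (s * g) ^+ 2)).
  have := integrableZl measurableT (s ^+ 2) i2.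
  by apply: eq_integrable => // g _; rewrite /= exprMn EFinM.
have E0g : \int[normal_prob 0 1]_g (s * g) = 0.
  by rewrite RintegralZl// Rintegral_normal_id mulr0.
have E2g : \int[normal_prob 0 1]_g ((s * g) ^+ 2) = s ^+ 2.
  under eq_Rintegral do rewrite exprMn.
  by rewrite RintegralZl// Rintegral_normal_sqr mulr1.
have st2 := @taylor_one_step _ (measurableTypeR R) R (normal_prob 0 1)
  _ _ _ _ _ _ (fun g => s * g) a _ x tW mW W1 (mg s) isg isg2 E0g E2g.
have -> : \int[normal_prob 0 1]_g W (x + a * s * g) =
          \int[normal_prob 0 1]_g W (x + a * (s * g)).
  by apply: eq_Rintegral => g _; rewrite mulrA.
move: st1 st2; rewrite /r; set c := avg _ _ f2 x * _ * _.
set u := \int[P]_w _; set v := \int[_]_g _ => st1 st2.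
rewrite -(opprB v u) -[v - u](_ : (v - W x - c) - (u - W x - c) = _); last by ring.
rewrite opprB; apply: le_trans (ler_normB _ _) _.
exact: lerD.
Qed.

End lindeberg.

(** * The central limit theorem *)

Lemma Rintegral_dominated_cvg d (T : measurableType d) (R : realType)
    (P : probability T R) (F : nat -> T -> R) (f g : T -> R) :
  (forall n, measurable_fun setT (F n)) -> measurable_fun setT f ->
  (forall w, F n w @[n --> \oo] --> f w) ->
  P.-integrable setT (EFin \o g) -> (forall n w, `|F n w| <= g w) ->
  \int[P]_w F n w @[n --> \oo] --> \int[P]_w f w.
Proof.
move=> mF mf Ff ig Fg.
have [] := @dominated_convergence _ _ _ P setT measurableT
  (fun n w => (F n w)%:E) (EFin \o f) (EFin \o g).
- by move=> n; apply/measurable_EFinP.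
- exact/measurable_EFinP.
- by apply: aeW => w _; apply: cvg_EFin; [exact: nearW|exact: Ff].
- exact: ig.
- by apply: aeW => w n _; rewrite /= lee_fin.
move=> iF _; rewrite [X in _ --> X](EFin_Rintegral iF) => cv.
exact: (fine_cvg cv).
Qed.

Section central_limit.
Context (R : realType).

Definition cdfr d (T : measurableType d) (P : probability T R) (Y : T -> R) (y : R) : R :=
  fine (P [set w | Y w <= y]).

(** The inequalities between distribution functions that define the Levy metric, with separate
    tolerances eta in the threshold and eps in the probability. *)
Definition levy_close d (T : measurableType d) (P : probability T R) (Y : T -> R)
    d' (T' : measurableType d') (P' : probability T' R) (Z : T' -> R) (eta eps : R) :=
  forall y, cdfr P Y y <= cdfr P' Z (y + eta) + eps /\
            cdfr P' Z y <= cdfr P Y (y + eta) + eps.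

(** With a = n^(-1/2), n times the integrand is at most B xi^2 by the quadratic bound, and tends
    to 0 pointwise by the cubic one: dominated convergence applies under a second moment. *)
Lemma taylor_rem_cvg d (T : measurableType d) (P : probability T R)
    (f f1 f2 : R -> R) (B K : R) (xi : T -> R) :
  taylor2 f f1 f2 B K -> measurable_fun setT xi ->
  P.-integrable setT (EFin \o (fun w => xi w ^+ 2)) ->
  n%:R * taylor_rem P B K xi (Num.sqrt n%:R)^-1 @[n --> \oo] --> (0 : R).
Proof.
move=> tf mxi ixi2.
pose a (n : nat) : R := (Num.sqrt n%:R)^-1.
pose F n w := n%:R * Num.min (B * (a n * xi w) ^+ 2) (K * `|a n * xi w| ^+ 3).
have iF n := @taylor_rem_integrable _ _ _ P f f1 f2 B K xi (a n) tf mxi ixi2.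
have iF' n : P.-integrable setT (EFin \o F n) := integrableZl measurableT n%:R (iF n).
have FE n : n%:R * taylor_rem P B K xi (a n) = \int[P]_w F n w.
  by rewrite /taylor_rem -RintegralZl.
have m0 n w : 0 <= Num.min (B * (a n * xi w) ^+ 2) (K * `|a n * xi w| ^+ 3).
  exact: le_trans (normr_ge0 _) (tf 0 (a n * xi w)).
have F0 n w : 0 <= F n w by rewrite mulr_ge0.
have B0 : 0 <= B.
  have := le_trans (normr_ge0 _) (tf 0 1).
  by rewrite expr1n mulr1 le_min => /andP[].
have K0 : 0 <= K.
  have := le_trans (normr_ge0 _) (tf 0 1).
  by rewrite normr1 !expr1n !mulr1 le_min => /andP[].
have na2 n : n%:R * a n ^+ 2 <= 1.
  have [->|n0] := posnP n; first by rewrite mul0r.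
  by rewrite /a exprVn sqr_sqrtr// divff// pnatr_eq0 -lt0n.
have FB n w : F n w <= B * xi w ^+ 2.
  apply: (@le_trans _ _ (n%:R * (B * (a n * xi w) ^+ 2))).
    by rewrite ler_wpM2l// ge_min lexx.
  rewrite exprMn [leLHS](_ : _ = (n%:R * a n ^+ 2) * (B * xi w ^+ 2)); last by ring.
  by rewrite ler_piMl// mulr_ge0// sqr_ge0.
have FK n w : F n w <= K * `|xi w| ^+ 3 * a n.
  apply: (@le_trans _ _ (n%:R * (K * `|a n * xi w| ^+ 3))).
    by rewrite ler_wpM2l// ge_min lexx orbT.
  have an0 : 0 <= a n by rewrite invr_ge0 sqrtr_ge0.
  rewrite normrM (ger0_norm an0) exprMn.
  rewrite [leLHS](_ : _ = (n%:R * a n ^+ 2) * (K * `|xi w| ^+ 3 * a n)); last by ring.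
  by rewrite ler_piMl// !mulr_ge0.
have acv : a n @[n --> \oo] --> (0 : R).
  apply/gtr0_cvgV0.
    by near=> n; rewrite sqrtr_gt0 ltr0n; near: n; exact: nbhs_infty_gt.
  apply/cvgryPge => A; near=> n.
  apply: (@le_trans _ _ `|A|); first exact: ler_norm.
  rewrite -sqrtr_sqr ler_wsqrtr//; near: n; exact: nbhs_infty_ger.
have Fcv w : F n w @[n --> \oo] --> (0 : R).
  apply: (@squeeze_cvgr _ _ _ _ (fun=> 0) (fun n => K * `|xi w| ^+ 3 * a n)).
  - by near=> n; rewrite F0 FK.
  - exact: cvg_cst.
  - by rewrite -[X in _ --> X](mulr0 (K * `|xi w| ^+ 3)); apply: cvgMr.
have cv : \int[P]_w F n w @[n --> \oo] --> \int[P]_(w in setT) (0 : R).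
  apply: (Rintegral_dominated_cvg _ _ Fcv (integrableZl measurableT B ixi2)) => //.
  - by move=> n; apply/measurable_EFinP; exact: measurable_int (iF' n).
  - by move=> n w; rewrite ger0_norm.
rewrite Rintegral_cst_prob in cv; apply: cvg_trans cv.
by apply: near_eq_cvg; apply: nearW => n; rewrite FE.
Unshelve. all: by end_near. Qed.

End central_limit.

Section logistic_smoothing.
Context (R : realType).

Lemma logisticN (x : R) : logistic (- x) = 1 - logistic x.
Proof.
rewrite /logistic expRN; have := expR_gt0 x; move: (expR x) => e e0.
by field; rewrite !gt_eqF// addr_gt0.
Qed.

Lemma logistic_tail (eps x : R) : 0 < eps -> eps^-1 <= x -> logistic x <= eps.
Proof.
move=> e0 ex; have p : 0 < 1 + expR x by rewrite addr_gt0// expR_gt0.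
rewrite -[leRHS]invrK lef_pV2 ?posrE ?invr_gt0//.
by apply: (le_trans ex); have := expR_ge1Dx x; lra.
Qed.

Context d (T : measurableType d) (P : probability T R).

Lemma measurable_le_preim (Y : T -> R) (y : R) : measurable_fun setT Y ->
  measurable [set w | Y w <= y].
Proof.
move=> mY; rewrite -[X in measurable X]setTI.
rewrite (_ : [set w | _] = Y @^-1` `]-oo, y]).
  by apply: mY => //; exact: measurable_itv.
by apply/seteqP; split=> w /=; rewrite in_itv.
Qed.

Lemma measurable_gt_preim (Y : T -> R) (y : R) : measurable_fun setT Y ->
  measurable [set w | y < Y w].
Proof.
move=> mY; rewrite (_ : [set w | _] = ~` [set w | Y w <= y]).
  by apply: measurableC; exact: measurable_le_preim.
by apply/seteqP; split=> w /=; rewrite ltNge => /negP.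
Qed.

Lemma fine_prob_indic (A : set T) : measurable A -> fine (P A) = \int[P]_w \1_A w.
Proof. by move=> mA; rewrite /Rintegral integral_indic// setIT. Qed.

Lemma indic_integrable (A : set T) : measurable A ->
  P.-integrable setT (EFin \o (\1_A : T -> R)).
Proof.
move=> mA; apply: (@bounded_integrable _ _ _ _ _ 1); first exact: measurable_indic.
by move=> w; rewrite indicE; case: (_ \in _); rewrite ?normr0 ?normr1.
Qed.

Lemma scaled_logistic01 (k x : R) : 0 <= logistic (k * x) <= 1.
Proof. by rewrite !ltW// ?logistic_gt0 ?logistic_lt1. Qed.

Lemma measurable_scaled_logistic (k : R) :
  measurable_fun setT (fun x => logistic (k * x)).
Proof.
apply: (measurableT_comp (@measurable_logistic R)).
by apply: measurable_funM => //; exact: measurable_id.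
Qed.

Lemma scaled_logistic_integrable (Y : T -> R) (k x : R) : measurable_fun setT Y ->
  P.-integrable setT (EFin \o (fun w => logistic (k * (x + Y w)))).
Proof.
move=> mY.
apply: (@bounded_shift_integrable _ _ _ P Y _ 1 x mY (measurable_scaled_logistic k)).
by move=> y; have /andP[l0 l1] := scaled_logistic01 k y; rewrite ger0_norm.
Qed.

(** The function logistic (k (. - y - delta)) is at least 1 - eps to the left of y and at most eps
    to the right of y + 2 delta, as soon as k delta >= 1 / eps. *)
Lemma cdfr_le_avg (Y : T -> R) (k delta eps y : R) :
  measurable_fun setT Y -> 0 <= k -> 0 < eps -> eps^-1 <= k * delta ->
  cdfr P Y y <= avg P Y (fun x => logistic (k * x)) (- (y + delta)) + eps.
Proof.
move=> mY k0 e0 ekd; rewrite /cdfr fine_prob_indic; last exact: measurable_le_preim.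
have il := scaled_logistic_integrable k (- (y + delta)) mY.
have ic : P.-integrable setT (EFin \o (fun _ : T => eps)).
  exact: finite_measure_integrable_cst.
rewrite /avg -[X in _ <= _ + X](Rintegral_cst_prob P eps) -RintegralD//.
apply: le_Rintegral => //; first by apply: indic_integrable; exact: measurable_le_preim.
  exact: (integrableD measurableT il ic).
move=> w _; rewrite indicE; case: (boolP (_ \in _)) => [|_] /=; last first.
  by rewrite addr_ge0 ?(ltW e0)//; have /andP[] := scaled_logistic01 k (- (y + delta) + Y w).
rewrite inE/= => Yy.
have : logistic (- (k * (- (y + delta) + Y w))) <= eps.
  apply: logistic_tail => //.
  by apply: (le_trans ekd); rewrite -mulrN ler_wpM2l//; lra.
by rewrite logisticN; lra.
Qed.

Lemma avg_le_cdfr (Y : T -> R) (k delta eps y : R) :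
  measurable_fun setT Y -> 0 <= k -> 0 < eps -> eps^-1 <= k * delta ->
  avg P Y (fun x => logistic (k * x)) (- (y + delta)) <=
  cdfr P Y (y + (delta + delta)) + eps.
Proof.
move=> mY k0 e0 ekd; rewrite /cdfr fine_prob_indic; last exact: measurable_le_preim.
have il := scaled_logistic_integrable k (- (y + delta)) mY.
have ic : P.-integrable setT (EFin \o (fun _ : T => eps)).
  exact: finite_measure_integrable_cst.
have ii : P.-integrable setT
   (EFin \o (\1_[set w | Y w <= y + (delta + delta)] : T -> R)).
  by apply: indic_integrable; exact: measurable_le_preim.
rewrite /avg -[X in _ <= _ + X](Rintegral_cst_prob P eps) -RintegralD//.
apply: le_Rintegral => //; first exact: (integrableD measurableT ii ic).
move=> w _; rewrite indicE; case: (boolP (_ \in _)) => [_|] /=.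
  have /andP[_] := scaled_logistic01 k (- (y + delta) + Y w).
  by move/le_trans; apply; rewrite lerDl ltW.
rewrite notin_setE/= => /negP; rewrite -ltNge => Yy; rewrite add0r.
apply: logistic_tail => //; apply: (le_trans ekd).
by rewrite ler_wpM2l//; lra.
Qed.

End logistic_smoothing.

Lemma levy_close_of_avg (R : realType) d (T : measurableType d) (P : probability T R)
    (Y : T -> R) d' (T' : measurableType d') (P' : probability T' R) (Z : T' -> R)
    (k eta eps : R) :
  measurable_fun setT Y -> measurable_fun setT Z -> 0 <= k -> 0 < eps ->
  eps^-1 <= k * (eta / 2) ->
  (forall x, `|avg P Y (fun x => logistic (k * x)) x -
               avg P' Z (fun x => logistic (k * x)) x| <= eps) ->
  levy_close P Y P' Z eta (3 * eps).
Proof.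
move=> mY mZ k0 e0 ek H y.
have /ler_normlP[Ha Hb] := H (- (y + eta / 2)).
have etaE : eta = eta / 2 + eta / 2 by field.
have Y1 := cdfr_le_avg P y mY k0 e0 ek; have Z1 := cdfr_le_avg P' y mZ k0 e0 ek.
have Y2 := avg_le_cdfr P y mY k0 e0 ek; have Z2 := avg_le_cdfr P' y mZ k0 e0 ek.
rewrite -etaE in Y2 Z2.
by split; lra.
Qed.

Section clt.
Context d (T : measurableType d) (R : realType) (P : probability T R).
Context (X : {RV P >-> R}) (Xs : nat -> {RV P >-> R}) (h : R -> R).

(** The central limit theorem, with an approximation that is uniform in the threshold; s = 0,
    where the limit is a point mass, is included.  The logistic function is taken steep enough
    to resolve eta up to an error eps / 3, and then n is taken large enough for the Lindeberg
    bound to be at most eps / 3. *)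
Theorem clt_levy (s eta eps : R) :
  iid_copies X Xs -> measurable_fun setT h -> 0 <= s ->
  P.-integrable setT (EFin \o (fun w => h (X w))) ->
  P.-integrable setT (EFin \o (fun w => h (X w) ^+ 2)) ->
  \int[P]_w h (X w) = 0 -> \int[P]_w (h (X w) ^+ 2) = s ^+ 2 ->
  0 < eta -> 0 < eps ->
  \forall n \near \oo,
    levy_close P (fun w => (Num.sqrt n%:R)^-1 * partial_sum Xs h n w)
      (normal_prob 0 1) (fun g : R => s * g) eta eps.
Proof.
move=> iid mh s0 ih ih2 E0 E2 eta0 eps0.
pose e := eps / 3; have e0 : 0 < e by rewrite divr_gt0.
pose k := e^-1 * (2 / eta).
have k0 : 0 <= k by rewrite mulr_ge0 ?invr_ge0 ?(ltW e0)// divr_ge0// ltW.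
have ek : e^-1 <= k * (eta / 2).
  by rewrite /k -mulrA [_ * (eta / 2)](_ : _ = 1) ?mulr1//; field; rewrite gt_eqF.
pose f x := logistic (k * x).
pose f1 x := k * logistic1 (k * x).
pose f2 x := k ^+ 2 * logistic2 (k * x).
have tf : taylor2 f f1 f2 (2 * k ^+ 2) (1 * k ^+ 3).
  exact: taylor2_scale k0 (@taylor2_logistic R).
have mkx : measurable_fun setT (fun x : R => k * x).
  by apply: measurable_funM => //; exact: measurable_id.
have ml := @measurable_scaled_logistic R k.
have mf1 : measurable_fun setT f1.
  apply: measurable_funM => //; apply: measurable_funN.
  by apply: measurable_funM => //; exact: measurable_funB.
have mf2 : measurable_fun setT f2.
  apply: measurable_funM => //; apply: measurable_funM.
    by apply: measurable_funM => //; exact: measurable_funB.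
  by apply: measurable_funB => //; exact: measurable_funM.
pose M := 1 + k + k ^+ 2.
have k20 := sqr_ge0 k.
have f1M x : `|f1 x| <= M.
  apply: (@le_trans _ _ k); last by rewrite /M; lra.
  rewrite normrM (ger0_norm k0) ler_piMr//.
  have := logistic_gt0 (k * x); have := logistic_lt1 (k * x).
  rewrite /logistic1; move: (logistic _) => g g1 g0.
  by apply: ler_norm_of_bounds; nra.
have f2M x : `|f2 x| <= M.
  apply: (@le_trans _ _ (k ^+ 2)); last by rewrite /M; lra.
  rewrite normrM (ger0_norm k20) ler_piMr//.
  have := logistic_gt0 (k * x); have := logistic_lt1 (k * x).
  rewrite /logistic2; move: (logistic _) => g g1 g0.
  by apply: ler_norm_of_bounds; nra.
have M1 : 1 <= M by rewrite /M; lra.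
have mxi : measurable_fun setT (fun w => h (X w)) by exact: (measurableT_comp mh).
have c1 := taylor_rem_cvg tf mxi ih2.
have isg2 : (normal_prob 0 1).-integrable setT (EFin \o (fun g : R => (s * g) ^+ 2)).
  have := integrableZl measurableT (s ^+ 2) (integrable_normal_sqr R).
  by apply: eq_integrable => // g _; rewrite /= exprMn EFinM.
have msg : measurable_fun setT (fun g : R => s * g).
  by apply: measurable_funM => //; exact: measurable_id.
have c2 := @taylor_rem_cvg R _ _ (normal_prob 0 1) f f1 f2 _ _ _ tf msg isg2.
pose ra (n : nat) : R := n%:R * taylor_rem P (2 * k ^+ 2) (1 * k ^+ 3)
  (fun w => h (X w)) (Num.sqrt n%:R)^-1.
pose rb (n : nat) : R := n%:R * taylor_rem (normal_prob 0 1) (2 * k ^+ 2) (1 * k ^+ 3)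
  (fun g => s * g) (Num.sqrt n%:R)^-1.
have /cvgrPdist_le/(_ e e0) H : ra n + rb n @[n --> \oo] --> (0 + 0 : R).
  exact: (cvgD c1 c2).
near=> n.
have n0 : (0 < n)%N by near: n; exact: nbhs_infty_gt.
have Hn : ra n + rb n <= e.
  apply: (le_trans (ler_norm _)); rewrite -normrN -[- _]add0r -{1}[0]addr0.
  by near: n; exact: H.
rewrite (_ : eps = 3 * e); last by rewrite /e; field.
have mS := measurable_partial_sum Xs mh n.
apply: (levy_close_of_avg _ _ k0 e0 ek) => //; first exact: measurable_funM.
move=> x.
have a0 : 0 <= (Num.sqrt n%:R)^-1 :> R by rewrite invr_ge0 sqrtr_ge0.
have := lindeberg_bound iid mh n x s0 a0 ml mf1 mf2 (scaled_logistic01 k) f1M f2M M1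
  tf ih ih2 E0 E2.
rewrite mulrDr (_ : (Num.sqrt n%:R)^-1 * s * Num.sqrt n%:R = s); last first.
  by rewrite mulrAC mulVf ?mul1r// gt_eqF// sqrtr_gt0 ltr0n.
by move=> /le_trans; apply.
Unshelve. all: by end_near. Qed.

End clt.

(** * Weak convergence *)

Section continuity_points.
Context (R : realType).

(** A monotone function has countably many discontinuities, and an interval is not null. *)
Lemma nondecreasing_continuity_point (F : R -> R) (a b : R) : a < b ->
  {homo F : x y / x <= y} -> exists2 x, a < x < b & {for x, continuous F}.
Proof.
move=> ab ndF.
have ndF' : {in `[a, b] &, nondecreasing_fun F} by move=> x y _ _; exact: ndF.
apply: contrapT => H.
have cD := @discontinuity_countable R a b F ndF'.
have : lebesgue_measure (`]a, b[%classic : set R) = 0%E.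
  apply: countable_lebesgue_measure0.
  apply: sub_countable cD; apply: subset_card_le => x /= xab; split => //.
  have xab' : a < x < b by move: xab; rewrite in_itv.
  have cl : cvg (F y @[y --> x^'-]).
    apply: nondecreasing_at_left_is_cvgr; apply: nearW => y.
      by move=> u v _ _; exact: ndF.
    by exists (F x) => _ [z /= + <-]; rewrite in_itv => /andP[_ /ltW/ndF].
  have cr : cvg (F y @[y --> x^'+]).
    apply: nondecreasing_at_right_is_cvgr; apply: nearW => y.
      by move=> u v _ _; exact: ndF.
    by exists (F x) => _ [z /= + <-]; rewrite in_itv => /andP[/ltW/ndF].
  split => //; apply/negP => /eqP lr; apply: H; exists x => //.
  have lF : lim (F y @[y --> x^'-]) <= F x.
    apply: limr_le => //; near=> y; apply: ndF; apply: ltW.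
    by near: y; exact: nbhs_left_lt.
  have Fr : F x <= lim (F y @[y --> x^'+]).
    apply: limr_ge => //; near=> y; apply: ndF; apply: ltW.
    by near: y; exact: nbhs_right_gt.
  have lE : lim (F y @[y --> x^'-]) = F x by apply/eqP; rewrite eq_le lF lr Fr.
  have rE : lim (F y @[y --> x^'+]) = F x by rewrite -lr.
  by apply/left_right_continuousP; split; [rewrite -lE|rewrite -rE].
rewrite lebesgue_measure_itv/= lte_fin ab => /eqP.
by rewrite -EFinB eqe subr_eq0 gt_eqF.
Unshelve. all: by end_near. Qed.

End continuity_points.

Section cdf.
Context d (T : measurableType d) (R : realType) (P : probability T R).
Variables (Y : T -> R) (mY : measurable_fun setT Y).

Lemma cdfrE (y : R) : P [set w | Y w <= y] = (cdfr P Y y)%:E.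
Proof. by rewrite /cdfr fineK// fin_num_measure//; exact: measurable_le_preim. Qed.

Lemma cdfr_ge0 (y : R) : 0 <= cdfr P Y y.
Proof. by rewrite /cdfr fine_ge0. Qed.

Lemma cdfr_le1 (y : R) : cdfr P Y y <= 1.
Proof. by rewrite -lee_fin -cdfrE probability_le1//; exact: measurable_le_preim. Qed.

Lemma cdfr_nd (x y : R) : x <= y -> cdfr P Y x <= cdfr P Y y.
Proof.
move=> xy; rewrite -lee_fin -!cdfrE; apply: le_measure.
- by rewrite inE; exact: measurable_le_preim.
- by rewrite inE; exact: measurable_le_preim.
- by move=> w /= /le_trans; apply.
Qed.

Lemma cdfr_comp (h : R -> R) (x y : R) : measurable_fun setT h ->
  (forall z, h z <= x -> z <= y) -> cdfr P (h \o Y) x <= cdfr P Y y.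
Proof.
move=> mh hxy; rewrite -lee_fin -cdfrE /cdfr fineK; last first.
  by rewrite fin_num_measure//; apply: measurable_le_preim; exact: measurableT_comp.
apply: le_measure.
- by rewrite inE; apply: measurable_le_preim; exact: measurableT_comp.
- by rewrite inE; exact: measurable_le_preim.
- by move=> w /= /hxy.
Qed.

Lemma cdfr_comp_ge (h : R -> R) (x y : R) : measurable_fun setT h ->
  (forall z, z <= y -> h z <= x) -> cdfr P Y y <= cdfr P (h \o Y) x.
Proof.
move=> mh hxy; rewrite -lee_fin -cdfrE /cdfr fineK; last first.
  by rewrite fin_num_measure//; apply: measurable_le_preim; exact: measurableT_comp.
apply: le_measure.
- by rewrite inE; exact: measurable_le_preim.
- by rewrite inE; apply: measurable_le_preim; exact: measurableT_comp.
- by move=> w /= /hxy.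
Qed.

Lemma cdfr_eq0 (x : R) : (forall w, x < Y w) -> cdfr P Y x = 0.
Proof.
move=> xY; rewrite /cdfr (_ : [set w | _] = set0) ?measure0//.
by apply/seteqP; split=> // w /=; rewrite leNgt xY.
Qed.

Lemma cdfr_eq1 (x : R) : (forall w, Y w <= x) -> cdfr P Y x = 1.
Proof.
move=> xY; rewrite /cdfr (_ : [set w | _] = setT) ?probability_setT//.
by apply/seteqP; split=> w //= _; exact: xY.
Qed.

End cdf.

Section weak_convergence.
Context (R : realType) (I : Type) (F : set_system I) {FF : Filter F}.
Context d (T : measurableType d) (P : probability T R).
Context d' (T' : measurableType d') (P' : probability T' R).

(** Weak convergence in a form that does not mention continuity points; two thresholds a < b
    leave room for the atoms of the limit. *)
Definition wcvg (Y : I -> T -> R) (Z : T' -> R) := forall a b e : R,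
  a < b -> 0 < e -> \forall t \near F,
    cdfr P (Y t) a <= cdfr P' Z b + e /\ cdfr P' Z a <= cdfr P (Y t) b + e.

(** Between two levels a < b the function h either stays on one side or crosses continuously, in
    which case the sets {h <= a} and {h > b} are separated by an interval. *)
Lemma nondecreasing_separation (h : R -> R) (a b : R) :
  a < b -> continuous h -> {homo h : x y / x <= y} ->
  [\/ forall y, a < h y, forall y, h y <= b |
   exists c c', [/\ c < c', forall y, h y <= a -> y <= c & forall y, y <= c' -> h y <= b]].
Proof.
move=> ab ch ndh.
pose m := (a + b) / 2; have am : a < m by rewrite /m; lra.
have mb : m < b by rewrite /m; lra.
have [H1|/existsNP[y0 /negP]] := pselect (forall y, a < h y); first by constructor 1.
rewrite -leNgt => y0a.
have [H2|/existsNP[y1 /negP]] := pselect (forall y, h y <= b); first by constructor 2.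
rewrite -ltNge => y1b.
constructor 3.
have y01 : y0 <= y1.
  by rewrite leNgt; apply/negP => /ltW/ndh; lra.
have cw : {within `[y0, y1], continuous h} by exact: continuous_subspaceT.
have [c _ hc] : exists2 c, c \in `[y0, y1] & h c = m.
  apply: IVT => //; rewrite (min_idPl _) ?(max_idPr _); [|lra|lra].
  by apply/andP; split; lra.
have : \forall y \near c^'+, h y < b.
  have /cvgr_lt : h y @[y --> c^'+] --> h c by apply: cvg_at_right_filter; exact: ch.
  by apply; rewrite hc.
move=> near_b.
have [c' [cc' hc']] : exists c', c < c' /\ h c' < b.
  by near c^'+ => c'; exists c'; split; near: c'; [exact: nbhs_right_gt|].
exists c, c'; split => // y.
  by move=> hya; rewrite leNgt; apply/negP => /ltW/ndh; lra.
by move=> /ndh hy; apply: (le_trans hy); exact: ltW.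
Unshelve. all: by end_near. Qed.

Lemma wcvg_comp (Y : I -> T -> R) (Z : T' -> R) (h : R -> R) :
  (forall t, measurable_fun setT (Y t)) -> measurable_fun setT Z ->
  continuous h -> {homo h : x y / x <= y} ->
  wcvg Y Z -> wcvg (fun t => h \o Y t) (h \o Z).
Proof.
move=> mY mZ ch ndh YZ a b e ab e0.
have mh : measurable_fun setT h by exact: continuous_measurable_fun.
have mhY t : measurable_fun setT (h \o Y t) by exact: measurableT_comp.
have mhZ : measurable_fun setT (h \o Z) by exact: measurableT_comp.
have [ah|hb|[c [c' [cc' hc hc']]]] := nondecreasing_separation ab ch ndh.
- apply: filterE => t; rewrite !(@cdfr_eq0 _ _ _ _ _ a)// => [|w|w]; try exact: ah.
  by split; rewrite addr_ge0 ?cdfr_ge0// ltW.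
- apply: filterE => t; rewrite !(@cdfr_eq1 _ _ _ _ _ b)// => [|w|w]; try exact: hb.
  by split; apply: (@le_trans _ _ 1); rewrite ?cdfr_le1 ?lerDl// ltW.
near=> t.
have [H1 H2] : cdfr P (Y t) c <= cdfr P' Z c' + e /\ cdfr P' Z c <= cdfr P (Y t) c' + e.
  by near: t; exact: YZ.
split.
  apply: le_trans (cdfr_comp P (mY t) mh hc) _; apply: (le_trans H1).
  by rewrite lerD2r; exact: cdfr_comp_ge.
apply: le_trans (cdfr_comp P' mZ mh hc) _; apply: (le_trans H2).
by rewrite lerD2r; exact: cdfr_comp_ge.
Unshelve. all: by end_near. Qed.

End weak_convergence.

Section levels.
Context (R : realType).

(** The number of levels j < k below u is u up to 1, as long as u lies between -1 and k. *)
Lemma count_levels_ge (u : R) (k : nat) :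
  Num.min u k%:R <= \sum_(j < k) (j%:R < u)%R%:R.
Proof.
elim: k => [|k IHk]; first by rewrite big_ord0 ge_min lexx orbT.
rewrite big_ord_recr/=; move: IHk; move: (\sum_(_ < _) _) => s.
rewrite -natr1 !ge_min; case: (boolP (k%:R < u)) => [_|] /=.
  by move=> /orP[us|ks]; apply/orP; [left|right]; lra.
by rewrite -leNgt => uk /orP[us|ks]; apply/orP; left; lra.
Qed.

Lemma count_levels_le (u : R) (k : nat) : -1 <= u ->
  \sum_(j < k) (j%:R < u)%R%:R <= Num.min k%:R (u + 1).
Proof.
move=> u1; elim: k => [|k IHk]; first by rewrite big_ord0 le_min lexx; lra.
rewrite big_ord_recr/=; move: IHk; move: (\sum_(_ < _) _) => s.
rewrite -natr1 !le_min => /andP[sk su].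
by case: (boolP (k%:R < u)) => [ku|_] /=; apply/andP; split; lra.
Qed.

End levels.

Section expectation_convergence.
Context (R : realType).

(** For a variable V with values in [0, 1], the average over j < k of the probabilities of
    V > j / k is the expectation of V up to 1 / k.  Comparing V at level j / k with W at level
    (j - 1) / k leaves the room that weak convergence requires. *)
Lemma expectation_le_of_cdf d (T : measurableType d) (P : probability T R)
    d' (T' : measurableType d') (P' : probability T' R) (V : T -> R) (W : T' -> R)
    (k : nat) (e : R) :
  measurable_fun setT V -> measurable_fun setT W ->
  (forall w, 0 <= V w <= 1) -> (forall w, 0 <= W w <= 1) -> (0 < k)%N ->
  (forall j, (j < k)%N ->
     cdfr P' W ((j%:R - 1) / k%:R) <= cdfr P V (j%:R / k%:R) + e) ->
  \int[P]_w V w <= \int[P']_w W w + e + 2 / k%:R.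
Proof.
move=> mV mW V01 W01 k0 H.
have kR : 0 < k%:R :> R by rewrite ltr0n.
have mgt d0 (T0 : measurableType d0) (U : T0 -> R) (y : R) : measurable_fun setT U ->
    measurable_fun setT (fun w => (y < U w)%R%:R : R).
  move=> mU; rewrite (_ : (fun w => _) = (fun w => 1 - \1_[set w | U w <= y] w)).
    by apply: measurable_funB => //; apply: measurable_indic; exact: measurable_le_preim.
  apply/funext => w; rewrite indicE; case: (boolP (_ \in _)).
    by rewrite inE/= leNgt => /negbTE ->; rewrite subrr.
  by rewrite notin_setE/= => /negP; rewrite -ltNge => ->; rewrite subr0.
have igt d0 (T0 : measurableType d0) (P0 : probability T0 R) (U : T0 -> R) (y : R) :
    measurable_fun setT U ->
    P0.-integrable setT (EFin \o (fun w => (y < U w)%R%:R : R)).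
  move=> mU; apply: (@bounded_integrable _ _ _ _ _ 1); first exact: mgt.
  by move=> w; case: (_ < _); rewrite ?normr0 ?normr1.
have Egt d0 (T0 : measurableType d0) (P0 : probability T0 R) (U : T0 -> R) (y : R) :
    measurable_fun setT U ->
    \int[P0]_w (y < U w)%R%:R = 1 - cdfr P0 U y.
  move=> mU; rewrite /cdfr fine_prob_indic; last exact: measurable_le_preim.
  rewrite -[X in _ = X - _](Rintegral_cst_prob P0 1) -RintegralB//; last 2 first.
  - exact: finite_measure_integrable_cst.
  - by apply: indic_integrable; exact: measurable_le_preim.
  apply: eq_Rintegral => w _; rewrite indicE; case: (boolP (_ \in _)).
    by rewrite inE/= leNgt => /negbTE ->; rewrite subrr.
  by rewrite notin_setE/= => /negP; rewrite -ltNge => ->; rewrite subr0.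
have sumE d0 (T0 : measurableType d0) (P0 : probability T0 R) (U : T0 -> R) (y : nat -> R)
    (n : nat) : measurable_fun setT U ->
    P0.-integrable setT (EFin \o (fun w => \sum_(j < n) (y j < U w)%R%:R)) /\
    \int[P0]_w (\sum_(j < n) (y j < U w)%R%:R) = \sum_(j < n) (1 - cdfr P0 U (y j)).
  move=> mU; elim: n => [|n [IHi IHE]].
    rewrite big_ord0; under eq_Rintegral do rewrite big_ord0.
    rewrite Rintegral_cst_prob; split=> //.
    apply: (eq_integrable measurableT (cst 0%E)); last exact: integrable0.
    by move=> w _; rewrite /= big_ord0.
  under eq_Rintegral do rewrite big_ord_recr/=.
  rewrite big_ord_recr/= RintegralD// ?IHE ?Egt//; last exact: igt.
  split=> //.
  have := integrableD measurableT IHi (igt _ _ P0 U (y n) mU).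
  by apply: eq_integrable => // w _; rewrite /= big_ord_recr.
have iU d0 (T0 : measurableType d0) (P0 : probability T0 R) (U : T0 -> R) :
    measurable_fun setT U -> (forall w, 0 <= U w <= 1) -> P0.-integrable setT (EFin \o U).
  move=> mU U01; apply: (@bounded_integrable _ _ _ _ _ 1) => // w.
  by have /andP[U0 U1] := U01 w; rewrite ger0_norm.
have [iV EV] := sumE _ _ P V (fun j => j%:R / k%:R) k mV.
have [iW EW] := sumE _ _ P' W (fun j => (j%:R - 1) / k%:R) k mW.
have step1 : k%:R * \int[P]_w V w <= \sum_(j < k) (1 - cdfr P V (j%:R / k%:R)).
  rewrite -EV -RintegralZl//; last exact: iU.
  apply: le_Rintegral => //; first exact: (integrableZl measurableT k%:R (iU _ _ P V mV V01)).
  move=> w _; have := count_levels_ge (k%:R * V w) k.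
  have /andP[V0 V1] := V01 w.
  have kV : k%:R * V w <= k%:R by rewrite ler_piMr// ltW.
  rewrite (min_idPl kV).
  move=> /le_trans; apply; apply: ler_sum => j _.
  by rewrite ltr_pdivrMr// mulrC.
have step2 : \sum_(j < k) (1 - cdfr P V (j%:R / k%:R)) <=
             \sum_(j < k) (1 - cdfr P' W ((j%:R - 1) / k%:R)) + k%:R * e.
  rewrite -[X in _ <= _ + X * _](_ : \sum_(j < k) 1 = _); last first.
    by rewrite sumr_const card_ord.
  rewrite mulr_suml -big_split/=; apply: ler_sum => j _.
  by have := H j (ltn_ord j); lra.
have step3 : \sum_(j < k) (1 - cdfr P' W ((j%:R - 1) / k%:R)) <=
             k%:R * \int[P']_w W w + 2.
  have iWW := iU _ _ P' W mW W01.
  have ikW := integrableZl measurableT k%:R iWW.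
  have i2 : P'.-integrable setT (EFin \o (fun _ => 2 : R)).
    exact: finite_measure_integrable_cst.
  rewrite -EW -RintegralZl// -(Rintegral_cst_prob P' 2) -RintegralD//.
  apply: le_Rintegral => //; first exact: (integrableD measurableT ikW i2).
  move=> w _; have /andP[W0 W1] := W01 w.
  have kW0 : 0 <= k%:R * W w by rewrite mulr_ge0.
  have u1 : -1 <= k%:R * W w + 1 by lra.
  have := count_levels_le k u1; rewrite le_min => /andP[_].
  rewrite (_ : k%:R * W w + 1 + 1 = k%:R * W w + 2); last by ring.
  apply: le_trans; apply: ler_sum => j _.
  by rewrite ltr_pdivrMr// ltrBlDr mulrC.
rewrite -(ler_pM2l kR) !mulrDr mulrCA divff ?gt_eqF// mulr1.
by apply: (le_trans step1); apply: (le_trans step2); lra.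
Qed.

End expectation_convergence.

Section wcvg_expectation.
Context (R : realType) (I : Type) (F : set_system I) {FF : Filter F}.
Context d (T : measurableType d) (P : probability T R).
Context d' (T' : measurableType d') (P' : probability T' R).

Lemma wcvg_expectation01 (V : I -> T -> R) (W : T' -> R) :
  (forall t, measurable_fun setT (V t)) -> measurable_fun setT W ->
  (forall t w, 0 <= V t w <= 1) -> (forall w, 0 <= W w <= 1) ->
  wcvg F P P' V W -> \int[P]_w V t w @[t --> F] --> \int[P']_w W w.
Proof.
move=> mV mW V01 W01 VW; apply/cvgrPdist_le => e e0.
pose k := (Num.trunc (4 / e)).+1.
have kN : (0 < k)%N by [].
have k0 : 0 < k%:R :> R by rewrite ltr0n.
have ke : 2 / k%:R <= e / 2.
  rewrite ler_pdivrMr//.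
  have : 4 / e <= k%:R by apply: ltW; exact: truncnS_gt.
  by rewrite ler_pdivrMr//; lra.
have step (j : nat) : (j%:R - 1) / k%:R < j%:R / k%:R :> R.
  by rewrite ltr_pM2r ?invr_gt0//; lra.
have e2 : 0 < e / 2 by rewrite divr_gt0.
have H : \forall t \near F, forall j, (j < k)%N ->
    cdfr P (V t) ((j%:R - 1) / k%:R) <= cdfr P' W (j%:R / k%:R) + e / 2 /\
    cdfr P' W ((j%:R - 1) / k%:R) <= cdfr P (V t) (j%:R / k%:R) + e / 2.
  have : \forall t \near F, forall j : 'I_k,
    cdfr P (V t) ((j%:R - 1) / k%:R) <= cdfr P' W (j%:R / k%:R) + e / 2 /\
    cdfr P' W ((j%:R - 1) / k%:R) <= cdfr P (V t) (j%:R / k%:R) + e / 2.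
    by apply: filter_forall => j; apply: VW.
  by apply: filterS => t Ht j jk; exact: (Ht (Ordinal jk)).
near=> t.
have Ht : forall j, (j < k)%N ->
    cdfr P (V t) ((j%:R - 1) / k%:R) <= cdfr P' W (j%:R / k%:R) + e / 2 /\
    cdfr P' W ((j%:R - 1) / k%:R) <= cdfr P (V t) (j%:R / k%:R) + e / 2.
  by near: t; exact: H.
have H1 := expectation_le_of_cdf (mV t) mW (V01 t) W01 kN
  (fun j jk => (Ht j jk).2).
have H2 := expectation_le_of_cdf mW (mV t) W01 (V01 t) kN
  (fun j jk => (Ht j jk).1).
by apply: ler_norm_of_bounds; lra.
Unshelve. all: by end_near. Qed.

(** The image of weak convergence under a monotone continuous map to [0, 1] is again weak
    convergence, and there expectations are controlled by distribution functions. *)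
Lemma wcvg_expectation_nd (Y : I -> T -> R) (Z : T' -> R) (h : R -> R) (M : R) :
  (forall t, measurable_fun setT (Y t)) -> measurable_fun setT Z ->
  continuous h -> {homo h : x y / x <= y} -> 0 < M -> (forall y, `|h y| <= M) ->
  wcvg F P P' Y Z -> \int[P]_w h (Y t w) @[t --> F] --> \int[P']_w h (Z w).
Proof.
move=> mY mZ ch ndh M0 hM YZ.
have mh : measurable_fun setT h by exact: continuous_measurable_fun.
pose g y := (2 * M)^-1 * (h y + M).
have MM : 0 < 2 * M by rewrite mulr_gt0.
have cg : continuous g.
  by move=> y; apply: cvgMr; apply: cvgD; [exact: ch|exact: cvg_cst].
have ndg : {homo g : x y / x <= y}.
  by move=> x y xy; rewrite ler_wpM2l ?invr_ge0 ?(ltW MM)// lerD2r ndh.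
have g01 y : 0 <= g y <= 1.
  have /ler_normlP[h1 h2] := hM y.
  have h3 : 0 <= h y + M by lra.
  have h4 : h y + M <= 2 * M by lra.
  apply/andP; split; first by rewrite mulr_ge0 ?invr_ge0 ?(ltW MM).
  by rewrite /g mulrC ler_pdivrMr// mul1r.
have mg : measurable_fun setT g by exact: continuous_measurable_fun.
have cv : \int[P]_w g (Y t w) @[t --> F] --> \int[P']_w g (Z w).
  apply: (wcvg_expectation01 _ _ _ _ (wcvg_comp mY mZ cg ndg YZ)) => //.
  - by move=> t; exact: measurableT_comp.
  - exact: measurableT_comp.
  - by move=> t w /=.
  - by move=> w /=.
have hE d0 (T0 : measurableType d0) (P0 : probability T0 R) (U : T0 -> R) :
    measurable_fun setT U -> 2 * M * \int[P0]_w g (U w) - M = \int[P0]_w h (U w).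
  move=> mU; have iU : P0.-integrable setT (EFin \o (h \o U)).
    apply: (@bounded_integrable _ _ _ _ _ M); first exact: measurableT_comp.
    by move=> w; exact: hM.
  have iM : P0.-integrable setT (EFin \o (fun _ => M)).
    exact: finite_measure_integrable_cst.
  rewrite RintegralZl//; last exact: (integrableD measurableT iU iM).
  by rewrite RintegralD// Rintegral_cst_prob mulrA divff ?gt_eqF// mul1r addrK.
rewrite -(hE _ _ P' Z mZ).
have : 2 * M * \int[P]_w g (Y t w) - M @[t --> F] --> 2 * M * \int[P']_w g (Z w) - M.
  by apply: cvgB; [exact: cvgMr|exact: cvg_cst].
by apply: cvg_trans; apply: near_eq_cvg; apply: filterE => t; rewrite hE.
Qed.

End wcvg_expectation.

Section convergence_in_distribution.
Context (R : realType).
Context d (T : measurableType d) (P : probability T R).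
Context d' (T' : measurableType d') (P' : probability T' R).
Variables (Y : R -> T -> R) (Z : T' -> R).
Hypotheses (mY : forall t, measurable_fun setT (Y t)) (mZ : measurable_fun setT Z).

(** Insert a continuity point between the two thresholds. *)
Lemma wcvg_of_cvg_in_distribution :
  cvg_in_distribution P P' Y Z -> wcvg (@pinfty_nbhs R) P P' Y Z.
Proof.
move=> YZ a b e ab e0.
have [x /andP[ax xb] cx] := nondecreasing_continuity_point ab (cdfr_nd P' mZ).
have cxE : {for x, continuous (fun y : R => P' [set w | Z w <= y])}.
  rewrite (_ : (fun y => _) = EFin \o cdfr P' Z); last first.
    by apply/funext => y; rewrite (cdfrE P' mZ).
  by apply: cvg_EFin; [exact: nearW|exact: cx].
have := YZ x cxE.
rewrite (cdfrE P' mZ) => /fine_cvg cv.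
have /cvgrPdist_le/(_ e e0) H : cdfr P (Y t) x @[t --> +oo%R] --> cdfr P' Z x.
  by exact: cv.
near=> t.
have : `|cdfr P' Z x - cdfr P (Y t) x| <= e by near: t; exact: H.
move=> /ler_normlP[H1 H2].
have := cdfr_nd P (mY t) (ltW ax); have := cdfr_nd P (mY t) (ltW xb).
have := cdfr_nd P' mZ (ltW ax); have := cdfr_nd P' mZ (ltW xb).
by move=> *; split; lra.
Unshelve. all: by end_near. Qed.

Lemma cvg_in_distribution_of_wcvg :
  wcvg (@pinfty_nbhs R) P P' Y Z -> cvg_in_distribution P P' Y Z.
Proof.
move=> YZ x cx.
have cE : (fun y : R => P' [set w | Z w <= y]) = EFin \o cdfr P' Z.
  by apply/funext => y; rewrite (cdfrE P' mZ).
have cvx : cdfr P' Z y @[y --> x] --> cdfr P' Z x.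
  by move: cx; rewrite cE /continuous_at /= => /fine_cvg.
rewrite (cdfrE P' mZ).
rewrite (_ : (fun t => _) = (fun t => (cdfr P (Y t) x)%:E)); last first.
  by apply/funext => t; rewrite (cdfrE P (mY t)).
apply: cvg_EFin; first exact: nearW.
apply/cvgrPdist_le => e e0.
have e2 : 0 < e / 2 by rewrite divr_gt0.
move/cvgrPdist_le : cvx => /(_ _ e2) [r /= r0 Hr].
pose x1 := x - r / 2; pose x2 := x + r / 2.
have H1 : `|cdfr P' Z x - cdfr P' Z x1| <= e / 2.
  by apply: Hr; rewrite /= /x1 opprB addrC subrK ger0_norm ?divr_ge0 ?ltW//; lra.
have H2 : `|cdfr P' Z x - cdfr P' Z x2| <= e / 2.
  apply: Hr; rewrite /= /x2 opprD addrA subrr sub0r normrN.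
  by rewrite ger0_norm ?divr_ge0 ?ltW//; lra.
have x1x : x1 < x by rewrite /x1; lra.
have xx2 : x < x2 by rewrite /x2; lra.
near=> t.
have [A1 A2] : cdfr P (Y t) x1 <= cdfr P' Z x + e / 2 /\
               cdfr P' Z x1 <= cdfr P (Y t) x + e / 2.
  by near: t; exact: YZ.
have [B1 B2] : cdfr P (Y t) x <= cdfr P' Z x2 + e / 2 /\
               cdfr P' Z x <= cdfr P (Y t) x2 + e / 2.
  by near: t; exact: YZ.
move/ler_normlP : H1 => [C1 C2]; move/ler_normlP : H2 => [D1 D2].
by apply: ler_norm_of_bounds; lra.
Unshelve. all: by end_near. Qed.

End convergence_in_distribution.

Section slutsky.
Context (R : realType) d (T : measurableType d) (P : probability T R).

Lemma measurable_dist_gt (A B : T -> R) (eta : R) :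
  measurable_fun setT A -> measurable_fun setT B ->
  measurable [set w | eta < `|A w - B w|].
Proof.
by move=> mA mB; apply: measurable_gt_preim; apply: measurableT_comp => //; exact: measurable_funB.
Qed.

Lemma cdfr_perturb (A B : T -> R) (eta y : R) :
  measurable_fun setT A -> measurable_fun setT B ->
  cdfr P B y <= cdfr P A (y + eta) + fine (P [set w | eta < `|A w - B w|]).
Proof.
move=> mA mB.
have mD := measurable_dist_gt eta mA mB.
have mAy := measurable_le_preim (y + eta) mA.
have mBy := measurable_le_preim y mB.
rewrite -lee_fin EFinD -!cdfrE// fineK ?fin_num_measure//.
apply: (@le_trans _ _ (P ([set w | A w <= y + eta] `|` [set w | eta < `|A w - B w|]))).
  apply: le_measure; rewrite ?inE//; first exact: measurableU.
  move=> w /= Bw; case: (leP (A w) (y + eta)) => [|Aw]; [by left|right].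
  by apply: lt_le_trans (ler_norm _); lra.
exact: measureU2.
Qed.

(** Slutsky's theorem: a perturbation that is small with high probability preserves the
    comparison. *)
Lemma levy_slutsky (A B : T -> R) d' (T' : measurableType d') (P' : probability T' R)
    (Z : T' -> R) (eta eps : R) :
  measurable_fun setT A -> measurable_fun setT B -> measurable_fun setT Z -> 0 <= eta ->
  levy_close P A P' Z eta eps -> fine (P [set w | eta < `|A w - B w|]) <= eps ->
  levy_close P B P' Z (eta + eta) (eps + eps).
Proof.
move=> mA mB mZ e0 AZ AB y; split.
  have := cdfr_perturb eta y mA mB; have [+ _] := AZ (y + eta).
  by rewrite [y + (eta + eta)]addrA; lra.
have := cdfr_perturb eta (y + eta) mB mA; have [_ +] := AZ y.
rewrite (_ : [set w | eta < `|B w - A w|] = [set w | eta < `|A w - B w|]); last first.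
  by apply/seteqP; split=> w /=; rewrite distrC.
by rewrite [y + (eta + eta)]addrA; lra.
Qed.

End slutsky.

(** * Random sample sizes *)

Section random_index.
Context d (T : measurableType d) (R : realType) (P : probability T R).
Context (N : R -> {RV P >-> nat}) (Xs : nat -> {RV P >-> R}).
Hypothesis indepN : process_indep N Xs.

Let sX := sigma_of [set: nat] (fun i => Xs i : T -> R).

Lemma sigma_of_measurable (A : set T) : sX A -> measurable A.
Proof.
apply: smallest_sub; first exact: sigma_algebra_measurable.
move=> B [i _ [C mC <-]]; exact: (measurable_funP (Xs i)).
Qed.

(** The random index being independent of the sample, an event depending on the sample and the
    index has the probability obtained by freezing the index. *)
Lemma prob_random_index (t : R) (B : nat -> set T) : 0 <= t ->
  (forall n, sX (B n)) ->
  fine (P [set w | B (N t w) w]) = \int[P]_w fine (P (B (N t w))).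
Proof.
move=> t0 sB.
have mB n : measurable (B n) by exact: sigma_of_measurable.
pose A n := N t @^-1` [set n].
have mA n : measurable (A n).
  by rewrite -[A n]setTI; exact: (measurable_funP (N t)).
have sA n : sigma_of [set t : R | 0 <= t] (fun t => N t : T -> nat) (A n).
  apply: sub_sigma_algebra; exists t => //; exists [set n] => //.
  by rewrite setTI.
have trA : trivIset setT A by exact: trivIset_preimage1.
have AT : \bigcup_n A n = setT.
  by apply/seteqP; split=> w //= _; exists (N t w).
have -> : [set w | B (N t w) w] = \bigcup_n (A n `&` B n).
  apply/seteqP; split=> w /=; first by exists (N t w).
  by move=> [n _ [<-]].
rewrite measure_bigcup//=; last 2 first.
- by move=> n _; exact: measurableI.
- exact: trivIset_setIr.
rewrite /Rintegral -AT ge0_integral_bigcup//.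
- congr fine; rewrite eseries_mkcond; apply: eq_eseriesr => n _; rewrite in_setT.
  rewrite (eq_integral (fun=> (fine (P (B n)))%:E)); last first.
    by move=> w; rewrite inE => ->.
  by rewrite integral_cst// fineK ?fin_num_measure// muleC; exact: (indepN (sA n) (sB n)).
- rewrite AT; apply: measurable_funTS; apply/measurable_EFinP.
  have mp : measurable_fun setT (fun n : nat => fine (P (B n))) by [].
  exact: (measurableT_comp mp (measurable_funP (N t))).
- by move=> w _; rewrite lee_fin fine_ge0.
Qed.

End random_index.

Section measurability.
Context (R : realType) d (T : measurableType d).

Lemma measurable_inv : measurable_fun setT (fun x : R => x^-1).
Proof.
rewrite (_ : setT = [set 0] `|` ~` [set (0 : R)]); last by rewrite setUv.
apply/measurable_funU => //; first exact: measurableC.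
split; first exact: measurable_fun_set1.
apply: open_continuous_measurable_fun.
  by apply: closed_openC; exact: closed_eq.
by move=> x; rewrite inE/= => /eqP x0; exact: inv_continuous.
Qed.

Lemma measurable_sqrt : measurable_fun setT (@Num.sqrt R).
Proof. by apply: continuous_measurable_fun => x; exact: sqrt_continuous. Qed.

Lemma measurable_sample_CoVar_of (x : nat -> T -> R) (n : nat) :
  (forall i, measurable_fun setT (x i)) ->
  measurable_fun setT (fun w => sample_CoVar_of (fun i => x i w) n).
Proof.
move=> mx; rewrite /sample_CoVar_of; case: (n == 0%N) => //.
have mm : measurable_fun setT (fun w => sample_mean (fun i => x i w) n).
  by apply: measurable_funM => //; apply: measurable_sum => i; exact: mx.
apply: measurable_funM; last exact: (measurableT_comp measurable_inv).
apply: (measurableT_comp measurable_sqrt); apply: measurable_funM => //.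
apply: measurable_sum => i; apply: measurable_funX; exact: measurable_funB.
Qed.

Lemma measurable_index (A : nat -> T -> R) (M : T -> nat) :
  (forall n, measurable_fun setT (A n)) -> measurable_fun setT M ->
  measurable_fun setT (fun w => A (M w) w).
Proof.
move=> mA mM _ B mB; rewrite setTI.
rewrite (_ : _ @^-1` B = \bigcup_n (M @^-1` [set n] `&` A n @^-1` B)).
  apply: bigcupT_measurable => n; apply: measurableI.
    by rewrite -[X in measurable X]setTI; exact: mM.
  by rewrite -[X in measurable X]setTI; exact: mA.
apply/seteqP; split=> w /=; first by move=> Bw; exists (M w).
by move=> [n _ [<-]].
Qed.

End measurability.

(** Right-continuity at 0 of the distribution function, which vanishes there. *)
Lemma cdfr_near0 d (T : measurableType d) (R : realType) (Q : probability T R)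
    (L : {RV Q >-> R}) (eps : R) : Q [set w | 0 < L w] = 1%E -> 0 < eps ->
  exists2 delta, 0 < delta & cdfr Q L delta <= eps.
Proof.
move=> L0 e0.
have F0 : cdfr Q L 0 = 0.
  rewrite /cdfr (_ : [set w | L w <= 0] = ~` [set w | 0 < L w]); last first.
    by apply/seteqP; split=> w /=; rewrite leNgt => /negP.
  by rewrite probability_setC ?L0 ?subee//; exact: measurable_gt_preim.
have := @cdf_right_continuous _ _ _ Q L 0.
have cE : (cdf L : R -> \bar R) = EFin \o cdfr Q L.
  apply/funext => r; transitivity (cdfr Q L r)%:E => //.
  by rewrite -cdfrE.
rewrite cE => /fine_cvg/=; rewrite F0 => /cvgrPdist_le/(_ _ e0) H.
near (0:R)^'+ => delta; exists delta; first by near: delta; exact: nbhs_right_gt.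
have : `|0 - cdfr Q L delta| <= eps by near: delta; exact: H.
by rewrite sub0r normrN; apply: le_trans; exact: ler_norm.
Unshelve. all: by end_near. Qed.

Section small_index.
Context d (T : measurableType d) d' (T' : measurableType d') (R : realType).
Context (P : probability T R) (Q : probability T' R).
Context (N : R -> {RV P >-> nat}) (L : {RV Q >-> R}).
Hypothesis NL : D_averages N L.

Lemma measurable_rate (t : R) : measurable_fun setT (fun w => (N t w)%:R / t).
Proof.
apply: measurable_funM => //.
have mn : measurable_fun setT (fun n : nat => n%:R : R) by [].
exact: (measurableT_comp mn (measurable_funP (N t))).
Qed.

Lemma rate_wcvg : wcvg (@pinfty_nbhs R) P Q (fun t w => (N t w)%:R / t) L.
Proof.
by apply: wcvg_of_cvg_in_distribution => //; [exact: measurable_rate|exact: (proj1 NL)].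
Qed.

Lemma small_rate (eps : R) : 0 < eps -> exists2 delta, 0 < delta &
  \forall t \near +oo%R, cdfr P (fun w => (N t w)%:R / t) delta <= eps.
Proof.
move=> e0; have e2 : 0 < eps / 2 by rewrite divr_gt0.
have [delta d0 Ld] := cdfr_near0 (proj2 NL) e2.
exists (delta / 2); first by rewrite divr_gt0.
near=> t.
have [+ _] : cdfr P (fun w => (N t w)%:R / t) (delta / 2) <= cdfr Q L delta + eps / 2 /\
    cdfr Q L (delta / 2) <= cdfr P (fun w => (N t w)%:R / t) delta + eps / 2.
  by near: t; apply: rate_wcvg => //; lra.
lra.
Unshelve. all: by end_near. Qed.

(** Since N(t) / t is bounded away from 0 with high probability, functions of N(t) need only be
    compared at indices of order t at least. *)
Lemma index_average_close (p q : R -> nat -> R) :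
  (forall t n, 0 <= p t n <= 1) -> (forall t n, 0 <= q t n <= 1) ->
  (forall eps delta, 0 < eps -> 0 < delta -> \forall t \near +oo%R,
     forall n, delta * t <= n%:R -> `|p t n - q t n| <= eps) ->
  forall eps, 0 < eps -> \forall t \near +oo%R,
    `|\int[P]_w p t (N t w) - \int[P]_w q t (N t w)| <= eps.
Proof.
move=> p01 q01 pq eps e0.
have e2 : 0 < eps / 2 by rewrite divr_gt0.
have [delta d0 Hd] := small_rate e2.
have mp (f : nat -> R) t : measurable_fun setT (fun w => f (N t w)).
  have mf : measurable_fun setT f by [].
  exact: (measurableT_comp mf (measurable_funP (N t))).
have ip (f : nat -> R) t : (forall n, 0 <= f n <= 1) ->
    P.-integrable setT (EFin \o (fun w => f (N t w))).
  move=> f01; apply: (@bounded_integrable _ _ _ _ _ 1) => // w.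
  by have /andP[f0 f1] := f01 (N t w); rewrite ger0_norm.
near=> t.
have t0 : 0 < t by near: t; exact: nbhs_pinfty_gt.
have Ht : forall n, delta * t <= n%:R -> `|p t n - q t n| <= eps / 2.
  by near: t; exact: pq.
have Hdt : cdfr P (fun w => (N t w)%:R / t) delta <= eps / 2 by near: t; exact: Hd.
have i1 := ip _ t (p01 t); have i2 := ip _ t (q01 t).
have iB := integrableB measurableT i1 i2.
rewrite -RintegralB//; apply: (le_trans (le_normr_Rintegral _ iB)) => //.
have mset := measurable_le_preim delta (measurable_rate t).
have iI := indic_integrable P mset.
have iE : P.-integrable setT (EFin \o (fun _ : T => eps / 2)).
  exact: finite_measure_integrable_cst.
apply: (@le_trans _ _ (\int[P]_w (eps / 2 + \1_[set w | (N t w)%:R / t <= delta] w))).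
  apply: le_Rintegral => //; first exact: integrable_norm iB.
    exact: (integrableD measurableT iE iI).
  move=> w _; rewrite indicE; case: (boolP (_ \in _)) => [_|].
    have /andP[p0 p1] := p01 t (N t w); have /andP[q0 q1] := q01 t (N t w).
    by apply: ler_norm_of_bounds; rewrite /=; lra.
  rewrite notin_setE/= => /negP; rewrite -ltNge ltr_pdivlMr// => Hn.
  by rewrite addr0; apply: Ht; exact: ltW.
rewrite RintegralD// Rintegral_cst_prob -fine_prob_indic//.
by move: Hdt; rewrite /cdfr; lra.
Unshelve. all: by end_near. Qed.

End small_index.

(** * The limit law as a scale mixture of normal laws *)

Section gaussian_cdf.
Context (R : realType).

(** The distribution function of N(0, s^2), written as that of s times a standard normal variable
    so that s = 0 is covered. *)
Definition gauss_cdf (s y : R) : R := cdfr (normal_prob 0 1) (fun g : R => s * g) y.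

Lemma measurable_scale (s : R) : measurable_fun setT (fun g : R => s * g).
Proof. by apply: measurable_funM => //; exact: measurable_id. Qed.

Lemma gauss_cdf01 s y : 0 <= gauss_cdf s y <= 1.
Proof. by rewrite cdfr_ge0 cdfr_le1//; exact: measurable_scale. Qed.

Lemma gauss_cdf_nd s : {homo gauss_cdf s : x y / x <= y}.
Proof. by move=> x y xy; apply: cdfr_nd => //; exact: measurable_scale. Qed.

Lemma gauss_cdf0 (y : R) : gauss_cdf 0 y = (0 <= y)%R%:R.
Proof.
rewrite /gauss_cdf; case: (leP 0 y) => y0.
  by rewrite cdfr_eq1// => w; rewrite mul0r.
by rewrite cdfr_eq0// => w; rewrite mul0r.
Qed.

(** The normal density is bounded by its value at the mean. *)
Lemma gauss_cdf_lipschitz (s y eta : R) : 0 < s -> 0 <= eta ->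
  gauss_cdf s (y + eta) <= gauss_cdf s y + normal_peak 1 / s * eta.
Proof.
move=> s0 eta0; have ms := measurable_scale s.
rewrite -lee_fin EFinD /gauss_cdf -(cdfrE (normal_prob 0 1) ms).
rewrite -(cdfrE (normal_prob 0 1) ms).
pose I : set R := `]y / s, (y + eta) / s]%classic.
have mI : measurable I by exact: measurable_itv.
apply: (@le_trans _ _ (normal_prob 0 1 ([set g : R | s * g <= y] `|` I))).
  apply: le_measure; rewrite ?inE.
  - exact: measurable_le_preim.
  - by apply: measurableU => //; exact: measurable_le_preim.
  - move=> g /= gy; case: (leP (s * g) y) => [|yg]; [by left|right].
    by rewrite /I /= in_itv/= ltr_pdivrMr// ler_pdivlMr// ![g * s]mulrC yg.
apply: le_trans (measureU2 _ _ _) _ => //; first exact: measurable_le_preim.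
rewrite leeD2l// /normal_prob.
apply: (@le_trans _ _ (\int[lebesgue_measure]_(x in I) (normal_peak 1 : R)%:E)%E).
  apply: ge0_le_integral => //.
  - by move=> x _; rewrite lee_fin normal_pdf_ge0.
  - apply: measurable_funTS; apply/measurable_EFinP; exact: measurable_normal_pdf.
  - by move=> x _; rewrite lee_fin normal_pdf_ub ?oner_eq0.
rewrite integral_cst// [X in (_ * X)%E]lebesgue_measure_itv/= lte_fin.
rewrite ltr_pM2r ?invr_gt0// ltrDl.
case: ifPn => e0; last by rewrite mule0 lee_fin !mulr_ge0 ?invr_ge0 ?normal_peak_ge0 ?(ltW s0).
rewrite -EFinB -EFinM lee_fin -mulrBl [y + eta]addrC addrK.
by rewrite -mulrA [s^-1 * _]mulrC.
Qed.

Lemma continuous_gauss_cdf (s : R) : 0 < s -> continuous (gauss_cdf s).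
Proof.
move=> s0 x; apply/cvgrPdist_le => e e0.
pose k := normal_peak 1 / s; have k0 : 0 < k by rewrite divr_gt0// normal_peak_gt0// oner_eq0.
near=> y.
have xy : `|x - y| <= e / k.
  near: y; have := @cvg_id _ (nbhs x) => /cvgrPdist_le; apply.
  by rewrite divr_gt0.
have {}xy : k * `|x - y| <= e by rewrite mulrC -ler_pdivlMr.
have L1 := gauss_cdf_lipschitz (Num.min x y) s0 (normr_ge0 (x - y)).
case: (leP x y) => cxy.
  move: L1; rewrite (min_idPl cxy) distrC ger0_norm ?subr_ge0// subrKC.
  have := gauss_cdf_nd s cxy; move: xy; rewrite distrC ger0_norm ?subr_ge0// -/k.
  by move=> *; apply: ler_norm_of_bounds; lra.
move: L1; rewrite (min_idPr (ltW cxy)) ger0_norm ?subr_ge0 ?(ltW cxy)// subrKC.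
have := gauss_cdf_nd s (ltW cxy); move: xy; rewrite ger0_norm ?subr_ge0 ?(ltW cxy)// -/k.
by move=> *; apply: ler_norm_of_bounds; lra.
Unshelve. all: by end_near. Qed.

(** Closeness in the Levy sense to a law with a Lipschitz distribution function is uniform
    closeness of the distribution functions. *)
Lemma levy_close_uniform d (T : measurableType d) (P : probability T R) (U : T -> R)
    (s eta eps y : R) : 0 < s -> 0 <= eta ->
  levy_close P U (normal_prob 0 1) (fun g : R => s * g) eta eps ->
  `|cdfr P U y - gauss_cdf s y| <= normal_peak 1 / s * eta + eps.
Proof.
move=> s0 eta0 H.
have [H1 _] := H y; have [_ H2] := H (y - eta).
rewrite subrK in H2.
have L1 := gauss_cdf_lipschitz y s0 eta0.
have := gauss_cdf_lipschitz (y - eta) s0 eta0; rewrite subrK => L2.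
rewrite -/(gauss_cdf s (y + eta)) in H1; rewrite -/(gauss_cdf s (y - eta)) in H2.
by apply: ler_norm_of_bounds; lra.
Qed.

Lemma cdfr_normal_law d (T : measurableType d) (P : probability T R) (Z : {RV P >-> R})
    (s y : R) : 0 <= s ->
  (forall A : set R, measurable A -> distribution P Z A = normal_law 0 (s ^+ 2) A) ->
  cdfr P Z y = gauss_cdf s y.
Proof.
move=> s0 ZE.
have mI : measurable (`]-oo, y]%classic : set R) by exact: measurable_itv.
have -> : cdfr P Z y = fine (distribution P Z `]-oo, y]%classic) by [].
rewrite (ZE _ mI) /normal_law sqrf_eq0 sqrtr_sqr ger0_norm//.
case: eqP => [->|/eqP sn0].
  by rewrite gauss_cdf0 diracE mem_setE in_itv.
rewrite -(normal_prob_affine 0 sn0 mI) /gauss_cdf /cdfr; congr fine.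
by congr (normal_prob _ _ _); apply/seteqP; split=> g /=; rewrite in_itv/= add0r.
Qed.

End gaussian_cdf.

Section full_events.
Context d (T : measurableType d) (R : realType) (P : probability T R).

Lemma measure_setI_full (A G : set T) : measurable A -> measurable G ->
  P G = 1%E -> P (A `&` G) = P A.
Proof.
move=> mA mG G1; apply/eqP; rewrite eq_le; apply/andP; split.
  by apply: le_measure; rewrite ?inE//; exact: measurableI.
have -> : P A = P ((A `&` G) `|` (A `&` ~` G)) by rewrite -setIUr setUv setIT.
apply: (le_trans (measureU2 _ _ _)); try exact: measurableI.
  by apply: measurableI => //; exact: measurableC.
rewrite -[leRHS]adde0 leeD2l//.
apply: (@le_trans _ _ (P (~` G))).
  apply: le_measure; rewrite ?inE//; last exact: measurableC.
  by apply: measurableI => //; exact: measurableC.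
by rewrite probability_setC// G1 subee.
Qed.

Lemma cdfr_eq_full (Y Z : T -> R) (G : set T) (y z : R) :
  measurable_fun setT Y -> measurable_fun setT Z -> measurable G -> P G = 1%E ->
  (forall w, G w -> (Y w <= y) = (Z w <= z)) -> cdfr P Y y = cdfr P Z z.
Proof.
move=> mY mZ mG G1 YZ; rewrite /cdfr; congr fine.
rewrite -(measure_setI_full (measurable_le_preim y mY) mG G1).
rewrite -(measure_setI_full (measurable_le_preim z mZ) mG G1).
by congr (P _); apply/seteqP; split=> w /= [Yw Gw]; split=> //; rewrite ?YZ// -?YZ.
Qed.

End full_events.

Section ratio_law.
Context (R : realType) d (T : measurableType d) (P : probability T R).
Context d' (T' : measurableType d') (Q : probability T' R).
Variables (Z L2 : {RV P >-> R}) (L : {RV Q >-> R}) (s : R).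
Hypotheses (s0 : 0 <= s) (LL2 : same_law L2 L) (L0 : Q [set w | 0 < L w] = 1%E).
Hypothesis ZE : forall A : set R, measurable A ->
  distribution P Z A = normal_law 0 (s ^+ 2) A.
Hypothesis ZL : indep_RV P Z L2.

Let mgt : measurable [set y : R | 0 < y].
Proof.
by apply: measurable_gt_preim; exact: measurable_id.
Qed.

Lemma measurable_ratio : measurable_fun setT (fun w => Z w / Num.sqrt (L2 w)).
Proof.
apply: measurable_funM => //; apply: (measurableT_comp (@measurable_inv R)).
exact: (measurableT_comp (@measurable_sqrt R)).
Qed.

(** The law of Z / sqrt(L2) is a mixture of centered normal laws: on the almost sure event L2 > 0,
    the quotient is at most x if and only if Z <= x sqrt(L2), and L2 can be frozen by
    independence. *)
Lemma cdfr_ratio (x : R) : cdfr P (fun w => Z w / Num.sqrt (L2 w)) x =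
  \int[Q]_w gauss_cdf s (x * Num.sqrt (L w)).
Proof.
have mG : measurable [set w | 0 < L2 w].
  by have := measurable_funP L2 measurableT _ mgt; rewrite setTI.
have G1 : P [set w | 0 < L2 w] = 1%E.
  by rewrite -L0; exact: (LL2 mgt).
have mD : measurable_fun setT (fun w => Z w - x * Num.sqrt (L2 w)).
  apply: measurable_funB => //; apply: measurable_funM => //.
  exact: (measurableT_comp (@measurable_sqrt R)).
rewrite (@cdfr_eq_full _ _ _ P _ (fun w => Z w - x * Num.sqrt (L2 w)) _ _ 0
  measurable_ratio mD mG G1); last first.
  by move=> w /= w0; rewrite ler_pdivrMr ?sqrtr_gt0// subr_le0.
have indep : indep_RV P L2 Z.
  by move=> A B FA GB; rewrite setIC muleC; exact: ZL.
pose f (p : R * R) := (\1_[set p : R * R | p.2 - x * Num.sqrt p.1 <= 0] p : R)%:E.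
have mset : measurable [set p : R * R | p.2 - x * Num.sqrt p.1 <= 0].
  apply: (@measurable_le_preim _ _ _ (fun p : R * R => p.2 - x * Num.sqrt p.1) 0).
  apply: measurable_funB => //; apply: measurable_funM => //.
  exact: (measurableT_comp (@measurable_sqrt R)).
have mf : measurable_fun setT f by apply/measurable_EFinP; exact: measurable_indic.
have f0 p : (0 <= f p)%E by rewrite lee_fin.
rewrite /cdfr fine_prob_indic; last exact: (measurable_le_preim 0 mD).
rewrite /Rintegral; congr fine.
transitivity (\int[P]_w f (L2 w, Z w))%E.
  by apply: eq_integral => w _; rewrite /f !indicE.
have mL2 : measurable_fun setT L2 by [].
have mZ : measurable_fun setT Z by [].
rewrite (ge0_integral_indep mL2 mZ indep mf f0).
have mPhi : measurable_fun setT (fun y : R => (gauss_cdf s (x * Num.sqrt y))%:E).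
  apply/measurable_EFinP.
  apply: (measurableT_comp (nondecreasing_measurable measurableT _)).
    exact: gauss_cdf_nd.
  by apply: measurable_funM => //; exact: measurable_sqrt.
transitivity (\int[P]_w (gauss_cdf s (x * Num.sqrt (L2 w)))%:E)%E.
  apply: eq_integral => w _; rewrite -(cdfr_normal_law _ s0 ZE) -cdfrE//.
  transitivity (\int[P]_w' (\1_[set w' | (Z w' <= x * Num.sqrt (L2 w))%R] w')%:E)%E;
    last by rewrite integral_indic ?setIT//; exact: measurable_le_preim.
  apply: eq_integral => u _; rewrite /f !indicE.
  rewrite (_ : (_ \in [set p : R * R | _]) =
    (u \in [set w' | Z w' <= x * Num.sqrt (L2 w)]))//.
  by apply/idP/idP; rewrite !inE/= subr_le0.
apply: (ge0_integral_same_law LL2 mPhi) => y.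
by rewrite lee_fin; have /andP[] := gauss_cdf01 s (x * Num.sqrt y).
Qed.

End ratio_law.

(** * Limit theorems with a random index *)

Section random_index_limit.
Context (R : realType) d (T : measurableType d) (P : probability T R).
Context (N : R -> {RV P >-> nat}) (Xs : nat -> {RV P >-> R}).
Context d' (T' : measurableType d') (Q : probability T' R) (L : {RV Q >-> R}).
Hypotheses (indepN : process_indep N Xs) (NL : D_averages N L).
Variables (A : nat -> T -> R) (s : R).
Hypothesis mA : forall n, measurable_fun setT (A n).
Hypothesis sA : forall n (B : set R), measurable B ->
  sigma_of [set: nat] (fun i => Xs i : T -> R) (A n @^-1` B).
Hypothesis s0 : 0 <= s.
Hypothesis limA : forall eta eps : R, 0 < eta -> 0 < eps ->
  \forall n \near \oo, levy_close P (fun w => Num.sqrt n%:R * A n w)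
    (normal_prob 0 1) (fun g : R => s * g) eta eps.

Let U n w := Num.sqrt n%:R * A n w.
Let V t w := Num.sqrt t * A (N t w) w.

Let mU n : measurable_fun setT (U n).
Proof. by apply: measurable_funM. Qed.

Lemma measurable_index_scaled t : measurable_fun setT (V t).
Proof. by apply: measurable_funM => //; apply: measurable_index. Qed.

Let cdf_frozen (t x : R) : 0 <= t ->
  cdfr P (V t) x = \int[P]_w cdfr P (fun w' => Num.sqrt t * A (N t w) w') x.
Proof.
move=> t0; rewrite /cdfr.
apply: (@prob_random_index _ _ _ _ _ _ indepN t
  (fun n => [set w | Num.sqrt t * A n w <= x]) t0) => n.
have mI : measurable [set y : R | Num.sqrt t * y <= x].
  by apply: measurable_le_preim; apply: measurable_funM => //; exact: measurable_id.
exact: (sA n mI).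
Qed.

(** Changing the normalization from sqrt n to sqrt t moves the threshold by the factor
    sqrt (n / t), a function of the rate of the index. *)
Let cdf_rescale (t x : R) (n : nat) : 0 < t -> (0 < n)%N ->
  cdfr P (fun w => Num.sqrt t * A n w) x = cdfr P (U n) (x * Num.sqrt (n%:R / t)).
Proof.
move=> t0 n0; rewrite /cdfr; congr (fine (P _)).
have st : 0 < Num.sqrt t by rewrite sqrtr_gt0.
have sn : 0 < Num.sqrt n%:R :> R by rewrite sqrtr_gt0 ltr0n.
have snt : Num.sqrt (n%:R / t) = Num.sqrt n%:R / Num.sqrt t.
  by rewrite sqrtrM ?ler0n// sqrtrV// ltW.
apply/seteqP; split=> w /=; rewrite /U snt mulrA ler_pdivlMr//.
  by rewrite mulrAC [x * _]mulrC -mulrA ler_pM2l// mulrC.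
by rewrite mulrAC [x * _]mulrC -mulrA ler_pM2l// mulrC.
Qed.

Let p01 t x n : 0 <= cdfr P (fun w => Num.sqrt t * A n w) x <= 1.
Proof.
by rewrite cdfr_ge0 cdfr_le1//; apply: measurable_funM.
Qed.

(** It suffices to approximate the conditional distribution function given N(t) = n for n of
    order t, by functions q whose averages converge. *)
Let cvg_of_close (x l : R) (q : R -> nat -> R) :
  (forall t n, 0 <= q t n <= 1) ->
  (forall eps delta, 0 < eps -> 0 < delta -> \forall t \near +oo%R,
     forall n, delta * t <= n%:R ->
       `|cdfr P (fun w => Num.sqrt t * A n w) x - q t n| <= eps) ->
  \int[P]_w q t (N t w) @[t --> +oo%R] --> l ->
  cdfr P (V t) x @[t --> +oo%R] --> l.
Proof.
move=> q01 pq ql; apply/cvgrPdist_le => e e0.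
have e2 : 0 < e / 2 by rewrite divr_gt0.
move/cvgrPdist_le : ql => /(_ _ e2) ql.
have close := index_average_close NL (fun t n => p01 t x n) q01 pq e2.
near=> t.
have t0 : 0 <= t by near: t; apply: nbhs_pinfty_ge; exact: num_real.
have Hq : `|l - \int[P]_w q t (N t w)| <= e / 2 by near: t; exact: ql.
have Hp : `|\int[P]_w cdfr P (fun w' => Num.sqrt t * A (N t w) w') x -
            \int[P]_w q t (N t w)| <= e / 2 by near: t; exact: close.
rewrite -(cdf_frozen x t0) in Hp.
move: Hq Hp => /ler_normlP[a1 a2] /ler_normlP[b1 b2].
by apply: ler_norm_of_bounds; lra.
Unshelve. all: by end_near. Qed.

Let near_large (S : set nat) (delta : R) : 0 < delta -> (\forall n \near \oo, S n) ->
  \forall t \near +oo%R, 0 < t /\ forall n, delta * t <= n%:R -> (0 < n)%N /\ S n.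
Proof.
move=> d0 [m _ mS]; near=> t.
have t0 : 0 < t by near: t; exact: nbhs_pinfty_gt.
have tm : m.+1%:R / delta <= t by near: t; apply: nbhs_pinfty_ge; exact: num_real.
split=> // n dtn.
have : m.+1%:R <= n%:R :> R.
  by apply: le_trans dtn; rewrite mulrC -ler_pdivrMr.
rewrite ler_nat => mn; split; first exact: leq_trans mn.
by apply: mS => /=; exact: ltnW.
Unshelve. all: by end_near. Qed.

(** Given N(t) = n, the distribution function at x is close to gauss_cdf s (x sqrt (n / t)), a
    monotone continuous function of n / t; it remains to use that N(t) / t converges weakly. *)
Let cvg_positive (x : R) : 0 < s ->
  cdfr P (V t) x @[t --> +oo%R] --> \int[Q]_w gauss_cdf s (x * Num.sqrt (L w)).
Proof.
move=> sp.
(* Depending on the sign of x, this function of y is nondecreasing for sg = 1 or sg = -1. *)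
pose h (sg y : R) := sg * gauss_cdf s (x * Num.sqrt y).
apply: (@cvg_of_close x _ (fun t n => gauss_cdf s (x * Num.sqrt (n%:R / t)))).
- by move=> t n; exact: gauss_cdf01.
- move=> eps delta e0 d0.
  pose k := normal_peak 1 / s.
  have k0 : 0 < k by rewrite divr_gt0// normal_peak_gt0// oner_eq0.
  have eta0 : 0 < eps / 2 / k by rewrite divr_gt0// divr_gt0.
  have e2 : 0 < eps / 2 by rewrite divr_gt0.
  apply: filterS (near_large d0 (limA eta0 e2)) => t [t0 Ht] n /Ht [n0 Hn].
  rewrite cdf_rescale//.
  apply: (le_trans (levy_close_uniform _ sp (ltW eta0) Hn)).
  by rewrite -/k mulrC divfK ?gt_eqF//; lra.
- have ch sg : continuous (h sg).
    move=> y; rewrite /h; apply: cvgMr.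
    apply: (@continuous_comp _ _ _ (fun y => x * Num.sqrt y) (gauss_cdf s)).
      by apply: cvgMr; exact: sqrt_continuous.
    exact: continuous_gauss_cdf.
  have hM sg y : `|sg| = 1 -> `|h sg y| <= 1.
    move=> sg1; rewrite normrM sg1 mul1r.
    by have /andP[g0 g1] := gauss_cdf01 s (x * Num.sqrt y); rewrite ger0_norm.
  have mr := @measurable_rate _ _ _ P N.
  have rw := rate_wcvg NL.
  have [x0|x0] := leP 0 x.
    have nd : {homo h 1 : y z / y <= z}.
      move=> y z yz; rewrite /h !mul1r; apply: gauss_cdf_nd.
      by rewrite ler_wpM2l// ler_wsqrtr.
    have cv : \int[P]_w h 1 ((N t w)%:R / t) @[t --> +oo%R] --> \int[Q]_w h 1 (L w).
      exact: (wcvg_expectation_nd mr (measurable_funP L) (ch 1) nd ltr01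
        (fun y => hM 1 y (normr1 _)) rw).
    have ig d0 (T0 : measurableType d0) (P0 : probability T0 R) (Y : T0 -> R) :
        \int[P0]_w h 1 (Y w) = \int[P0]_w gauss_cdf s (x * Num.sqrt (Y w)).
      by apply: eq_Rintegral => w _; rewrite /h mul1r.
    rewrite -ig; apply: cvg_trans cv; apply: near_eq_cvg; apply: nearW => t /=.
    by rewrite ig.
  have nd : {homo h (-1) : y z / y <= z}.
    move=> y z yz; rewrite /h !mulN1r lerN2; apply: gauss_cdf_nd.
    by rewrite ler_wnM2l// ?ler_wsqrtr// ltW.
  have cv : \int[P]_w h (-1) ((N t w)%:R / t) @[t --> +oo%R] --> \int[Q]_w h (-1) (L w).
    exact: (wcvg_expectation_nd mr (measurable_funP L) (ch (-1)) nd ltr01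
      (fun y => hM (-1) y (normrN1 _)) rw).
  have ig d0 (T0 : measurableType d0) (P0 : probability T0 R) (Y : T0 -> R) :
      measurable_fun setT Y ->
      \int[P0]_w h (-1) (Y w) = - \int[P0]_w gauss_cdf s (x * Num.sqrt (Y w)).
    move=> mY; rewrite /h RintegralZl ?mulN1r//.
    have mg : measurable_fun setT (fun y : R => gauss_cdf s (x * Num.sqrt y)).
      have -> : (fun y => gauss_cdf s (x * Num.sqrt y)) = h 1.
        by apply/funext => y; rewrite /h mul1r.
      exact: continuous_measurable_fun.
    apply: (@bounded_integrable _ _ _ _ _ 1); first exact: (measurableT_comp mg mY).
    by move=> w; rewrite -[gauss_cdf _ _]mul1r; apply: (hM 1); exact: normr1.
  rewrite -[X in _ --> X]opprK -(ig _ _ Q L)//; apply: cvg_trans (cvgN cv).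
  apply: near_eq_cvg.
  apply: nearW => t; apply: oppr_inj.
  rewrite -(ig _ _ P (fun w => (N t w)%:R / t) (mr t)).
  exact: opprK.
Qed.

(** In the degenerate case the limit is a point mass at 0, and the moved threshold x sqrt (n / t)
    stays away from 0 as long as n / t does. *)
Let cvg_zero (x : R) : s = 0 -> x != 0 ->
  cdfr P (V t) x @[t --> +oo%R] --> ((0 <= x)%R%:R : R).
Proof.
move=> sz xn0.
apply: (@cvg_of_close x _ (fun _ _ => (0 <= x)%R%:R)).
- by move=> t n; case: (0 <= x)%R; rewrite ?ler01 ?lexx.
- move=> eps delta e0 d0.
  have [x0|x0] := ltP x 0.
    pose eta := - x * Num.sqrt delta / 2.
    have eta0 : 0 < eta by rewrite divr_gt0// mulr_gt0 ?oppr_gt0// sqrtr_gt0.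
    apply: filterS (near_large d0 (limA eta0 e0)) => t [t0 Ht] n dn.
    have [n0 Hn] := Ht n dn.
    rewrite cdf_rescale//= ?mulr0n subr0 ger0_norm ?cdfr_ge0//.
    have xs : x * Num.sqrt (n%:R / t) <= x * Num.sqrt delta.
      by rewrite ler_wnM2l ?(ltW x0)// ler_wsqrtr// ler_pdivlMr.
    apply: (le_trans (cdfr_nd P (mU n) xs)).
    have [+ _] := Hn (x * Num.sqrt delta).
    have neg : (0 <= x * Num.sqrt delta + eta) = false.
      by apply/negbTE; rewrite -ltNge; move: eta0; rewrite /eta; lra.
    by rewrite -/(gauss_cdf s _) sz gauss_cdf0 neg mulr0n add0r.
  have {}x0 : 0 < x by rewrite lt_neqAle eq_sym xn0.
  pose eta := x * Num.sqrt delta.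
  have eta0 : 0 < eta by rewrite mulr_gt0// sqrtr_gt0.
  apply: filterS (near_large d0 (limA eta0 e0)) => t [t0 Ht] n dn.
  have [n0 Hn] := Ht n dn.
  rewrite cdf_rescale//= ?mulr1n distrC ger0_norm ?subr_ge0 ?cdfr_le1//.
  have xs : x * Num.sqrt delta <= x * Num.sqrt (n%:R / t).
    by rewrite ler_wpM2l ?(ltW x0)// ler_wsqrtr// ler_pdivlMr.
  have := cdfr_nd P (mU n) xs.
  have [_] := Hn 0.
  rewrite -/(gauss_cdf s _) sz gauss_cdf0 lexx add0r -/eta /U /=; lra.
- by under eq_fun do rewrite Rintegral_cst_prob; exact: cvg_cst.
Qed.

(** The normal limit at deterministic sample sizes survives the random index, with an independent
    factor 1 / sqrt(Lambda).  Convergence of the distribution functions at one point between any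
    two thresholds is enough; for s = 0 that point is chosen different from 0, the atom of the
    limit. *)
Lemma random_index_limit d2 (T2 : measurableType d2) (P2 : probability T2 R)
    (Z L2 : {RV P2 >-> R}) :
  same_law L2 L ->
  (forall B : set R, measurable B -> distribution P2 Z B = normal_law 0 (s ^+ 2) B) ->
  indep_RV P2 Z L2 ->
  wcvg (@pinfty_nbhs R) P P2 V (fun w => Z w / Num.sqrt (L2 w)).
Proof.
move=> LL2 ZE ZL a b e ab e0.
have mr := measurable_ratio Z L2.
have ratioE x := cdfr_ratio s0 LL2 (proj2 NL) ZE ZL x.
have [x [xab cvx]] : exists x, a < x < b /\
    cdfr P (V t) x @[t --> +oo%R] --> cdfr P2 (fun w => Z w / Num.sqrt (L2 w)) x.
  move: (s0); rewrite le0r => /predU1P[sz|sp]; last first.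
    exists ((a + b) / 2); split; first by apply/andP; split; lra.
    by rewrite ratioE; exact: cvg_positive.
  have [x xab xn0] : exists2 x, a < x < b & x != 0.
    have [E|E] := eqVneq ((a + b) / 2) 0.
      exists ((b - a) / 4); first by apply/andP; split; lra.
      by rewrite gt_eqF// divr_gt0// subr_gt0.
    by exists ((a + b) / 2) => //; apply/andP; split; lra.
  exists x; split=> //; rewrite ratioE.
  have -> : \int[Q]_w gauss_cdf s (x * Num.sqrt (L w)) = (0 <= x)%R%:R.
    have [x0|x0] := ltP x 0; last first.
      transitivity (\int[Q]_(w in setT) (1 : R)); last by rewrite Rintegral_cst_prob.
      by apply: eq_Rintegral => w _; rewrite sz gauss_cdf0 mulr_ge0 ?sqrtr_ge0.
    rewrite -(Rintegral_cst_prob Q (false)%:R) /Rintegral; congr fine.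
    have mL : measurable_fun setT L by [].
    have mG : measurable [set w | 0 < L w] by exact: measurable_gt_preim.
    have Gc : Q (~` [set w | 0 < L w]) = 0%E.
      by rewrite probability_setC// (proj2 NL) subee.
    apply: ge0_ae_eq_integral => //.
    - apply/measurable_EFinP; rewrite sz.
      apply: (measurableT_comp (nondecreasing_measurable measurableT _)).
        exact: gauss_cdf_nd.
      by apply: measurable_funM => //; exact: (measurableT_comp (@measurable_sqrt R)).
    - by move=> w _; rewrite lee_fin; have /andP[] := gauss_cdf01 s (x * Num.sqrt (L w)).
    exists (~` [set w | 0 < L w]); split => //; first exact: measurableC.
    move=> w /= H Lw; apply: H => _.
    by rewrite sz gauss_cdf0 leNgt nmulr_rlt0// sqrtr_gt0 Lw.
  exact: cvg_zero.
move/andP: xab => [ax xb].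
move/cvgrPdist_le : cvx => /(_ _ e0) cvx.
near=> t.
have : `|cdfr P2 (fun w => Z w / Num.sqrt (L2 w)) x - cdfr P (V t) x| <= e.
  by near: t; exact: cvx.
move=> /ler_normlP[H1 H2].
have mV := measurable_index_scaled t.
have := cdfr_nd P mV (ltW ax); have := cdfr_nd P mV (ltW xb).
have := cdfr_nd P2 mr (ltW ax); have := cdfr_nd P2 mr (ltW xb).
by move=> *; split; lra.
Unshelve. all: by end_near. Qed.

End random_index_limit.

(** * Linearization of the sample coefficient of variation *)

Section delta_method.
Context (R : realType).

(** The deterministic core of the delta method.  With E such that Cn^2 - C^2 = r E, the difference
    Cn - C is r E / (Cn + C); replacing Cn + C by 2 C, and then m1 by mu1 in E, costs O(r) each
    time, and the two errors are the two terms of the bound. *)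
Lemma delta_bound (mu1 mu2 C K r D M m1 Cn : R) :
  0 < mu1 -> 0 <= mu2 -> 0 < C -> 0 < K -> 0 < r -> r <= 1 ->
  `|D| <= K -> `|M| <= K -> r * K <= mu1 / 2 -> m1 = mu1 + r * D -> 0 <= Cn ->
  Cn ^+ 2 - C ^+ 2 = r * (M - mu2 * r * D ^+ 2) / (m1 ^+ 2 * mu1 ^+ 2) ->
  `|r^-1 * (Cn - C) - M / (2 * C * mu1 ^+ 4)| <=
  r * (((K + mu2 * K ^+ 2) * 4 / mu1 ^+ 4) ^+ 2 / (2 * C ^+ 3) +
       (3 * K ^+ 2 * mu1 + mu2 * K ^+ 2 * mu1 ^+ 2) * 4 / mu1 ^+ 6 / (2 * C)).
Proof.
move=> mu1p mu2p Cp Kp rp r1 DK MK rK m1E Cn0 CnE.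
have [E EE] : exists E, E = (M - mu2 * r * D ^+ 2) / (m1 ^+ 2 * mu1 ^+ 2).
  by eexists.
have /ler_normlP[D1 D2] := DK.
have rD1 : r * D <= mu1 / 2 by apply: le_trans rK; rewrite ler_wpM2l// ltW.
have rD2 : - (mu1 / 2) <= r * D.
  rewrite lerNl -mulrN; apply: le_trans rK; rewrite ler_wpM2l//; first exact: ltW.
have m1h : mu1 / 2 <= m1 by rewrite m1E; lra.
have m1p : 0 < m1 by apply: lt_le_trans m1h; rewrite divr_gt0.
have D2K : D ^+ 2 <= K ^+ 2.
  by rewrite -[D ^+ 2]real_normK ?num_real// lerXn2r// ?nnegrE// ltW.
have rDD : mu2 * r * D ^+ 2 <= mu2 * K ^+ 2.
  rewrite -mulrA ler_wpM2l//; apply: le_trans D2K.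
  by rewrite ler_piMl// sqr_ge0.
have r0 := ltW rp.
have C0 := ltW Cp.
have rDD0 : 0 <= mu2 * r * D ^+ 2 by apply: mulr_ge0; [exact: mulr_ge0|exact: sqr_ge0].
have m1inv : (m1 ^+ 2)^-1 <= 4 / mu1 ^+ 2.
  rewrite -[4 / _]invrK lef_pV2 ?posrE ?invr_gt0 ?divr_gt0 ?exprn_gt0//.
  rewrite invf_div; have -> : mu1 ^+ 2 / 4 = (mu1 / 2) ^+ 2 by field.
  by rewrite lerXn2r// ?nnegrE ltW// divr_gt0.
have EK : `|E| <= (K + mu2 * K ^+ 2) * 4 / mu1 ^+ 4.
  rewrite EE normrM.
  have -> : (K + mu2 * K ^+ 2) * 4 / mu1 ^+ 4 =
     (K + mu2 * K ^+ 2) * (4 / mu1 ^+ 2 / mu1 ^+ 2) by field; rewrite gt_eqF.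
  apply: ler_pM => //.
    apply: (le_trans (ler_normB _ _)); rewrite (ger0_norm rDD0); exact: lerD.
  rewrite ger0_norm; last by rewrite invr_ge0 mulr_ge0// sqr_ge0.
  by rewrite invfM ler_wpM2r// invr_ge0 sqr_ge0.
set K1 := _ * 4 / mu1 ^+ 4 in EK *.
have K10 : 0 <= K1 by exact: le_trans EK.
have dE : Cn ^+ 2 - C ^+ 2 = r * E by rewrite CnE EE mulrA.
have CC : 0 < Cn + C by rewrite ltr_wpDl.
have dC : Cn - C = r * E / (Cn + C).
  by rewrite -dE subr_sqr mulrK// unitfE gt_eqF.
have s1 : `|r^-1 * (Cn - C) - E / (2 * C)| <= r * (K1 ^+ 2 / (2 * C ^+ 3)).
  have -> : r^-1 * (Cn - C) - E / (2 * C) = - (r * E ^+ 2 / (2 * C * (Cn + C) ^+ 2)).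
    have e1 : r^-1 * (Cn - C) = E / (Cn + C).
      by rewrite dC !mulrA mulVf ?gt_eqF// mul1r.
    have e2 : E / (Cn + C) - E / (2 * C) = - (E * (Cn - C) / (2 * C * (Cn + C))).
      by field; rewrite !gt_eqF.
    rewrite e1 e2 dC; field; by rewrite !gt_eqF.
  rewrite normrN ger0_norm; last first.
    by rewrite divr_ge0// mulr_ge0// ?sqr_ge0// mulr_ge0.
  rewrite -mulrA ler_wpM2l ?(ltW rp)//; apply: ler_pM; rewrite ?sqr_ge0//.
    by rewrite invr_ge0 mulr_ge0 ?sqr_ge0// mulr_ge0.
    by rewrite -[E ^+ 2]real_normK ?num_real// lerXn2r// ?nnegrE.
  rewrite lef_pV2 ?posrE ?mulr_gt0 ?exprn_gt0//.
  have -> : 2 * C ^+ 3 = 2 * C * C ^+ 2 by ring.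
  rewrite ler_wpM2l ?mulr_ge0 ?(ltW Cp)//.
  by rewrite lerXn2r// ?nnegrE ?(ltW Cp) ?(ltW CC)// lerDr.
have s2 : `|E / (2 * C) - M / (2 * C * mu1 ^+ 4)| <=
   r * ((3 * K ^+ 2 * mu1 + mu2 * K ^+ 2 * mu1 ^+ 2) * 4 / mu1 ^+ 6 / (2 * C)).
  have -> : E / (2 * C) - M / (2 * C * mu1 ^+ 4) =
    r * (- (M * (D * (2 * mu1 + r * D)) + mu2 * D ^+ 2 * mu1 ^+ 2)
          * ((m1 ^+ 2)^-1 / mu1 ^+ 4) / (2 * C)).
    rewrite EE m1E; field; by rewrite -m1E !gt_eqF.
  rewrite normrM (gtr0_norm rp) ler_wpM2l ?(ltW rp)// normrM.
  rewrite [Num.norm (2 * C)^-1]ger0_norm ?invr_ge0 ?mulr_ge0 ?(ltW Cp)//.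
  rewrite ler_wpM2r ?invr_ge0 ?mulr_ge0 ?(ltW Cp)// normrM normrN.
  rewrite -[leRHS]mulrA; apply: ler_pM => //.
    apply: (le_trans (ler_normD _ _)); apply: lerD; last first.
      rewrite ger0_norm; last first.
        by apply: mulr_ge0; [exact: (mulr_ge0 mu2p (sqr_ge0 _))|exact: sqr_ge0].
      by rewrite ler_wpM2r ?sqr_ge0// ler_wpM2l.
    rewrite !normrM.
    have -> : 3 * K ^+ 2 * mu1 = K * (K * (3 * mu1)) by ring.
    apply: ler_pM => //; apply: ler_pM => //; rewrite ger0_norm; lra.
  rewrite ger0_norm; last first.
    by rewrite divr_ge0 ?invr_ge0 ?sqr_ge0// exprn_ge0// ltW.
  have -> : 4 / mu1 ^+ 6 = 4 / mu1 ^+ 2 / mu1 ^+ 4 by field; rewrite gt_eqF.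
  by rewrite ler_wpM2r// invr_ge0 exprn_ge0// ltW.
rewrite [leRHS]mulrDr; apply: le_trans (lerD s1 s2); apply: le_trans (ler_normD _ _).
by rewrite addrA subrK.
Qed.

End delta_method.

Section sample_algebra.
Context (R : realType).

(** The square of the statistic is a rational function of the first two empirical moments, whose
    linearization needs no square root. *)
Lemma sample_CoVar_sqr (x : nat -> R) (n : nat) : (0 < n)%N -> 0 < sample_mean x n ->
  0 <= sample_CoVar_of x n /\
  sample_CoVar_of x n ^+ 2 =
  (n%:R^-1 * \sum_(i < n) x i ^+ 2) / sample_mean x n ^+ 2 - 1.
Proof.
move=> n0 m0; rewrite /sample_CoVar_of gtn_eqF//.
split; first by rewrite divr_ge0 ?sqrtr_ge0// ltW.
have nn0 : n%:R != 0 :> R by rewrite pnatr_eq0 -lt0n.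
rewrite expr_div_n /sample_sd sqr_sqrtr; last first.
  by rewrite mulr_ge0 ?invr_ge0// sumr_ge0// => i _; exact: sqr_ge0.
have -> : n%:R^-1 * \sum_(i < n) (x i - sample_mean x n) ^+ 2 =
    n%:R^-1 * \sum_(i < n) x i ^+ 2 - sample_mean x n ^+ 2.
  set m := sample_mean x n.
  have sE : \sum_(i < n) x i = n%:R * m by rewrite /m /sample_mean mulVKf.
  have -> : \sum_(i < n) (x i - m) ^+ 2 =
      \sum_(i < n) x i ^+ 2 - 2 * m * (\sum_(i < n) x i) + n%:R * m ^+ 2.
    rewrite mulr_sumr -sumrB -[n%:R * m ^+ 2](_ : \sum_(i < n) m ^+ 2 = _); last first.
      by rewrite sumr_const card_ord mulr_natl.
    by rewrite -big_split/=; apply: eq_bigr => i _; ring.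
  by rewrite sE; field.
by rewrite mulrBl divff// expf_neq0// gt_eqF.
Qed.

End sample_algebra.

Section moments.
Context d (T : measurableType d) (R : realType) (P : probability T R).
Variable X : {RV P >-> R}.
Hypothesis mu4_fin : ('E_P[fun w => (X w ^+ 4)%R] < +oo)%E.

Lemma momentE k : moment P X k = \int[P]_w (X w ^+ k).
Proof. by rewrite /moment unlock. Qed.

Lemma power_le (x : R) (k : nat) : (k <= 4)%N -> `|x ^+ k| <= 1 + x ^+ 4.
Proof.
move=> k4; have x40 : 0 <= x ^+ 4 by exact: exprn_even_ge0.
rewrite normrX; have [x1|x1] := leP `|x| 1.
  by apply: (@le_trans _ _ 1); rewrite ?lerDl// exprn_ile1.
apply: (@le_trans _ _ (`|x| ^+ 4)); first by rewrite ler_weXn2l// ltW.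
by rewrite -normrX ger0_norm// lerDr.
Qed.

Lemma power_integrable k : (k <= 4)%N -> P.-integrable setT (EFin \o (fun w => X w ^+ k)).
Proof.
move=> k4.
have mX j : measurable_fun setT (fun w => X w ^+ j) by apply: measurable_funX.
have i4 : P.-integrable setT (EFin \o (fun w => X w ^+ 4)).
  apply/integrableP; split; first by apply/measurable_EFinP.
  move: mu4_fin; rewrite unlock; apply: le_lt_trans; rewrite le_eqVlt; apply/orP; left.
  apply/eqP; apply: eq_integral => w _ /=.
  by rewrite ger0_norm// exprn_even_ge0.
have i1 : P.-integrable setT (EFin \o (fun _ : T => 1 : R)).
  exact: finite_measure_integrable_cst.
have := integrableD measurableT i1 i4.
apply: le_integrable => //; first by apply/measurable_EFinP.
move=> w _ /=; rewrite lee_fin; apply: (le_trans (power_le (X w) k4)).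
exact: ler_norm.
Qed.

(** Everything that is needed on X is the expectation of polynomials of degree at most 4. *)
Lemma poly_moment (c0 c1 c2 c3 c4 : R) (f : R -> R) :
  (forall x, f x = c0 + c1 * x + c2 * x ^+ 2 + c3 * x ^+ 3 + c4 * x ^+ 4) ->
  P.-integrable setT (EFin \o (fun w => f (X w))) /\
  \int[P]_w f (X w) = c0 + c1 * moment P X 1 + c2 * moment P X 2
    + c3 * moment P X 3 + c4 * moment P X 4.
Proof.
move=> fE; have i0 : P.-integrable setT (EFin \o (fun _ : T => c0)).
  exact: finite_measure_integrable_cst.
have iZ k (c : R) : (k <= 4)%N -> P.-integrable setT (EFin \o (fun w => c * X w ^+ k)).
  by move=> k4; exact: (integrableZl measurableT c (power_integrable k4)).
have i1 := iZ 1 c1 isT; have i2 := iZ 2 c2 isT.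
have i3 := iZ 3 c3 isT; have i4 := iZ 4 c4 isT.
have s1 := integrableD measurableT i0 i1.
have s2 := integrableD measurableT s1 i2.
have s3 := integrableD measurableT s2 i3.
have s4 := integrableD measurableT s3 i4.
have E : (fun w => f (X w)) =
  (fun w => c0 + c1 * X w ^+ 1 + c2 * X w ^+ 2 + c3 * X w ^+ 3 + c4 * X w ^+ 4).
  by apply/funext => w; rewrite fE expr1.
rewrite E; split; first exact: s4.
rewrite RintegralD// RintegralD// RintegralD// RintegralD//.
by rewrite Rintegral_cst_prob !RintegralZl ?power_integrable// !momentE.
Qed.

End moments.

Lemma prob_le_second_moment d (T : measurableType d) (R : realType)
    (P : probability T R) (xi : T -> R) (a : R) (A : set T) : 0 < a -> measurable A ->
  P.-integrable setT (EFin \o (fun w => xi w ^+ 2)) ->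
  (forall w, A w -> a ^+ 2 <= xi w ^+ 2) ->
  fine (P A) <= (\int[P]_w (xi w ^+ 2)) / a ^+ 2.
Proof.
move=> a0 mA ixi2 H; rewrite ler_pdivlMr ?exprn_gt0//.
have iI := indic_integrable P mA.
rewrite fine_prob_indic// -RintegralZr//; apply: le_Rintegral => //.
  exact: (integrableZr measurableT (a ^+ 2) iI).
move=> w _; rewrite indicE; case: (boolP (_ \in _)) => [|_].
  by rewrite inE mul1r; exact: H.
by rewrite mul0r sqr_ge0.
Qed.

Section gaussian_tails.
Context (R : realType).

Let isg2 (s : R) : (normal_prob 0 1).-integrable setT (EFin \o (fun g : R => (s * g) ^+ 2)).
Proof.
have := integrableZl measurableT (s ^+ 2) (integrable_normal_sqr R).
by apply: eq_integrable => // g _; rewrite /= exprMn EFinM.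
Qed.

Let Esg2 (s : R) : \int[normal_prob 0 1]_g ((s * g) ^+ 2) = s ^+ 2.
Proof.
under eq_Rintegral do rewrite exprMn.
by rewrite RintegralZl ?Rintegral_normal_sqr ?mulr1//; exact: integrable_normal_sqr.
Qed.

Let tail_le (s a : R) (A : set R) : 0 < a -> measurable A ->
  (forall g, A g -> a ^+ 2 <= (s * g) ^+ 2) -> fine (normal_prob 0 1 A) <= s ^+ 2 / a ^+ 2.
Proof.
move=> a0 mA H; rewrite -Esg2.
exact: (prob_le_second_moment (P := normal_prob 0 1) a0 mA (isg2 s) H).
Qed.

Lemma gauss_tail_left (s a : R) : 0 < a -> gauss_cdf s (- a) <= s ^+ 2 / a ^+ 2.
Proof.
move=> a0; apply: tail_le => //.
  by apply: measurable_le_preim; exact: measurable_scale.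
move=> g /= sg; rewrite -[leRHS]sqrrN; rewrite lerXn2r// ?nnegrE; lra.
Qed.

Lemma gauss_tail_right (s a : R) : 0 < a -> 1 - s ^+ 2 / a ^+ 2 <= gauss_cdf s a.
Proof.
move=> a0; have ms := measurable_scale s.
have mA : measurable [set g : R | s * g <= a] by exact: measurable_le_preim.
have : fine (normal_prob 0 1 (~` [set g : R | s * g <= a])) <= s ^+ 2 / a ^+ 2.
  apply: tail_le => //; first exact: measurableC.
  by move=> g /= /negP; rewrite -ltNge => sg; rewrite lerXn2r// ?nnegrE; lra.
rewrite (probability_setC (normal_prob 0 1) mA) (cdfrE (normal_prob 0 1) ms) /=.
by rewrite -/(gauss_cdf s a); lra.
Qed.

(** Chebyshev's inequality for the normal law, transferred to a variable that is close to it. *)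
Lemma levy_close_tight d (T : measurableType d) (P : probability T R) (U : T -> R)
    (s eps K : R) : measurable_fun setT U -> 1 < K ->
  levy_close P U (normal_prob 0 1) (fun g : R => s * g) 1 eps ->
  fine (P [set w | K < `|U w|]) <= 2 * (s ^+ 2 / (K - 1) ^+ 2 + eps).
Proof.
move=> mU K1 H; have K0 : 0 < K - 1 by rewrite subr_gt0.
have [H1 _] := H (- K); have [_ H2] := H (K - 1).
have g1 := gauss_tail_left s K0; have g2 := gauss_tail_right s K0.
rewrite -/(gauss_cdf _ _) (_ : - K + 1 = - (K - 1)) in H1; last by ring.
rewrite -/(gauss_cdf _ _) subrK in H2.
have m1 := measurable_le_preim (- K) mU; have m2 := measurable_le_preim K mU.
apply: (@le_trans _ _ (cdfr P U (- K) + (1 - cdfr P U K))); last by lra.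
have mC : measurable (~` [set w | U w <= K]) by exact: measurableC.
have mAbs : measurable [set w | K < `|U w|].
  have := @measurable_dist_gt _ _ T U (fun=> 0) K mU (measurable_cst _).
  by under eq_set do rewrite subr0.
rewrite -lee_fin fineK ?fin_num_measure// EFinD EFinB -!(cdfrE P mU).
rewrite -(probability_setC P m2).
apply: le_trans (measureU2 P m1 mC).
apply: le_measure; rewrite ?inE//; first exact: measurableU.
move=> w /= KU; case: (leP (U w) K) => [UK|KU']; last by right.
left; case: (leP 0 (U w)) => U0; move: KU; first by rewrite ger0_norm//; lra.
by rewrite ltr0_norm//; lra.
Qed.

End gaussian_tails.

Lemma inv_sqrt_small (R : realType) (rho : R) : 0 < rho ->
  \forall n \near \oo, (Num.sqrt n%:R)^-1 <= rho.
Proof.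
move=> r0; near=> n.
have n0 : (0 < n)%N by near: n; exact: nbhs_infty_gt.
have nr : (rho ^- 2) <= n%:R by near: n; exact: nbhs_infty_ger.
rewrite -[leRHS]invrK lef_pV2 ?posrE ?invr_gt0// ?sqrtr_gt0 ?ltr0n//.
have -> : rho^-1 = Num.sqrt (rho ^- 2).
  by rewrite -exprVn sqrtr_sqr ger0_norm// invr_ge0 ltW.
exact: ler_wsqrtr.
Unshelve. all: by end_near. Qed.

(** On an event of probability at least 1 / 2 the variable exceeds some delta > 0. *)
Lemma Rintegral_gt0 d (T : measurableType d) (R : realType) (P : probability T R)
    (X : {RV P >-> R}) : P [set w | 0 < X w] = 1%E -> P.-integrable setT (EFin \o X) ->
  0 < \int[P]_w X w.
Proof.
move=> X0 iX.
have h2 : 0 < 1 / 2 :> R by rewrite divr_gt0.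
have [delta d0 Hd] := cdfr_near0 X0 h2.
have mX : measurable_fun setT X by [].
pose G := [set w | 0 < X w].
have mG : measurable G by exact: measurable_gt_preim.
have -> : \int[P]_w X w = \int[P]_w Num.max (X w) 0.
  rewrite /Rintegral; congr fine; apply: ae_eq_integral => //.
  - exact/measurable_EFinP.
  - by apply/measurable_EFinP; exact: measurable_maxr.
  have Gc : P (~` G) = 0%E by rewrite probability_setC// X0 subee.
  exists (~` G); split => //; first exact: measurableC.
  by move=> w /= H Gw; apply: H => _; rewrite (max_idPl _)// ltW.
have mA : measurable [set w | X w <= delta] by exact: measurable_le_preim.
have iA := indic_integrable P mA.
have imax : P.-integrable setT (EFin \o (fun w => Num.max (X w) 0)).
  move: iX; apply: le_integrable => //.
    by apply/measurable_EFinP; exact: measurable_maxr.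
  move=> w _ /=; rewrite lee_fin; case: (leP (X w) 0) => // _.
  by rewrite normr0.
have ic : P.-integrable setT (EFin \o (fun _ : T => 1 : R)).
  exact: finite_measure_integrable_cst.
have iB := integrableB measurableT ic iA.
have iD := integrableZl measurableT delta iB.
apply: (@lt_le_trans _ _ (\int[P]_w (delta * (1 - \1_[set w | X w <= delta] w)))).
  rewrite RintegralZl// RintegralB// Rintegral_cst_prob -fine_prob_indic//.
  by rewrite mulr_gt0//; move: Hd; rewrite /cdfr; lra.
apply: le_Rintegral => // w _; rewrite indicE; case: (boolP (_ \in _)) => [_|].
  by rewrite subrr mulr0 le_max lexx orbT.
rewrite notin_setE/= => /negP; rewrite -ltNge => dX.
by rewrite subr0 mulr1 le_max ltW.
Qed.

Section sample_coefficient.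
Context d (T : measurableType d) (R : realType) (P : probability T R).
Context (X : {RV P >-> R}) (Xs : nat -> {RV P >-> R}).
Hypotheses (X_gt0 : P [set w | 0 < X w] = 1%E) (X_nondegenerate : (0 < 'V_P[X])%E).
Hypothesis Xs_iid : iid_copies X Xs.
Hypothesis mu4_fin : ('E_P[fun w => (X w ^+ 4)%R] < +oo)%E.

Let mu k := moment P X k.
Let C := CoVar P X.

Lemma moment1_gt0 : 0 < mu 1.
Proof.
rewrite /mu momentE.
under eq_Rintegral do rewrite expr1.
apply: Rintegral_gt0 => //.
by have := power_integrable mu4_fin (isT : (1 <= 4)%N); apply: eq_integrable.
Qed.

Lemma variance_moment : 'V_P[X] = (mu 2 - mu 1 ^+ 2)%:E.
Proof.
have EX : fine 'E_P[X] = mu 1 by rewrite /mu /moment; congr (fine 'E_P[_]).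
have fE x : (x - mu 1) ^+ 2 =
    mu 1 ^+ 2 + (- 2 * mu 1) * x + 1 * x ^+ 2 + 0 * x ^+ 3 + 0 * x ^+ 4 by ring.
have [i2 E2] := poly_moment mu4_fin fE.
transitivity (\int[P]_w ((X w - mu 1) ^+ 2)%:E)%E; last first.
  by rewrite (EFin_Rintegral i2) E2 -!/(mu _); congr EFin; ring.
rewrite /variance unlock -EX unlock; apply: eq_integral => w _ /=.
by rewrite expr2.
Qed.

Lemma variance_gt0 : 0 < fine 'V_P[X].
Proof. by move: X_nondegenerate; rewrite variance_moment/= lte_fin. Qed.

Lemma CoVarE : C = Num.sqrt (fine 'V_P[X]) / mu 1.
Proof. by rewrite /C /CoVar; congr (_ / fine 'E_P[_]). Qed.

Lemma CoVar_gt0 : 0 < C.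
Proof. by rewrite CoVarE divr_gt0 ?moment1_gt0// sqrtr_gt0 variance_gt0. Qed.

Lemma CoVar_sqr : C ^+ 2 = mu 2 / mu 1 ^+ 2 - 1.
Proof.
rewrite CoVarE expr_div_n sqr_sqrtr ?(ltW variance_gt0)// variance_moment/=.
by field; rewrite gt_eqF// moment1_gt0.
Qed.

Let v := sigma_star2 P X * mu 1 ^+ 2 / (4 * fine 'V_P[X]).

(** The influence function of the coefficient of variation: the linear part of
    sqrt (m2 / m1^2 - 1), as a function of the empirical moments m1 and m2, at mu 1 and mu 2. *)
Let infl (x : R) : R := (2 * C * mu 1 ^+ 4)^-1 *
  (mu 1 ^+ 2 * (x ^+ 2 - mu 2) - 2 * mu 1 * mu 2 * (x - mu 1)).

Lemma infl_mean : \int[P]_w infl (X w) = 0 /\ P.-integrable setT (EFin \o (fun w => infl (X w))).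
Proof.
pose k := (2 * C * mu 1 ^+ 4)^-1.
have fE x : infl x = k * (- mu 1 ^+ 2 * mu 2 + 2 * mu 1 ^+ 2 * mu 2) +
  k * (- 2 * mu 1 * mu 2) * x + k * mu 1 ^+ 2 * x ^+ 2 + 0 * x ^+ 3 + 0 * x ^+ 4.
  by rewrite /infl -/k; ring.
have [i ->] := poly_moment mu4_fin fE; split => //.
by rewrite -!/(mu _); ring.
Qed.

(** The identity between the variance of the influence function and the constant of the
    theorem, after expanding both in the moments. *)
Lemma infl_var : \int[P]_w (infl (X w) ^+ 2) = v /\
  P.-integrable setT (EFin \o (fun w => infl (X w) ^+ 2)).
Proof.
pose k := (2 * C * mu 1 ^+ 4)^-1.
pose a := mu 1 ^+ 2; pose b := - 2 * mu 1 * mu 2; pose c := mu 1 ^+ 2 * mu 2.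
have fE x : infl x ^+ 2 = k ^+ 2 * c ^+ 2 + k ^+ 2 * (2 * b * c) * x +
  k ^+ 2 * (b ^+ 2 + 2 * a * c) * x ^+ 2 + k ^+ 2 * (2 * a * b) * x ^+ 3 +
  k ^+ 2 * a ^+ 2 * x ^+ 4.
  by rewrite /infl -/k /a /b /c; ring.
have [i ->] := poly_moment mu4_fin fE; split => //.
have m10 : mu 1 != 0 by rewrite gt_eqF// moment1_gt0.
have s0 : mu 2 - mu 1 ^+ 2 != 0.
  by have := variance_gt0; rewrite variance_moment/= => /gt_eqF ->.
have k2 : k ^+ 2 = (4 * (mu 2 - mu 1 ^+ 2) * mu 1 ^+ 6)^-1.
  have sq (e m : R) : (2 * e * m ^+ 4) ^+ 2 = 4 * e ^+ 2 * m ^+ 8 by ring.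
  by rewrite /k exprVn sq CoVar_sqr; congr (_^-1); field.
rewrite k2 /v /sigma_star2 variance_moment /= -!/(mu _) /a /b /c.
by field; rewrite m10 s0.
Qed.

Lemma measurable_infl : measurable_fun setT infl.
Proof.
apply: measurable_funM => //; apply: measurable_funB.
  by apply: measurable_funM => //; apply: measurable_funB => //; exact: measurable_funX.
by apply: measurable_funM => //; exact: measurable_funB.
Qed.

(** The limit variance is an expected square. *)
Lemma limit_variance_ge0 : 0 <= v.
Proof.
have [<- _] := infl_var.
by apply: Rintegral_ge0 => w _; exact: sqr_ge0.
Qed.

Let mhat n w := sample_mean (fun i => Xs i w) n.
Let Chat n w := sample_CoVar_of (fun i => Xs i w) n.
Let r n : R := (Num.sqrt n%:R)^-1.
Let D n w := r n * partial_sum Xs (fun x => x - mu 1) n w.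
Let W n w := r n * partial_sum Xs infl n w.

Let r_sqr n : (0 < n)%N -> r n ^+ 2 = n%:R^-1.
Proof. by move=> n0; rewrite /r exprVn sqr_sqrtr. Qed.

Let r_gt0 n : (0 < n)%N -> 0 < r n.
Proof. by move=> n0; rewrite invr_gt0 sqrtr_gt0 ltr0n. Qed.

Lemma mu2_ge0 : 0 <= mu 2.
Proof. by rewrite /mu momentE; apply: Rintegral_ge0 => w _; exact: sqr_ge0. Qed.

(** On the event where both normalized sums are bounded by K, the statistic differs from its
    linearization by O(n^(-1/2)), with a constant depending on K only.  The bounds on r n keep the
    empirical mean above half of the mean. *)
Lemma linearization (K : R) : 0 < K -> exists2 B, 0 < B & forall n w,
  (0 < n)%N -> r n <= 1 -> r n * K <= mu 1 / 2 ->
  `|D n w| <= K -> `|W n w| <= K / (2 * C * mu 1 ^+ 4) ->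
  `|W n w - Num.sqrt n%:R * (Chat n w - C)| <= r n * B.
Proof.
move=> K0; have m1 := moment1_gt0; have m2 := mu2_ge0; have c0 := CoVar_gt0.
exists (((K + mu 2 * K ^+ 2) * 4 / mu 1 ^+ 4) ^+ 2 / (2 * C ^+ 3) +
       (3 * K ^+ 2 * mu 1 + mu 2 * K ^+ 2 * mu 1 ^+ 2) * 4 / mu 1 ^+ 6 / (2 * C)).
  have a0 : 0 < K + mu 2 * K ^+ 2 by rewrite ltr_pwDl// mulr_ge0 ?sqr_ge0.
  have b0 : 0 < 3 * K ^+ 2 * mu 1 + mu 2 * K ^+ 2 * mu 1 ^+ 2.
    apply: ltr_pwDl; first by rewrite !mulr_gt0// exprn_gt0.
    by apply: mulr_ge0; rewrite ?sqr_ge0//; apply: mulr_ge0; rewrite ?sqr_ge0.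
  have ? : 0 < 4 :> R by [].
  have ? j : 0 < mu 1 ^+ j by rewrite exprn_gt0.
  apply: addr_gt0; apply: divr_gt0.
  - by apply: exprn_gt0; apply: divr_gt0 => //; exact: mulr_gt0.
  - by apply: mulr_gt0 => //; exact: exprn_gt0.
  - by apply: divr_gt0 => //; exact: mulr_gt0.
  - exact: mulr_gt0.
move=> n w n0 r1 rK DK WK.
have rp := r_gt0 n0; have r2 := r_sqr n0.
have nn0 : n%:R != 0 :> R by rewrite pnatr_eq0 -lt0n.
have k0 : 0 < 2 * C * mu 1 ^+ 4 by apply: mulr_gt0; [exact: mulr_gt0|exact: exprn_gt0].
pose M := 2 * C * mu 1 ^+ 4 * W n w.
have ME : W n w = M / (2 * C * mu 1 ^+ 4) by rewrite /M mulrAC divff ?mul1r// gt_eqF.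
have MK : `|M| <= K.
  by rewrite /M normrM (gtr0_norm k0) mulrC -ler_pdivlMr.
pose q : R := n%:R^-1 * \sum_(i < n) Xs i w ^+ 2.
have mE : mhat n w = mu 1 + r n * D n w.
  rewrite /D mulrA -expr2 r2 /partial_sum sumrB sumr_const card_ord /mhat /sample_mean.
  by rewrite mulrBr -[mu 1 *+ n]mulr_natl mulKf// addrC subrK.
have rM : r n * M = mu 1 ^+ 2 * (q - mu 2) - 2 * mu 1 * mu 2 * (mhat n w - mu 1).
  have -> : r n * M = r n ^+ 2 * (2 * C * mu 1 ^+ 4 * partial_sum Xs infl n w).
    by rewrite /M /W; ring.
  have -> : 2 * C * mu 1 ^+ 4 * partial_sum Xs infl n w =
      mu 1 ^+ 2 * (\sum_(i < n) Xs i w ^+ 2) - n%:R * (mu 1 ^+ 2 * mu 2)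
      - 2 * mu 1 * mu 2 * (\sum_(i < n) Xs i w) + n%:R * (2 * mu 1 ^+ 2 * mu 2).
    rewrite /partial_sum mulr_sumr.
    have cst (c : R) : n%:R * c = \sum_(i < n) c by rewrite sumr_const card_ord mulr_natl.
    rewrite !cst !mulr_sumr -sumrB -sumrB -big_split/=; apply: eq_bigr => i _.
    rewrite /infl mulrA divff ?gt_eqF// mul1r; ring.
  by rewrite r2 /q /mhat /sample_mean; field.
have mh0 : 0 < mhat n w.
  rewrite mE; have /ler_normlP[D1 D2] := DK.
  have : - (r n * D n w) <= r n * K by rewrite -mulrN ler_wpM2l// ltW.
  lra.
have [Cn0 CnE] := sample_CoVar_sqr n0 mh0.
have key := @delta_bound R (mu 1) (mu 2) C K (r n) (D n w) M (mhat n w) (Chat n w)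
  m1 m2 c0 K0 rp r1 DK MK rK mE Cn0.
rewrite ME distrC; have -> : Num.sqrt n%:R = (r n)^-1 by rewrite /r invrK.
apply: key.
rewrite /Chat CnE -/q CoVar_sqr.
have -> : r n * (M - mu 2 * r n * D n w ^+ 2) =
   r n * M - mu 2 * (r n * D n w) ^+ 2 by ring.
have -> : r n * D n w = mhat n w - mu 1 by rewrite mE addrC addKr.
rewrite rM -/(mhat n w); field.
by rewrite !gt_eqF.
Qed.

Lemma measurable_Chat n : measurable_fun setT (Chat n).
Proof. exact: measurable_sample_CoVar_of. Qed.

(** Asymptotic normality at deterministic sample sizes: the central limit theorem for the
    influence function, and for the deviations of the empirical mean to make both sums tight, so
    that the linearization error is small with high probability. *)
Theorem sample_CoVar_levy (eta eps : R) : 0 < eta -> 0 < eps ->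
  \forall n \near \oo, levy_close P (fun w => Num.sqrt n%:R * (Chat n w - C))
    (normal_prob 0 1) (fun g : R => Num.sqrt v * g) eta eps.
Proof.
move=> eta0 eps0.
have m10 := moment1_gt0; have c0 := CoVar_gt0.
have vE : Num.sqrt v ^+ 2 = v by rewrite sqr_sqrtr// limit_variance_ge0.
have [E0 iE0] := infl_mean; have [Ev iEv] := infl_var.
have mh1 : measurable_fun setT (fun x : R => x - mu 1) by exact: measurable_funB.
have fE (x : R) : x - mu 1 = - mu 1 + 1 * x + 0 * x ^+ 2 + 0 * x ^+ 3 + 0 * x ^+ 4 by ring.
have [i1 E1] := poly_moment mu4_fin fE.
have gE (x : R) : (x - mu 1) ^+ 2 =
    mu 1 ^+ 2 + (- 2 * mu 1) * x + 1 * x ^+ 2 + 0 * x ^+ 3 + 0 * x ^+ 4 by ring.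
have [i2 E2] := poly_moment mu4_fin gE.
pose s1 := Num.sqrt (fine 'V_P[X]).
have s1E : s1 ^+ 2 = fine 'V_P[X] by rewrite sqr_sqrtr// ltW// variance_gt0.
have E1' : \int[P]_w (X w - mu 1) = 0 by rewrite E1 -!/(mu _); ring.
have E2' : \int[P]_w ((X w - mu 1) ^+ 2) = s1 ^+ 2.
  by rewrite s1E variance_moment/= E2 -!/(mu _); ring.
(* Each of the two tail events has probability at most 2 (e0 + e0), which makes eps / 2. *)
pose e0 := eps / 16; have e00 : 0 < e0 by rewrite divr_gt0.
pose k := 2 * C * mu 1 ^+ 4; have k0 : 0 < k by apply: mulr_gt0; [exact: mulr_gt0|exact: exprn_gt0].
(* Chosen such that both s1^2 and v are at most e0 (K1 - 1)^2. *)
pose K1 := 2 + (s1 ^+ 2 + v) / e0.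
have v0 := limit_variance_ge0.
have K1p : 0 <= (s1 ^+ 2 + v) / e0 by rewrite divr_ge0 ?(ltW e00)// addr_ge0// sqr_ge0.
have tail (x : R) : 0 <= x -> x <= s1 ^+ 2 + v -> x / (K1 - 1) ^+ 2 <= e0.
  move=> x0 xs; have K11 : 1 <= K1 - 1 by rewrite /K1; lra.
  have K12 : K1 - 1 <= (K1 - 1) ^+ 2 by rewrite expr2 ler_peMl//; lra.
  rewrite ler_pdivrMr; last by rewrite exprn_gt0//; lra.
  apply: (@le_trans _ _ (e0 * (K1 - 1))); last by rewrite ler_wpM2l// ltW.
  rewrite mulrC -ler_pdivrMr//; apply: (@le_trans _ _ ((s1 ^+ 2 + v) / e0)).
    by rewrite ler_wpM2r// invr_ge0 ltW.
  by rewrite /K1; lra.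
have K1gt : 1 < K1 by rewrite /K1; lra.
(* Large enough to bound D by K and W by K / k at the same time. *)
pose K := K1 * (1 + k).
have K1K : K1 <= K by rewrite /K ler_peMr; lra.
have KK : K1 <= K / k.
  by rewrite ler_pdivlMr// /K ler_wpM2l; lra.
have K0 : 0 < K by lra.
have [B B0 lin] := linearization K0.
have clt1 : \forall n \near \oo, levy_close P (D n) (normal_prob 0 1)
    (fun g : R => s1 * g) 1 e0.
  by apply: (clt_levy Xs_iid) => //; exact: sqrtr_ge0.
have E2v : \int[P]_w (infl (X w) ^+ 2) = Num.sqrt v ^+ 2 by rewrite vE Ev.
have clt2 (e e' : R) : 0 < e -> 0 < e' -> \forall n \near \oo,
    levy_close P (W n) (normal_prob 0 1) (fun g : R => Num.sqrt v * g) e e'.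
  by move=> ep ep'; apply: (clt_levy Xs_iid) => //; exact: measurable_infl.
have eta2 : 0 < eta / 2 by rewrite divr_gt0.
have eps2 : 0 < eps / 2 by rewrite divr_gt0.
have rK0 : 0 < mu 1 / 2 / K by rewrite !divr_gt0.
have rB0 : 0 < eta / 2 / B by rewrite !divr_gt0.
near=> n.
have n0 : (0 < n)%N by near: n; exact: nbhs_infty_gt.
have r1 : r n <= 1 by near: n; exact: inv_sqrt_small.
have rK : r n * K <= mu 1 / 2.
  by rewrite -ler_pdivlMr//; near: n; exact: inv_sqrt_small.
have rB : r n * B <= eta / 2.
  by rewrite -ler_pdivlMr//; near: n; exact: inv_sqrt_small.
have L1 : levy_close P (D n) (normal_prob 0 1) (fun g : R => s1 * g) 1 e0.
  by near: n.
have L2 : levy_close P (W n) (normal_prob 0 1) (fun g : R => Num.sqrt v * g) 1 e0.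
  by near: n; apply: clt2.
have L3 : levy_close P (W n) (normal_prob 0 1) (fun g : R => Num.sqrt v * g) (eta / 2) (eps / 2).
  by near: n; apply: clt2.
have mD : measurable_fun setT (D n).
  by apply: measurable_funM => //; exact: measurable_partial_sum.
have mW : measurable_fun setT (W n).
  by apply: measurable_funM => //; apply: measurable_partial_sum; exact: measurable_infl.
have mU : measurable_fun setT (fun w => Num.sqrt n%:R * (Chat n w - C)).
  by apply: measurable_funM => //; apply: measurable_funB => //; exact: measurable_Chat.
have T1 := levy_close_tight mD K1gt L1; have T2 := levy_close_tight mW K1gt L2.
have t1 : s1 ^+ 2 / (K1 - 1) ^+ 2 <= e0 by apply: tail; rewrite ?sqr_ge0// lerDl.
have t2 : Num.sqrt v ^+ 2 / (K1 - 1) ^+ 2 <= e0.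
  by rewrite vE; apply: tail => //; rewrite lerDr sqr_ge0.
rewrite [eta]splitr [eps]splitr.
apply: (levy_slutsky mW mU _ (ltW eta2) L3); first exact: measurable_scale.
have mA1 : measurable [set w | K1 < `|D n w|].
  have := @measurable_dist_gt _ _ T (D n) (fun=> 0) K1 mD (measurable_cst _).
  by under eq_set do rewrite subr0.
have mA2 : measurable [set w | K1 < `|W n w|].
  have := @measurable_dist_gt _ _ T (W n) (fun=> 0) K1 mW (measurable_cst _).
  by under eq_set do rewrite subr0.
apply: (@le_trans _ _ (fine (P [set w | K1 < `|D n w|]) + fine (P [set w | K1 < `|W n w|]))); last first.
  have : 16 * e0 = eps by rewrite /e0; field.
  lra.
have mdist := measurable_dist_gt (eta / 2) mW mU.
rewrite -lee_fin EFinD !fineK ?fin_num_measure//.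
apply: le_trans (measureU2 P mA1 mA2).
apply: le_measure; rewrite ?inE//; first exact: measurableU.
move=> w /= dist; apply: contrapT => /not_orP[/negP + /negP]; rewrite -!leNgt => DK WK.
have := lin n w n0 r1 rK (le_trans DK K1K) (le_trans WK KK).
by lra.
Unshelve. all: by end_near. Qed.

End sample_coefficient.

Section sample_coefficient_limit.
Context d (T : measurableType d) (R : realType) (P : probability T R).
Context (X : {RV P >-> R}) (Xs : nat -> {RV P >-> R}) (N : R -> {RV P >-> nat}).
Context d' (T' : measurableType d') (Q : probability T' R) (L : {RV Q >-> R}).
Hypotheses (X_gt0 : P [set w | 0 < X w] = 1%E) (X_nondegenerate : (0 < 'V_P[X])%E).
Hypothesis Xs_iid : iid_copies X Xs.
Hypothesis mu4_fin : ('E_P[fun w => (X w ^+ 4)%R] < +oo)%E.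
Hypotheses (N_indep : process_indep N Xs) (N_average : D_averages N L).

Let hatC := sample_CoVar (fun i => Xs i : T -> R) (fun t => N t : T -> nat).
Let v := sigma_star2 P X * moment P X 1 ^+ 2 / (4 * fine 'V_P[X]).

(** The sigma-algebra generated by the sample is the smallest one for which the sample is
    measurable, so that the measurability of the statistic can be read in it. *)
Lemma sigma_of_sample_CoVar n (B : set R) : measurable B ->
  sigma_of [set: nat] (fun i => Xs i : T -> R)
    ((fun w => sample_CoVar_of (fun i => Xs i w) n - CoVar P X) @^-1` B).
Proof.
move=> mB.
pose G := \bigcup_(i in [set: nat]) preimage_set_system [set: T] (Xs i : T -> R) measurable.
have mXs i : measurable_fun [set: g_sigma_algebraType G] (Xs i : g_sigma_algebraType G -> R).
  move=> _ A mA; rewrite setTI; apply: sub_sigma_algebra.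
  by exists i => //; exists A => //; rewrite setTI.
have mC : measurable_fun [set: g_sigma_algebraType G]
    (fun w : g_sigma_algebraType G => sample_CoVar_of (fun i => Xs i w) n - CoVar P X).
  by apply: measurable_funB => //; exact: measurable_sample_CoVar_of.
by have := mC measurableT _ mB; rewrite setTI.
Qed.

Theorem sample_CoVar_wcvg d2 (T2 : measurableType d2) (P2 : probability T2 R)
    (Z L2 : {RV P2 >-> R}) :
  same_law L2 L ->
  (forall A : set R, measurable A -> distribution P2 Z A = normal_law 0 v A) ->
  indep_RV P2 Z L2 ->
  wcvg (@pinfty_nbhs R) P P2
    (fun t w => Num.sqrt t * (hatC t w - CoVar P X))
    (fun w => Z w / Num.sqrt (L2 w)).
Proof.
move=> LL ZN ind.
have v0 : 0 <= v by exact: limit_variance_ge0.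
pose A n w := sample_CoVar_of (fun i => Xs i w) n - CoVar P X.
have mA n : measurable_fun setT (A n).
  by apply: measurable_funB => //; exact: measurable_sample_CoVar_of.
have sA n (B : set R) : measurable B ->
    sigma_of [set: nat] (fun i => Xs i : T -> R) (A n @^-1` B).
  by move=> mB; exact: sigma_of_sample_CoVar.
have limA (eta eps : R) : 0 < eta -> 0 < eps -> \forall n \near \oo,
    levy_close P (fun w => Num.sqrt n%:R * A n w) (normal_prob 0 1)
      (fun g : R => Num.sqrt v * g) eta eps.
  by move=> eta0 eps0; exact: (sample_CoVar_levy X_gt0).
have lim := random_index_limit N_indep N_average mA sA (sqrtr_ge0 v) limA LL.
have ZN' (B : set R) : measurable B -> distribution P2 Z B = normal_law 0 (Num.sqrt v ^+ 2) B.
  by move=> mB; rewrite sqr_sqrtr//; exact: ZN.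
exact: (lim Z ZN' ind).
Qed.

Lemma measurable_sample_CoVar t : measurable_fun setT (hatC t).
Proof.
by apply: (@measurable_index _ _ _ (fun n w => sample_CoVar_of (fun i => Xs i w) n)) => // n;
   exact: measurable_sample_CoVar_of.
Qed.

Lemma measurable_sample_CoVar_scaled t :
  measurable_fun setT (fun w => Num.sqrt t * (hatC t w - CoVar P X)).
Proof.
by apply: measurable_funM => //; apply: measurable_funB => //; exact: measurable_sample_CoVar.
Qed.

End sample_coefficient_limit.

(** * Convergence of moments under uniform integrability *)

Section tails.
Context d (T : measurableType d) (R : realType) (P : probability T R).
Implicit Types (Y : T -> R) (h : R -> R).

(** The squares of a family of variables are uniformly integrable when this tends to 0 as c grows,
    uniformly over the family. *)
Definition tail2 Y (c : R) : R := \int[P]_w (Y w ^+ 2 * \1_[set w | c < Y w ^+ 2] w).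

Lemma measurable_tail_set Y c : measurable_fun setT Y ->
  measurable [set w | c < Y w ^+ 2].
Proof.
by move=> mY; apply: measurable_gt_preim; exact: measurable_funX.
Qed.

Lemma measurable_tail Y c : measurable_fun setT Y ->
  measurable_fun setT (fun w => Y w ^+ 2 * \1_[set w | c < Y w ^+ 2] w).
Proof.
move=> mY; apply: measurable_funM; first exact: measurable_funX.
by apply: measurable_indic; exact: measurable_tail_set.
Qed.

Lemma tail_integrand_le Y c w : Y w ^+ 2 * \1_[set w | c < Y w ^+ 2] w <= Y w ^+ 2.
Proof.
by rewrite indicE; case: (_ \in _); rewrite ?mulr1// mulr0 sqr_ge0.
Qed.

Lemma tail_integrand_ge0 Y c w : 0 <= Y w ^+ 2 * \1_[set w | c < Y w ^+ 2] w.
Proof. by rewrite mulr_ge0 ?sqr_ge0//; exact: indic_ge0. Qed.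

Lemma integrable_tail Y c : measurable_fun setT Y ->
  P.-integrable setT (EFin \o (fun w => Y w ^+ 2)) ->
  P.-integrable setT (EFin \o (fun w => Y w ^+ 2 * \1_[set w | c < Y w ^+ 2] w)).
Proof.
move=> mY; apply: le_integrable => //; first by apply/measurable_EFinP; exact: measurable_tail.
move=> w _ /=; rewrite lee_fin (ger0_norm (tail_integrand_ge0 _ _ _)).
by rewrite ger0_norm ?sqr_ge0//; exact: tail_integrand_le.
Qed.

Lemma tail2_le Y (c c' : R) : measurable_fun setT Y ->
  P.-integrable setT (EFin \o (fun w => Y w ^+ 2)) -> c <= c' -> tail2 Y c' <= tail2 Y c.
Proof.
move=> mY iY cc; apply: le_Rintegral => //; [exact: integrable_tail..|].
move=> w _; rewrite ler_wpM2l ?sqr_ge0// !indicE ler_nat.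
case: (boolP (w \in [set w | c' < Y w ^+ 2])) => //; rewrite inE/= => cY.
by rewrite mem_set//=; exact: le_lt_trans cY.
Qed.

Lemma tail2_cvg0 Y : measurable_fun setT Y ->
  P.-integrable setT (EFin \o (fun w => Y w ^+ 2)) ->
  forall e : R, 0 < e -> exists n : nat, tail2 Y n%:R <= e.
Proof.
move=> mY iY e e0.
have cv : tail2 Y n%:R @[n --> \oo] --> \int[P]_w (0 : R).
  apply: (Rintegral_dominated_cvg _ _ _ iY) => //.
  - by move=> n; exact: measurable_tail.
  - move=> w; apply: cvg_near_cst; near=> n.
    have Yn : Y w ^+ 2 <= n%:R by near: n; exact: nbhs_infty_ger.
    by rewrite indicE memNset ?mulr0//= => /lt_geF; rewrite Yn.
  - move=> n w; rewrite (ger0_norm (tail_integrand_ge0 _ _ _)).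
    exact: tail_integrand_le.
rewrite Rintegral_cst_prob in cv.
have /cvgrPdist_le/(_ e e0) [n _ Hn] := cv.
exists n; have := Hn n (leqnn n); rewrite /= sub0r normrN.
exact: (le_trans (ler_norm _)).
Unshelve. all: by end_near. Qed.

Lemma norm_le_quadratic (y : R) : `|y| <= 1 + y ^+ 2.
Proof.
rewrite ler_norml; have := sqr_ge0 (y - 1); have := sqr_ge0 (y + 1).
by rewrite !expr2 => *; apply/andP; split; nra.
Qed.

Lemma integrable_of_quadratic h Y : measurable_fun setT h -> measurable_fun setT Y ->
  (forall y, `|h y| <= 1 + y ^+ 2) ->
  P.-integrable setT (EFin \o (fun w => Y w ^+ 2)) ->
  P.-integrable setT (EFin \o (fun w => h (Y w))).
Proof.
move=> mh mY hq iY.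
have i1 : P.-integrable setT (EFin \o (fun _ : T => 1 : R)).
  exact: finite_measure_integrable_cst.
have := integrableD measurableT i1 iY; apply: le_integrable => //.
  by apply/measurable_EFinP; exact: measurableT_comp.
move=> w _ /=; rewrite lee_fin (ger0_norm (addr_ge0 ler01 (sqr_ge0 _))).
exact: hq.
Qed.

(** A function of at most quadratic growth differs from its truncation at 1 + c only where
    Y^2 > c, and there by at most 1 + Y^2 <= 2 Y^2. *)
Lemma truncation_error h Y (c : R) : measurable_fun setT h -> measurable_fun setT Y ->
  (forall y, `|h y| <= 1 + y ^+ 2) ->
  P.-integrable setT (EFin \o (fun w => Y w ^+ 2)) -> 1 <= c ->
  `| \int[P]_w h (Y w) - \int[P]_w Num.max (- (1 + c)) (Num.min (h (Y w)) (1 + c)) |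
  <= 2 * tail2 Y c.
Proof.
move=> mh mY hq iY c1.
have ih := integrable_of_quadratic mh mY hq iY.
have mhY : measurable_fun setT (fun w => h (Y w)) by exact: measurableT_comp.
have it : P.-integrable setT (EFin \o (fun w => Num.max (- (1 + c)) (Num.min (h (Y w)) (1 + c)))).
  apply: (@bounded_integrable _ _ _ _ _ (1 + c)).
    by apply: measurable_maxr => //; exact: measurable_minr.
  move=> w; rewrite ler_norml le_max lexx/= ge_max ge_min lexx orbT andbT.
  lra.
have iB := integrableB measurableT ih it.
rewrite -RintegralB//; apply: (le_trans (le_normr_Rintegral measurableT iB)).
have itl := integrable_tail c mY iY.
rewrite /tail2 -RintegralZl//; apply: le_Rintegral => //.
- exact: integrable_norm iB.
- exact: (integrableZl measurableT 2 itl).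
move=> w _; set y := Y w; rewrite indicE; have /ler_normlP[h1 h2] := hq y.
case: (boolP (w \in _)) => [|]; last first.
  rewrite notin_setE/= => /negP; rewrite -leNgt -/y => yc.
  by rewrite mulr0n !mulr0 min_l ?max_r ?subrr ?normr0//; lra.
rewrite inE/= -/y => cy; rewrite mulr1n mulr1.
rewrite maxEle minEle; case: ifP; case: ifP; rewrite ler_norml => *; lra.
Qed.

End tails.

Section uniform_integrability.
Context d (T : measurableType d) (R : realType) (P : probability T R).
Context d' (T' : measurableType d') (P' : probability T' R).
Context (I : Type) (F : set_system I) {FF : Filter F}.
Context (V : I -> T -> R) (W : T' -> R).
Hypotheses (mV : forall t, measurable_fun setT (V t)) (mW : measurable_fun setT W).
Hypothesis VW : wcvg F P P' V W.
Hypothesis iV : \forall t \near F, P.-integrable setT (EFin \o (fun w => V t w ^+ 2)).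
Hypothesis iW : P'.-integrable setT (EFin \o (fun w => W w ^+ 2)).
Hypothesis uiV : forall e : R, 0 < e -> \forall c \near +oo%R, \forall t \near F, tail2 P (V t) c <= e.

(** Truncate h at a level where the tails of the second moments of all variables are small; the
    truncated function is bounded, monotone and continuous. *)
Lemma wcvg_expectation_ui_nd (h : R -> R) : continuous h -> {homo h : x y / x <= y} ->
  (forall y, `|h y| <= 1 + y ^+ 2) ->
  \int[P]_w h (V t w) @[t --> F] --> \int[P']_w h (W w).
Proof.
move=> ch ndh hq; have mh : measurable_fun setT h by exact: continuous_measurable_fun.
apply/cvgrPdist_le => e e0.
have e8 : 0 < e / 8 by rewrite divr_gt0.
have [n Hn] := tail2_cvg0 mW iW e8.
have [c [c1 nc Hc]] : exists c : R, [/\ 1 <= c, n%:R <= c & \forall t \near F, tail2 P (V t) c <= e / 8].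
  suff : \forall c \near +oo%R, [/\ 1 <= c, n%:R <= c & \forall t \near F, tail2 P (V t) c <= e / 8].
    by move=> /filter_ex.
  near=> c; split.
  - by near: c; apply: nbhs_pinfty_ge; exact: num_real.
  - by near: c; apply: nbhs_pinfty_ge; exact: num_real.
  - by near: c; exact: uiV.
have tW : tail2 P' W c <= e / 8 by apply: le_trans Hn; exact: tail2_le.
pose hc y := Num.max (- (1 + c)) (Num.min (h y) (1 + c)).
have chc : continuous hc.
  move=> y; apply: (@continuous_max R R (fun=> - (1 + c)) (fun y => Num.min (h y) (1 + c))).
    exact: cst_continuous.
  by apply: (@continuous_min R R h (fun=> 1 + c)); [exact: ch|exact: cst_continuous].
have ndhc : {homo hc : x y / x <= y}.
  move=> x y xy; rewrite /hc ge_max le_max lexx/= le_max; apply/orP; right.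
  by rewrite le_min !ge_min lexx orbT andbT ndh.
have hcb y : `|hc y| <= 1 + c.
  rewrite /hc ler_norml le_max lexx/= ge_max ge_min lexx orbT andbT; lra.
have c0 : 0 < 1 + c by lra.
have /cvgrPdist_le/(_ (e / 2)) : \int[P]_w hc (V t w) @[t --> F] --> \int[P']_w hc (W w).
  exact: (wcvg_expectation_nd mV mW chc ndhc c0 hcb VW).
rewrite divr_gt0// => /(_ isT) cv.
have eW := truncation_error mh mW hq iW c1.
near=> t.
have iVt : P.-integrable setT (EFin \o (fun w => V t w ^+ 2)) by near: t.
have eV := truncation_error mh (mV t) hq iVt c1.
have tV : tail2 P (V t) c <= e / 8 by near: t.
have : `|\int[P']_w hc (W w) - \int[P]_w hc (V t w)| <= e / 2 by near: t.
move: eV eW; rewrite /hc => /ler_normlP[? ?] /ler_normlP[? ?] /ler_normlP[? ?].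
by rewrite ler_norml; apply/andP; split; lra.
Unshelve. all: by end_near. Qed.

Lemma wcvg_expectation_ui : \int[P]_w V t w @[t --> F] --> \int[P']_w W w.
Proof.
apply: (wcvg_expectation_ui_nd (h := id)) => // y.
  exact: cvg_id.
exact: norm_le_quadratic.
Qed.

(** The square is the difference of two nondecreasing functions of quadratic growth. *)
Lemma wcvg_expectation_sqr_ui :
  \int[P]_w (V t w ^+ 2) @[t --> F] --> \int[P']_w (W w ^+ 2).
Proof.
pose f (y : R) := Num.max y 0 ^+ 2; pose g (y : R) := - (Num.min y 0 ^+ 2).
have fgE (y : R) : y ^+ 2 = f y - g y.
  by rewrite /f /g; case: (leP y 0) => y0; rewrite expr0n/= opprK ?add0r ?addr0.
have cf : continuous f.
  move=> y; have cm : {for y, continuous (fun y : R => Num.max y 0)}.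
    by apply: (@continuous_max R R id (fun=> 0)); [exact: cvg_id|exact: cst_continuous].
  exact: (cvgM cm cm).
have cg : continuous g.
  move=> y; have cm : {for y, continuous (fun y : R => Num.min y 0)}.
    by apply: (@continuous_min R R id (fun=> 0)); [exact: cvg_id|exact: cst_continuous].
  exact: (cvgN (cvgM cm cm)).
have max0 (y : R) : 0 <= Num.max y 0 by rewrite le_max lexx orbT.
have min0 (y : R) : 0 <= - Num.min y 0 by rewrite oppr_ge0 ge_min lexx orbT.
have ndf : {homo f : x y / x <= y}.
  by move=> x y xy; apply: lerXn2r; rewrite ?nnegrE//; exact: le_max2.
have ndg : {homo g : x y / x <= y}.
  move=> x y xy; rewrite /g lerN2 -[leLHS]sqrrN -[leRHS]sqrrN.
  by apply: lerXn2r; rewrite ?nnegrE// lerN2; exact: le_min2.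
have f0 y : 0 <= f y by exact: sqr_ge0.
have g0 y : g y <= 0 by rewrite oppr_le0 sqr_ge0.
have fq y : `|f y| <= 1 + y ^+ 2.
  by rewrite ger0_norm// fgE; have := g0 y; have := f0 y; lra.
have gq y : `|g y| <= 1 + y ^+ 2.
  by rewrite ler0_norm// fgE; have := g0 y; have := f0 y; lra.
have cvf := wcvg_expectation_ui_nd cf ndf fq.
have cvg := wcvg_expectation_ui_nd cg ndg gq.
have mf : measurable_fun setT f by exact: continuous_measurable_fun.
have mg : measurable_fun setT g by exact: continuous_measurable_fun.
have sE d0 (T0 : measurableType d0) (P0 : probability T0 R) (U : T0 -> R) :
    measurable_fun setT U -> P0.-integrable setT (EFin \o (fun w => U w ^+ 2)) ->
    \int[P0]_w (U w ^+ 2) = \int[P0]_w f (U w) - \int[P0]_w g (U w).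
  move=> mU iU; rewrite -RintegralB//; last 2 first.
  - exact: integrable_of_quadratic.
  - exact: integrable_of_quadratic.
  by apply: eq_Rintegral => w _; exact: fgE.
rewrite (sE _ _ _ _ mW iW).
apply: cvg_trans (cvgB cvf cvg); apply: near_eq_cvg.
by near=> t; rewrite /= [RHS]sE//; near: t.
Unshelve. all: by end_near. Qed.

End uniform_integrability.

(** * A realization of the limit variable *)

Lemma exists_RV d (T : measurableType d) (R : realType) (P : probability T R) (f : T -> R) :
  measurable_fun setT f -> exists X : {RV P >-> R}, (X : T -> R) = f.
Proof.
move=> mf; pose X : {mfun T >-> R} := HB.pack f (isMeasurableFun.Build _ _ _ _ f mf).
by exists X.
Qed.

Section inverse_moment.
Context d (T : measurableType d) (R : realType) (Q : probability T R) (L : {RV Q >-> R}).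
Hypothesis L_gt0 : Q [set w | 0 < L w] = 1%E.
Hypothesis invL_fin : ('E_Q[fun w => ((L w)^-1)%R] < +oo)%E.

(** The square of the inverse square root is 1 / L on the almost sure event L > 0; unlike 1 / L it
    is nonnegative everywhere. *)
Lemma inverse_sqrt_sqr : Q.-integrable setT (EFin \o (fun w => (Num.sqrt (L w))^-1 ^+ 2)) /\
  \int[Q]_w ((Num.sqrt (L w))^-1 ^+ 2) = fine 'E_Q[fun w => ((L w)^-1)%R].
Proof.
have mL : measurable_fun setT L by [].
have mi : measurable_fun setT (fun w => (L w)^-1).
  exact: (measurableT_comp (@measurable_inv R)).
have mf : measurable_fun setT (fun w => (Num.sqrt (L w))^-1 ^+ 2).
  apply: measurable_funX; apply: (measurableT_comp (@measurable_inv R)).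
  exact: (measurableT_comp (@measurable_sqrt R)).
have mG : measurable [set w | 0 < L w] by exact: measurable_gt_preim.
have QG : Q (~` [set w | 0 < L w]) = 0%E by rewrite probability_setC// L_gt0 subee.
have E : (\int[Q]_w ((Num.sqrt (L w))^-1 ^+ 2)%:E = 'E_Q[fun w => ((L w)^-1)%R])%E.
  rewrite unlock; apply: ae_eq_integral => //; [exact/measurable_EFinP..|].
  exists (~` [set w | 0 < L w]); split; first exact: measurableC.
    exact: QG.
  move=> w /= H Lw; apply: H => _.
  by rewrite exprVn sqr_sqrtr// ltW.
split; last by rewrite /Rintegral E.
apply/integrableP; split; first exact/measurable_EFinP.
rewrite (_ : (\int[Q]_w _ = 'E_Q[fun w => ((L w)^-1)%R])%E)// -E.
by apply: eq_integral => w _ /=; rewrite ger0_norm// sqr_ge0.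
Qed.

End inverse_moment.

(** A pair of independent variables with prescribed laws lives on the product of the two spaces;
    the moments of its quotient follow from Tonelli's and Fubini's theorems. *)
Section product_pair.
Context d (T : measurableType d) (R : realType) (Q : probability T R) (L : {RV Q >-> R}).
Context d' (Y : measurableType d') (G : probability Y R) (g : Y -> R) (s : R).
Hypothesis mg : measurable_fun setT g.
Hypotheses (ig : G.-integrable setT (EFin \o g))
  (ig2 : G.-integrable setT (EFin \o (fun y => g y ^+ 2))).
Hypotheses (Eg : \int[G]_y g y = 0) (Eg2 : \int[G]_y (g y ^+ 2) = 1).
Hypothesis L_gt0 : Q [set w | 0 < L w] = 1%E.
Hypothesis invL_fin : ('E_Q[fun w => ((L w)^-1)%R] < +oo)%E.

Let Z (z : T * Y) : R := s * g z.2.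
Let L2 (z : T * Y) : R := L z.1.
Let W z := Z z / Num.sqrt (L2 z).

Lemma measurable_pairZ : measurable_fun setT Z.
Proof. by apply: measurable_funM => //; exact: (measurableT_comp mg measurable_snd). Qed.

Lemma measurable_pairL : measurable_fun setT L2.
Proof.
have mL : measurable_fun setT L by [].
exact: (measurableT_comp mL measurable_fst).
Qed.

Lemma pair_preimZ (A : set R) : Z @^-1` A = setT `*` [set y | A (s * g y)].
Proof. by apply/seteqP; split=> z /=; [split|case]. Qed.

Lemma pair_preimL (A : set R) : L2 @^-1` A = (L @^-1` A) `*` setT.
Proof. by apply/seteqP; split=> z /=; [split|case]. Qed.

Let mgA (A : set R) : measurable A -> measurable [set y | A (s * g y)].
Proof.
move=> mA; rewrite -[X in measurable X]setTI.
by apply: (_ : measurable_fun setT (fun y => s * g y)) => //; apply: measurable_funM.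
Qed.

Let mLA (A : set R) : measurable A -> measurable (L @^-1` A).
Proof.
by move=> mA; rewrite -[X in measurable X]setTI; apply: (_ : measurable_fun setT L).
Qed.

Let P2 : probability (T * Y)%type R := (Q \x G)%E.

Let P2X (A : set T) (B : set Y) : measurable A -> measurable B ->
  P2 (A `*` B) = (Q A * G B)%E.
Proof. by move=> mA mB; exact: product_measure1E. Qed.

Lemma pair_lawZ (A : set R) : measurable A ->
  P2 (Z @^-1` A) = G [set y | A (s * g y)].
Proof.
move=> mA; rewrite pair_preimZ P2X//; last exact: mgA.
by rewrite [X in (X * _)%E](_ : _ = 1%E) ?mul1e//; exact: probability_setT.
Qed.

Lemma pair_lawL (A : set R) : measurable A -> P2 (L2 @^-1` A) = Q (L @^-1` A).
Proof.
move=> mA; rewrite pair_preimL P2X//; last exact: mLA.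
by rewrite [X in (_ * X)%E](_ : _ = 1%E) ?mule1//; exact: probability_setT.
Qed.

Lemma pair_indep : indep_RV P2 Z L2.
Proof.
move=> _ _ [A mA <-] [B mB <-]; rewrite !setTI pair_lawZ// pair_lawL//.
rewrite pair_preimZ pair_preimL -setXI setTI setIT P2X//; [|exact: mLA|exact: mgA].
by rewrite muleC.
Qed.

Let ell w := (Num.sqrt (L w))^-1 ^+ 2.

Let mW : measurable_fun setT W.
Proof.
apply: measurable_funM; first exact: measurable_pairZ.
apply: (measurableT_comp (@measurable_inv R)).
by apply: (measurableT_comp (@measurable_sqrt R)); exact: measurable_pairL.
Qed.

Lemma pair_second_moment : (\int[P2]_z (W z ^+ 2)%:E =
  (s ^+ 2 * fine 'E_Q[fun w => ((L w)^-1)%R])%:E)%E.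
Proof.
have [il El] := inverse_sqrt_sqr L_gt0 invL_fin.
rewrite (fubini_tonelli1 (fun z => (W z ^+ 2)%:E)); last 2 first.
- by apply/measurable_EFinP; exact: measurable_funX.
- by move=> z /=; rewrite lee_fin sqr_ge0.
rewrite -El -RintegralZl// -EFin_Rintegral; last exact: (integrableZl measurableT (s ^+ 2) il).
apply: eq_integral => w _; rewrite /fubini_F /=.
have c2 := integrableZl measurableT (s ^+ 2 * ell w) ig2.
transitivity (\int[G]_y (s ^+ 2 * ell w * g y ^+ 2)%:E)%E.
  by apply: eq_integral => y _; rewrite /W /Z /L2 /= /ell; congr EFin; ring.
by rewrite EFin_Rintegral// RintegralZl// Eg2 mulr1.
Qed.

Lemma integrable_pair_sqr : P2.-integrable setT (EFin \o (fun z => W z ^+ 2)).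
Proof.
apply/integrableP; split; first by apply/measurable_EFinP; exact: measurable_funX.
rewrite (_ : (\int[_]_z _)%E = (\int[P2]_z (W z ^+ 2)%:E)%E).
  by rewrite pair_second_moment ltry.
by apply: eq_integral => z _ /=; rewrite ger0_norm// sqr_ge0.
Qed.

Lemma pair_mean : \int[P2]_z W z = 0.
Proof.
have iW : P2.-integrable setT (EFin \o W).
  apply: (@integrable_of_quadratic _ _ _ _ id) => // [y|]; last exact: integrable_pair_sqr.
  exact: norm_le_quadratic.
rewrite /Rintegral -(@integral12_prod_meas1 _ _ _ _ _ Q G (EFin \o W))//.
rewrite integral0_eq// => w _.
have c2 := integrableZl measurableT (s / Num.sqrt (L w)) ig.
transitivity (\int[G]_y (s / Num.sqrt (L w) * g y)%:E)%E.
  by apply: eq_integral => y _ /=; rewrite /W /Z /L2 /=; congr EFin; ring.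
by rewrite EFin_Rintegral// RintegralZl// Eg mulr0.
Qed.

End product_pair.

(** * Moments of an estimator with uniformly integrable squared error *)

(** For c = 0 the quotient tends to 0, which is the definition of o(g). *)
Lemma sim_const_of_cvg (R : realType) (f g : R -> R) (c : R) :
  (\forall t \near +oo%R, 0 < g t) -> f t / g t @[t --> +oo%R] --> c -> sim_const f c g.
Proof.
move=> g0 cv; split=> [cn0|c0].
- apply/eqaddoP => e e0; have ec0 : 0 < e * `|c| by rewrite mulr_gt0// normr_gt0.
  have /cvgrPdist_le/(_ _ ec0) cvc := cv.
  near=> t; have gt : 0 < g t by near: t.
  have : `|c - f t / g t| <= e * `|c| by near: t.
  rewrite -(ler_pM2r gt) => H.
  have -> : (f - (fun t => c * g t)) t = - ((c - f t / g t) * g t).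
    by rewrite mulrBl mulrVK ?unitfE ?gt_eqF// opprB.
  by rewrite normrN !normrM (gtr0_norm gt) mulrA.
- apply/eqoP => e e0.
  have /cvgrPdist_le/(_ _ e0) cvc := cv.
  near=> t; have gt : 0 < g t by near: t.
  have : `|c - f t / g t| <= e by near: t.
  by rewrite c0 sub0r normrN normrM normfV ler_pdivrMr// normr_gt0 gt_eqF.
Unshelve. all: by end_near. Qed.

(** If the error of hatC, scaled by sqrt t, converges weakly and has uniformly integrable squares,
    its first two moments converge; they determine the mean and the variance of hatC, and all
    asymptotic statements about hatC follow. *)
Section estimator.
Context d (T : measurableType d) (R : realType) (P : probability T R).
Context d' (T' : measurableType d') (P' : probability T' R).
Context (hatC : R -> T -> R) (C : R) (W : T' -> R) (kappa : R).
Hypothesis mhatC : forall t, measurable_fun setT (hatC t).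
Hypotheses (C0 : 0 < C) (mW : measurable_fun setT W).

Let V t w := Num.sqrt t * (hatC t w - C).

Hypothesis VW : wcvg (@pinfty_nbhs R) P P' V W.
Hypothesis iW : P'.-integrable setT (EFin \o (fun w => W w ^+ 2)).
Hypotheses (EW : \int[P']_w W w = 0) (EW2 : \int[P']_w (W w ^+ 2) = kappa).
Hypothesis ui : uniformly_integrable P [set t : R | 0 <= t]
  (fun t w => t * (hatC t w - C) ^+ 2).

Let mV t : measurable_fun setT (V t).
Proof. by apply: measurable_funM => //; exact: measurable_funB. Qed.

Let V_sqr t w : 0 <= t -> V t w ^+ 2 = t * (hatC t w - C) ^+ 2.
Proof. by move=> t0; rewrite /V exprMn sqr_sqrtr. Qed.

Lemma ui_tail (e : R) : 0 < e -> \forall c \near +oo%R, forall t : R, 0 <= t ->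
  (\int[P]_w (V t w ^+ 2 * \1_[set w | c < V t w ^+ 2] w)%:E <= e%:E)%E.
Proof.
move=> e0.
have e0' : (0 < e%:E :> \bar R)%E by rewrite lte_fin.
have near_sup : \forall c \near +oo%R, (ereal_sup [set (\int[P]_(w in
    [set w | (c < `|t * (hatC t w - C) ^+ 2|)%R]) `|t * (hatC t w - C) ^+ 2|%:E)
    | t in [set t : R | (0 <= t)%R]] < e%:E)%E.
  exact: ui (open_ereal_lt' e0').
move: near_sup; apply: filterS => c /ltW Hc t t0.
apply: le_trans Hc; apply: ereal_sup_ubound; exists t => //.
rewrite integral_mkcond; apply: eq_integral => w _; rewrite patchE indicE -V_sqr//.
rewrite (ger0_norm (sqr_ge0 _)).
have -> : (w \in [set w0 | c < `|t * (hatC t w0 - C) ^+ 2|]) = (w \in [set w0 | c < V t w0 ^+ 2]).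
  by congr (w \in _); apply/seteqP; split=> x /=; rewrite -V_sqr// (ger0_norm (sqr_ge0 _)).
by case: ifP => _; rewrite ?mulr1 ?mulr0.
Qed.

Lemma integrable_scaled_sqr t : 0 <= t -> P.-integrable setT (EFin \o (fun w => V t w ^+ 2)).
Proof.
move=> t0.
have [c [c0 Hc]] : exists c : R, 0 <= c /\ forall t : R, 0 <= t ->
    (\int[P]_w (V t w ^+ 2 * \1_[set w | (c < V t w ^+ 2)%R] w)%:E <= 1%:E)%E.
  suff : \forall c \near +oo%R, 0 <= c /\ forall t : R, 0 <= t ->
    (\int[P]_w (V t w ^+ 2 * \1_[set w | (c < V t w ^+ 2)%R] w)%:E <= 1%:E)%E by move=> /filter_ex.
  near=> c; split.
    by near: c; apply: nbhs_pinfty_ge; exact: num_real.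
  by near: c; exact: ui_tail.
have mt := measurable_tail c (mV t).
apply/integrableP; split; first by apply/measurable_EFinP; exact: measurable_funX.
apply: (@le_lt_trans _ _ (\int[P]_w (c%:E + (V t w ^+ 2 * \1_[set w | (c < V t w ^+ 2)%R] w)%:E))%E).
  apply: ge0_le_integral => //.
  - by apply/measurable_EFinP; apply: measurableT_comp => //; exact: measurable_funX.
  - by apply: emeasurable_funD => //; exact/measurable_EFinP.
  - move=> w _ /=; rewrite -EFinD lee_fin ger0_norm ?sqr_ge0// indicE.
    case: (boolP (_ \in _)) => [_|]; first by rewrite mulr1 lerDr.
    by rewrite notin_setE/= mulr0 addr0 => /negP; rewrite -leNgt.
rewrite ge0_integralD//; last 2 first.
- by move=> w _; rewrite lee_fin tail_integrand_ge0.
- exact/measurable_EFinP.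
rewrite integral_cst// [X in (_ * X)%E](_ : _ = 1%E); last exact: probability_setT.
by rewrite mule1; apply: (@le_lt_trans _ _ (c%:E + 1%:E)%E); [rewrite leeD2l// Hc|rewrite -EFinD ltry].
Unshelve. all: by end_near. Qed.

Let near_ge0 : \forall t \near +oo%R, (0 : R) <= t.
Proof. by apply: nbhs_pinfty_ge; exact: num_real. Qed.

Let near_gt0 : \forall t \near +oo%R, (0 : R) < t.
Proof. by apply: nbhs_pinfty_gt; exact: num_real. Qed.

Let integrable_near : \forall t \near +oo%R, P.-integrable setT (EFin \o (fun w => V t w ^+ 2)).
Proof. by move: near_ge0; apply: filterS => t; exact: integrable_scaled_sqr. Qed.

Let ui_tail2 (e : R) : 0 < e ->
  \forall c \near +oo%R, \forall t \near +oo%R, tail2 P (V t) c <= e.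
Proof.
move=> e0; have := ui_tail e0; apply: filterS => c Hc.
move: near_ge0; apply: filterS => t t0.
rewrite -lee_fin -EFin_Rintegral; first exact: Hc.
by apply: integrable_tail => //; exact: integrable_scaled_sqr.
Qed.

Let mean t := \int[P]_w V t w.
Let mean2 t := \int[P]_w (V t w ^+ 2).

Let mean_cvg : mean t @[t --> +oo%R] --> 0.
Proof. by rewrite -EW; exact: (wcvg_expectation_ui mV mW VW integrable_near iW ui_tail2). Qed.

Let mean2_cvg : mean2 t @[t --> +oo%R] --> kappa.
Proof.
by rewrite -EW2; exact: (wcvg_expectation_sqr_ui mV mW VW integrable_near iW ui_tail2).
Qed.

Let hatCE t w : 0 < t -> hatC t w = C + (Num.sqrt t)^-1 * V t w.
Proof.
move=> t0; rewrite /V mulKf ?gt_eqF ?sqrtr_gt0//.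
by rewrite addrC subrK.
Qed.

Let integrable_scaled t : 0 <= t -> P.-integrable setT (EFin \o V t).
Proof.
move=> t0; apply: (@integrable_of_quadratic _ _ _ _ id) => // [|y|]; [exact: mV| |exact: integrable_scaled_sqr].
exact: norm_le_quadratic.
Qed.

Lemma expectation_estimator t : 0 < t ->
  ('E_P[hatC t] = (C + (Num.sqrt t)^-1 * mean t)%:E)%E.
Proof.
move=> t0; have iV := integrable_scaled (ltW t0).
have i2 := integrableZl measurableT (Num.sqrt t)^-1 iV.
have i1 : P.-integrable setT (EFin \o (fun _ : T => C)).
  exact: finite_measure_integrable_cst.
rewrite unlock; transitivity (\int[P]_w (C + (Num.sqrt t)^-1 * V t w)%:E)%E.
  by apply: eq_integral => w _ /=; rewrite hatCE.
rewrite EFin_Rintegral; last exact: (integrableD measurableT i1 i2).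
by rewrite RintegralD// RintegralZl// Rintegral_cst_prob.
Qed.

Lemma variance_estimator t : 0 < t -> ('V_P[hatC t] = (t^-1 * (mean2 t - mean t ^+ 2))%:E)%E.
Proof.
move=> t0; have t0' := ltW t0.
have st : Num.sqrt t != 0 by rewrite gt_eqF// sqrtr_gt0.
have tE : (Num.sqrt t)^-1 ^+ 2 = t^-1 by rewrite exprVn sqr_sqrtr.
have i1 : P.-integrable setT (EFin \o (fun _ : T => t^-1 * mean t ^+ 2)).
  exact: finite_measure_integrable_cst.
have i2 := integrableZl measurableT (- 2 * t^-1 * mean t) (integrable_scaled t0').
have i3 := integrableZl measurableT t^-1 (integrable_scaled_sqr t0').
have i12 := integrableD measurableT i1 i2.
rewrite /variance unlock expectation_estimator//= unlock.
transitivity (\int[P]_w (t^-1 * mean t ^+ 2 + - 2 * t^-1 * mean t * V t w + t^-1 * V t w ^+ 2)%:E)%E.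
  apply: eq_integral => w _ /=.
  rewrite [X in X%:E = _](_ : _ = (hatC t w - (C + (Num.sqrt t)^-1 * mean t)) ^+ 2)//.
  rewrite hatCE// -tE; congr EFin; ring.
rewrite EFin_Rintegral; last exact: (integrableD measurableT i12 i3).
have E2 : \int[P]_w (- 2 * t^-1 * mean t * V t w) = - 2 * t^-1 * mean t * mean t.
  by rewrite RintegralZl//; exact: integrable_scaled.
have E3 : \int[P]_w (t^-1 * V t w ^+ 2) = t^-1 * mean2 t.
  by rewrite RintegralZl//; exact: integrable_scaled_sqr.
rewrite RintegralD// RintegralD// E2 E3 Rintegral_cst_prob; congr EFin; ring.
Qed.

Let inv_sqrt_cvg : (Num.sqrt t)^-1 @[t --> +oo%R] --> (0 : R).
Proof.
apply/cvgrPdist_le => e e0; near=> t.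
have t0 : 0 < t by near: t; exact: near_gt0.
have te : e ^- 2 <= t by near: t; apply: nbhs_pinfty_ge; exact: num_real.
rewrite sub0r normrN gtr0_norm ?invr_gt0 ?sqrtr_gt0//.
rewrite -[leRHS]invrK lef_pV2 ?posrE ?invr_gt0 ?sqrtr_gt0//.
have -> : e^-1 = Num.sqrt (e ^- 2).
  by rewrite -exprVn sqrtr_sqr ger0_norm// invr_ge0 ltW.
exact: ler_wsqrtr.
Unshelve. all: by end_near. Qed.

Let expectation_cvg : C + (Num.sqrt t)^-1 * mean t @[t --> +oo%R] --> C.
Proof.
have cv : (Num.sqrt t)^-1 * mean t @[t --> +oo%R] --> (0 * 0 : R).
  exact: (cvgM inv_sqrt_cvg mean_cvg).
rewrite mulr0 in cv; rewrite -[X in _ --> X]addr0.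
exact: (cvgD (cvg_cst C) cv).
Qed.

Lemma estimator_mean : ('E_P[hatC t])%E @[t --> +oo%R] --> C%:E.
Proof.
have cv : (C + (Num.sqrt t)^-1 * mean t)%:E @[t --> +oo%R] --> C%:E.
  by apply: cvg_EFin; [exact: nearW|exact: expectation_cvg].
apply: cvg_trans cv; apply: near_eq_cvg.
by move: near_gt0; apply: filterS => t t0; rewrite expectation_estimator.
Qed.

Lemma estimator_unbiased : asymptotically_unbiased P hatC C.
Proof.
have cv : ((Num.sqrt t)^-1 * mean t)%:E @[t --> +oo%R] --> 0%:E.
  apply: cvg_EFin; first exact: nearW.
  by rewrite -[X in _ --> X](mulr0 (0 : R)); exact: (cvgM inv_sqrt_cvg mean_cvg).
apply: cvg_trans cv; apply: near_eq_cvg.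
move: near_gt0; apply: filterS => t t0; rewrite expectation_estimator//.
by rewrite -EFinB; congr EFin; ring.
Qed.

Lemma estimator_variance_fin : \forall t \near +oo%R, ('V_P[hatC t])%E \is a fin_num.
Proof. by move: near_gt0; apply: filterS => t t0; rewrite variance_estimator. Qed.

Let variance_cvg : mean2 t - mean t ^+ 2 @[t --> +oo%R] --> kappa.
Proof.
rewrite -[X in _ --> X]subr0 -[X in _ - X](mulr0 (0 : R)).
exact: (cvgB mean2_cvg (cvgM mean_cvg mean_cvg)).
Qed.

Lemma estimator_variance : sim_const (fun t => fine 'V_P[hatC t]) kappa (fun t => t^-1).
Proof.
apply: sim_const_of_cvg.
  by move: near_gt0; apply: filterS => t t0; rewrite invr_gt0.
apply: cvg_trans variance_cvg; apply: near_eq_cvg.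
move: near_gt0; apply: filterS => t t0; rewrite variance_estimator//=.
by rewrite invrK mulrAC mulVf ?mul1r// gt_eqF.
Qed.

Lemma estimator_CoVar : sim_const (fun t => CoVar P (hatC t)) (Num.sqrt kappa / C)
  (fun t => (Num.sqrt t)^-1).
Proof.
apply: sim_const_of_cvg.
  by move: near_gt0; apply: filterS => t t0; rewrite invr_gt0 sqrtr_gt0.
have cs : Num.sqrt (mean2 t - mean t ^+ 2) @[t --> +oo%R] --> Num.sqrt kappa.
  exact: (continuous_cvg _ (@sqrt_continuous R kappa) variance_cvg).
have Cn0 : C != 0 by rewrite gt_eqF.
apply: cvg_trans (cvgM cs (cvgV Cn0 expectation_cvg)); apply: near_eq_cvg.
move: near_gt0; apply: filterS => t t0.
rewrite /CoVar variance_estimator// expectation_estimator//=.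
rewrite sqrtrM ?invr_ge0 ?(ltW t0)// sqrtrV ?(ltW t0)// invrK.
by rewrite [RHS]mulrC !mulrA divff ?mul1r// gt_eqF// sqrtr_gt0.
Qed.

(** Chebyshev's inequality for the scaled error, whose second moment is bounded. *)
Lemma estimator_consistent : consistent P hatC C.
Proof.
move=> eps eps0; apply/fine_cvgP; split.
  by apply: nearW => t; apply: fin_num_measure; apply: (measurable_dist_gt _ (mhatC t) (measurable_cst C)).
apply/cvgrPdist_le => e e0.
have k1 : 0 < kappa + 1.
  by rewrite ltr_pwDr// -EW2; apply: Rintegral_ge0 => w _; exact: sqr_ge0.
have /cvgrPdist_le/(_ 1 ltr01) cv2 := mean2_cvg.
near=> t.
have t0 : 0 < t by near: t; exact: near_gt0.
have mA : measurable [set w | eps < `|hatC t w - C|].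
  exact: (measurable_dist_gt _ (mhatC t) (measurable_cst C)).
rewrite sub0r normrN ger0_norm /= ?fine_ge0//.
have te : (kappa + 1) / (eps ^+ 2 * e) <= t by near: t; apply: nbhs_pinfty_ge; exact: num_real.
have k2 : mean2 t <= kappa + 1.
  have : `|kappa - mean2 t| <= 1 by near: t.
  by move=> /ler_normlP[? ?]; lra.
apply: (@le_trans _ _ (mean2 t / (Num.sqrt t * eps) ^+ 2)).
  apply: prob_le_second_moment => //.
  - by rewrite mulr_gt0 ?sqrtr_gt0.
  - by apply: integrable_scaled_sqr; exact: ltW.
  move=> w /= H; rewrite /V !exprMn ler_wpM2l ?sqr_ge0// -[leRHS]real_normK ?num_real//.
  by rewrite lerXn2r ?nnegrE// ltW.
rewrite exprMn sqr_sqrtr ?(ltW t0)// ler_pdivrMr ?mulr_gt0 ?exprn_gt0//.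
apply: (le_trans k2); have -> : e * (t * eps ^+ 2) = t * (eps ^+ 2 * e) by ring.
by move: te; rewrite ler_pdivrMr ?mulr_gt0 ?exprn_gt0.
Unshelve. all: by end_near. Qed.

End estimator.

(** * The sample coefficient of variation *)

(** The centered normal laws, the point mass at 0 included, are the images of the standard one
    under scaling. *)
Lemma scaled_normal_law (R : realType) (v : R) (A : set R) : 0 <= v -> measurable A ->
  normal_prob 0 1 [set y : R | A (Num.sqrt v * y)] = normal_law 0 v A.
Proof.
move=> v0 mA; rewrite /normal_law; case: eqP => [->|/eqP vn0].
  rewrite sqrtr0 diracE; case: (boolP (0 \in A)) => [|]; rewrite ?inE ?notin_setE => A0.
    rewrite (_ : [set y | _] = setT); first exact: probability_setT.
    by apply/seteqP; split=> y //= _; rewrite mul0r.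
  rewrite (_ : [set y | _] = set0); first exact: measure0.
  by apply/seteqP; split=> y //=; rewrite mul0r.
rewrite -(@normal_prob_affine R 0 (Num.sqrt v) A)//; last first.
  by rewrite gt_eqF// sqrtr_gt0 lt_neqAle eq_sym vn0.
by congr (normal_prob 0 1 _); apply/seteqP; split=> y /=; rewrite add0r.
Qed.

(** The first part of the theorem speaks of any pair with the prescribed laws; the second part does
    not mention the limit variable, so that one pair has to be constructed, on the product of the
    space of Lambda with the standard normal law. *)
Lemma exists_limit_pair d (T : measurableType d) (R : realType) (Q : probability T R)
    (L : {RV Q >-> R}) (v : R) :
  Q [set w | 0 < L w] = 1%E -> ('E_Q[fun w => ((L w)^-1)%R] < +oo)%E -> 0 <= v ->
  exists (d2 : measure_display) (T2 : measurableType d2) (P2 : probability T2 R)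
    (Z L2 : {RV P2 >-> R}),
  [/\ same_law L2 L,
      forall A : set R, measurable A -> distribution P2 Z A = normal_law 0 v A &
      indep_RV P2 Z L2] /\
  [/\ P2.-integrable setT (EFin \o (fun w => (Z w / Num.sqrt (L2 w)) ^+ 2)),
      \int[P2]_w (Z w / Num.sqrt (L2 w)) = 0 &
      \int[P2]_w ((Z w / Num.sqrt (L2 w)) ^+ 2) = v * fine 'E_Q[fun w => ((L w)^-1)%R]].
Proof.
move=> L0 invL v0.
pose G : probability (measurableTypeR R) R := normal_prob 0 1.
pose P2 : probability (T * measurableTypeR R)%type R := (Q \x G)%E.
have mid : measurable_fun [set: measurableTypeR R] (fun y : measurableTypeR R => y : R).
  exact: measurable_id.
pose f (z : T * measurableTypeR R) : R := Num.sqrt v * z.2.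
pose l (z : T * measurableTypeR R) : R := L z.1.
have mf : measurable_fun setT f by exact: (@measurable_pairZ _ T R _ _ id (Num.sqrt v) mid).
have ml : measurable_fun setT l by exact: measurable_pairL.
have [Z ZE] := exists_RV P2 mf; have [L2 LE] := exists_RV P2 ml.
have i1 := integrable_normal_id R; have i2 := integrable_normal_sqr R.
have e1 := Rintegral_normal_id R; have e2 := Rintegral_normal_sqr R.
exists _, _, P2, Z, L2; rewrite ZE LE; split; split.
- move=> A mA; rewrite /distribution /pushforward LE; exact: pair_lawL.
- move=> A mA; rewrite -scaled_normal_law// /distribution /pushforward ZE.
  exact: (@pair_lawZ _ _ _ Q _ _ G id (Num.sqrt v) mid).
- exact: (@pair_indep _ _ _ Q L _ _ G id (Num.sqrt v) mid).
- exact: (@integrable_pair_sqr _ _ _ Q L _ _ G id (Num.sqrt v) mid i2 e2 L0 invL).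
- exact: (@pair_mean _ _ _ Q L _ _ G id (Num.sqrt v) mid i1 i2 e1 e2 L0 invL).
- have := @pair_second_moment _ _ _ Q L _ _ G id (Num.sqrt v) mid i2 e2 L0 invL.
  by rewrite sqr_sqrtr// /Rintegral => ->.
Qed.

Theorem mainTheorem12 (R : realType)
  (d : measure_display) (T : measurableType d) (P : probability T R)
  (X : {RV P >-> R}) (Xs : nat -> {RV P >-> R}) (N : R -> {RV P >-> nat})
  (d' : measure_display) (T' : measurableType d') (Q : probability T' R)
  (L : {RV Q >-> R})
  (X_gt0 : P [set w | 0 < X w] = 1%E)
  (X_nondegenerate : (0 < 'V_P[X])%E)
  (Xs_iid : iid_copies X Xs)
  (N_counting : counting_process N)
  (N_indep : process_indep N Xs)
  (mu4_fin : ('E_P[fun w => (X w ^+ 4)%R] < +oo)%E)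
  (N_average : D_averages N L) :
  let mu1 := moment P X 1 in
  let sigma2 := fine 'V_P[X] in
  let v := sigma_star2 P X * mu1 ^+ 2 / (4 * sigma2) in
  let hatC := sample_CoVar (fun i => Xs i : T -> R) (fun t => N t : T -> nat) in
  let EinvL := fine 'E_Q[fun w => ((L w)^-1)%R] in
  (forall (d2 : measure_display) (T2 : measurableType d2)
      (P2 : probability T2 R) (Z L2 : {RV P2 >-> R}),
    same_law L2 L ->
    (forall A : set R, measurable A ->
       distribution P2 Z A = normal_law 0 v A) ->
    indep_RV P2 Z L2 ->
    cvg_in_distribution P P2
      (fun t w => Num.sqrt t * (hatC t w - CoVar P X))
      (fun w => Z w / Num.sqrt (L2 w))) /\
  (('E_Q[fun w => ((L w)^-1)%R] < +oo)%E ->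
   uniformly_integrable P [set t : R | 0 <= t]
     (fun t w => t * (hatC t w - CoVar P X) ^+ 2) ->
   ('E_P[hatC t])%E @[t --> +oo%R] --> (CoVar P X)%:E /\
   (\forall t \near +oo%R, ('V_P[hatC t])%E \is a fin_num) /\
   sim_const (fun t => fine 'V_P[hatC t])
     (sigma_star2 P X * mu1 ^+ 2 * EinvL / (4 * sigma2))
     (fun t => t^-1) /\
   sim_const (fun t => CoVar P (hatC t))
     (sigma_star P X * mu1 ^+ 2 * Num.sqrt EinvL / (2 * sigma2))
     (fun t => (Num.sqrt t)^-1) /\
   consistent P hatC (CoVar P X) /\
   asymptotically_unbiased P hatC (CoVar P X)).
Proof.
move=> mu1 sigma2 v hatC EinvL.
have [_ L_gt0] := N_average.
have v0 : 0 <= v by exact: limit_variance_ge0.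
have mhatC t : measurable_fun setT (hatC t) by exact: measurable_sample_CoVar.
split=> [d2 T2 P2 Z L2 LL ZN ind|invL ui].
  apply: cvg_in_distribution_of_wcvg.
  - by move=> t; exact: measurable_sample_CoVar_scaled.
  - exact: measurable_ratio.
  - exact: (sample_CoVar_wcvg X_gt0 X_nondegenerate Xs_iid mu4_fin N_indep N_average).
have [d2 [T2 [P2 [Z [L2 [[LL ZN ind] [iW EW EW2]]]]]]] := exists_limit_pair L_gt0 invL v0.
have VW := sample_CoVar_wcvg X_gt0 X_nondegenerate Xs_iid mu4_fin N_indep N_average LL ZN ind.
have mW : measurable_fun setT (fun w => Z w / Num.sqrt (L2 w)) by exact: measurable_ratio.
have C0 : 0 < CoVar P X by exact: CoVar_gt0.
have m1 : 0 < mu1 by exact: (moment1_gt0 X_gt0).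
have s20 : 0 < sigma2 by exact: variance_gt0.
have c1 : sigma_star2 P X * mu1 ^+ 2 * EinvL / (4 * sigma2) = v * EinvL.
  by rewrite /v mulrAC.
have c2 : sigma_star P X * mu1 ^+ 2 * Num.sqrt EinvL / (2 * sigma2) =
    Num.sqrt (v * EinvL) / CoVar P X.
  have s40 : 0 < 4 * sigma2 by rewrite mulr_gt0.
  have ss0 : 0 <= sigma_star2 P X.
    by move: v0; rewrite /v -mulrA pmulr_lge0// divr_gt0// exprn_gt0.
  have sq4 : Num.sqrt 4 = 2 :> R by rewrite (_ : 4 = 2 ^+ 2) ?sqrtr_sqr ?ger0_norm//; ring.
  have sv : Num.sqrt v = sigma_star P X * mu1 / (2 * Num.sqrt sigma2).
    rewrite /v sqrtrM; last by apply: mulr_ge0 => //; exact: sqr_ge0.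
    rewrite (sqrtrM _ ss0) sqrtr_sqr gtr0_norm// sqrtrV ?(ltW s40)//.
    by rewrite (@sqrtrM _ 4)// sq4.
  rewrite sqrtrM// sv CoVarE -/sigma2 -/mu1.
  rewrite -[in LHS](sqr_sqrtr (ltW s20)).
  by field; rewrite !gt_eqF// sqrtr_gt0.
rewrite c1 c2; split; first exact: (estimator_mean mhatC mW VW iW EW ui).
split; first exact: (estimator_variance_fin mhatC ui).
split; first exact: (estimator_variance mhatC mW VW iW EW EW2 ui).
split; first exact: (estimator_CoVar mhatC C0 mW VW iW EW EW2 ui).
split; first exact: (estimator_consistent mhatC mW VW iW EW2 ui).
exact: (estimator_unbiased mhatC mW VW iW EW ui).
Qed.
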